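(* Let $(\Omega,\mathcal{F},\mathbb{P})$ be a complete probability space, $t_0<T$, $x_0$ a random variable and $a,b$ stochastic processes on $[t_0,T]$, and let $x(t,\omega)=x_0(\omega)\mathrm{e}^{\int_{t_0}^t a(s,\omega)\mathrm{d} s}+\int_{t_0}^t b(s,\omega)\mathrm{e}^{\int_s^t a(r,\omega)\mathrm{d} r}\mathrm{d} s$. Assume: (H1) $a,b\in \mathrm{L}^2([t_0,T]\times\Omega)$ and $x_0\in \mathrm{L}^2(\Omega)$; (H2) for every $N\ge1$, $x_0$, $\eta_1$ and $(\xi_1,\ldots,\xi_N,\eta_2,\ldots,\eta_N)$ are absolutely continuous and independent; (H3) the density $f_{\eta_1}$ of $\eta_1$ is Lipschitz on $\mathbb{R}$; (H4) $\xi_1,\xi_2,\ldots$ have support in $[-A,A]$ for some $A>0$, and $\psi_1>0$ on $(t_0,T)$. Then for each fixed $t\in(t_0,T]$, the sequence \[ f_1^N(x,t)=\int_{\mathbb{R}^{2N}} f_0\Big(x\,\mathrm{e}^{-K_a(t,\pmb{\xi}_N)}-\int_{t_0}^t S_b(s,\pmb{\eta}_N)\mathrm{e}^{-K_a(s,\pmb{\xi}_N)}\,\mathrm{d} s\Big)f_{\pmb{\xi}_N,\pmb{\eta}_N}(\pmb{\xi}_N,\pmb{\eta}_N)\,\mathrm{e}^{-K_a(t,\pmb{\xi}_N)}\,\mathrm{d} \pmb{\xi}_N\,\mathrm{d} \pmb{\eta}_N \] (where $f_0$ is the density of $x_0$) converges in $\mathrm{L}^\infty(J)$, for every bounded set $J\subseteq\mathbb{R}$,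 to a probability density $f_1(\cdot,t)$ of $x(t,\cdot)$.
   Context: Karhunen–Loève expansions: for $a\in \mathrm{L}^2([t_0,T]\times\Omega)$ write $a(t,\omega)=\mu_a(t)+\sum_{j=1}^\infty\sqrt{\nu_j}\,\phi_j(t)\xi_j(\omega)$ (convergence in $\mathrm{L}^2([t_0,T]\times\Omega)$), where $\mu_a(t)=\mathbb{E}[a(t)]$, $\{(\nu_j,\phi_j)\}$ are the (nonnegative) eigenvalue/eigenfunction pairs of the covariance operator $\mathcal{C}f(t)=\int_{t_0}^T\mathrm{Cov}[a(t),a(s)]f(s)\,\mathrm{d} s$ on $\mathrm{L}^2([t_0,T])$ with $\{\phi_j\}$ an orthonormal basis, and $\xi_j$ are zero-mean, unit-variance, pairwise uncorrelated random variables. Similarly $b(t,\omega)=\mu_b(t)+\sum_{i=1}^\infty\sqrt{\gamma_i}\,\psi_i(t)\eta_i(\omega)$; the condition $\psi_1>0$ presupposes that $b$ has at least one nonzero eigenvalue (i.e. $b(t,\omega)\ne\mu_b(t)$), with $\gamma_1>0$. Pairs may be enumerated in any order; if only finitely many eigenvalues are nonzero, vectors stop at that number. $\pmb{\xi}_N=(\xi_1,\ldots,\xi_N)$, $\pmb{\eta}_N=(\eta_1,\ldots,\eta_N)$, $K_a(t,\pmb{\xi}_N)=\int_{t_0}^t\big(\mu_a(s)+\sum_{j=1}^N\sqrt{\nu_j}\phi_j(s)\xi_j\big)\mathrm{d} s$, $S_b(s,\pmb{\eta}_N)=\mu_b(s)+\sum_{i=1}^N\sqrt{\gamma_i}\psi_i(s)\eta_i$,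 and $f_{\pmb{\xi}_N,\pmb{\eta}_N}$ is the joint density of $(\xi_1,\ldots,\xi_N,\eta_1,\ldots,\eta_N)$. (Under the hypotheses this $f_1^N$ equals, via a change of variables isolating $\eta_1$, an integral expression involving $f_{\eta_1}$.) *)

(* Defs.v *)
From HB Require Import structures.
From mathcomp Require Import all_boot all_order all_algebra.
From mathcomp Require Import all_classical all_reals all_analysis.
Set Implicit Arguments.
Unset Strict Implicit.
Unset Printing Implicit Defensive.
Import Order.TTheory GRing.Theory Num.Theory.
Local Open Scope classical_set_scope.
Local Open Scope ring_scope.

Section Defs.
Context {R : realType} {d : measure_display} {Omega : measurableType d}.
Variable P : probability Omega R.

(** Number of (nonzero) terms in a KL expansion: [None] = infinitely many,
    [Some m] = exactly m. Index j (0-based) corresponds to the paper's j+1. *)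
Definition in_range (L : option nat) (j : nat) : bool :=
  if L is Some m then (j < m)%N else true.

(** Length of the truncated vector (xi_1,...,xi_N): vectors stop at L. *)
Definition trunc_len (L : option nat) (N : nat) : nat :=
  if L is Some m then minn N m else N.

(** Iterated Lebesgue integral over R^n (n.-tuple R), first coordinate
    outermost.  For nonnegative measurable integrands it coincides (Tonelli)
    with the integral w.r.t. n-dimensional Lebesgue measure. *)
Fixpoint iint (n : nat) : (n.-tuple R -> \bar R) -> \bar R :=
  match n return (n.-tuple R -> \bar R) -> \bar R with
  | 0 => fun f => f [tuple]
  | n'.+1 => fun f =>
      (\int[@lebesgue_measure R]_x iint (fun v : n'.-tuple R => f (cons_tuple x v)))%E
  end.

Definition is_density (X : Omega -> R) (f : R -> R) : Prop :=
  [/\ measurable_fun setT X,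
      (forall x, 0 <= f x),
      measurable_fun setT f &
      forall B : set R, measurable B ->
        P (X @^-1` B) = (\int[@lebesgue_measure R]_(y in B) (f y)%:E)%E].

Definition is_joint_density (n1 n2 : nat)
    (X : Omega -> n1.-tuple R * n2.-tuple R)
    (f : n1.-tuple R -> n2.-tuple R -> R) : Prop :=
  [/\ measurable_fun setT X,
      (forall u w, 0 <= f u w),
      measurable_fun setT (fun z : n1.-tuple R * n2.-tuple R => f z.1 z.2) &
      forall B : set (n1.-tuple R * n2.-tuple R), measurable B ->
        P (X @^-1` B) =
        iint (fun u => iint (fun w => ((\1_B (u, w) : R) * f u w)%:E))].

Definition abs_continuous (X : Omega -> R) : Prop :=
  exists f, is_density X f.

Definition abs_continuous_vec (n1 n2 : nat)
    (X : Omega -> n1.-tuple R * n2.-tuple R) : Prop :=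
  exists f, is_joint_density X f.

Definition independent3 {d1 d2 d3} {T1 : measurableType d1}
    {T2 : measurableType d2} {T3 : measurableType d3}
    (X1 : Omega -> T1) (X2 : Omega -> T2) (X3 : Omega -> T3) : Prop :=
  forall (A1 : set T1) (A2 : set T2) (A3 : set T3),
    measurable A1 -> measurable A2 -> measurable A3 ->
    P (X1 @^-1` A1 `&` X2 @^-1` A2 `&` X3 @^-1` A3) =
    (P (X1 @^-1` A1) * P (X2 @^-1` A2) * P (X3 @^-1` A3))%E.

Definition complete_prob : Prop := measure_is_complete P.

Definition restr (t0 T : R) (a : R -> Omega -> R) (z : R * Omega) : R :=
  if (t0 <= z.1 <= T) then a z.1 z.2 else 0.

Definition L2_process (t0 T : R) (a : R -> Omega -> R) : Prop :=
  measurable_fun setT (restr t0 T a) /\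
  (\int[(@lebesgue_measure R \x P)%E]_z ((restr t0 T a z) ^+ 2)%:E < +oo)%E.

Definition L2_rv (X : Omega -> R) : Prop :=
  measurable_fun setT X /\ (\int[P]_w ((X w) ^+ 2)%:E < +oo)%E.

Definition mean_fun (a : R -> Omega -> R) (t : R) : R :=
  \int[P]_(w in setT) a t w.

Definition cov_fun (a : R -> Omega -> R) (t s : R) : R :=
  \int[P]_(w in setT) ((a t w - mean_fun a t) * (a s w - mean_fun a s)).

Definition KL_sum (a : R -> Omega -> R) (nu : nat -> R) (phi : nat -> R -> R)
    (n : nat) (v : n.-tuple R) (t : R) : R :=
  mean_fun a t + \sum_(j < n) Num.sqrt (nu j) * phi j t * tnth v j.

Definition KL_expansion (t0 T : R) (a : R -> Omega -> R) (L : option nat)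
    (nu : nat -> R) (phi : nat -> R -> R) (xi : nat -> Omega -> R) : Prop :=
  [/\ (forall j, in_range L j -> 0 < nu j),
      (forall j, in_range L j -> measurable_fun `[t0, T]%classic (phi j)) &
   [/\
      (forall i j, in_range L i -> in_range L j ->
         \int[@lebesgue_measure R]_(s in `[t0, T]%classic) (phi i s * phi j s)
           = (i == j)%:R),
      (forall j, in_range L j ->
         {ae @lebesgue_measure R, forall t, `[t0, T]%classic t ->
           \int[@lebesgue_measure R]_(s in `[t0, T]%classic) (cov_fun a t s * phi j s)
             = nu j * phi j t}) &
   [/\
      (forall j, in_range L j ->
         measurable_fun setT (xi j) /\ (\int[P]_w (xi j w)%:E = 0)%E),
      (forall i j, in_range L i -> in_range L j ->
         (\int[P]_w (xi i w * xi j w)%:E = (i == j)%:R%:E)%E) &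
      (fun n : nat => (
         \int[(@lebesgue_measure R \x P)%E]_z
           ((restr t0 T (fun s w => a s w
               - KL_sum a nu phi
                   (mktuple (fun j : 'I_(trunc_len L n) => xi j w)) s) z) ^+ 2)%:E)%E)
        @ \oo --> 0%E ]]].

Definition vec (L : option nat) (xi : nat -> Omega -> R) (N : nat) (w : Omega)
  : (trunc_len L N).-tuple R :=
  mktuple (fun j : 'I_(trunc_len L N) => xi j w).

Definition vec_tail (L : option nat) (eta : nat -> Omega -> R) (N : nat)
    (w : Omega) : (trunc_len L N).-1.-tuple R :=
  mktuple (fun j : 'I_(trunc_len L N).-1 => eta j.+1 w).

Definition K_a (t0 : R) (a : R -> Omega -> R) (nu : nat -> R)
    (phi : nat -> R -> R) (n : nat) (v : n.-tuple R) (t : R) : R :=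
  \int[@lebesgue_measure R]_(s in `[t0, t]%classic) KL_sum a nu phi v s.

Definition sol (t0 : R) (x0 : Omega -> R) (a b : R -> Omega -> R)
    (t : R) (w : Omega) : R :=
  x0 w * expR (\int[@lebesgue_measure R]_(s in `[t0, t]%classic) a s w)
  + \int[@lebesgue_measure R]_(s in `[t0, t]%classic)
      (b s w * expR (\int[@lebesgue_measure R]_(r in `[s, t]%classic) a r w)).

Definition f1N (t0 : R) (a b : R -> Omega -> R)
    (La Lb : option nat) (nu gam : nat -> R) (phi psi : nat -> R -> R)
    (f0 : R -> R)
    (fj : forall N, (trunc_len La N).-tuple R -> (trunc_len Lb N).-tuple R -> R)
    (N : nat) (x t : R) : \bar R :=
  iint (fun u : (trunc_len La N).-tuple R =>
    iint (fun w : (trunc_len Lb N).-tuple R =>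
      (f0 (x * expR (- K_a t0 a nu phi u t)
           - \int[@lebesgue_measure R]_(s in `[t0, t]%classic)
               (KL_sum b gam psi w s * expR (- K_a t0 a nu phi u s)))
       * fj N u w * expR (- K_a t0 a nu phi u t))%:E)).

End Defs.

Arguments f1N {R d Omega} P t0 a b La Lb nu gam phi psi f0 fj N x t.

(* Main.v *)
(** Isolate the leading coefficient [eta 0] of [b].  Writing [K] for the
    primitive of [a], the solution at time [t] is
      [x(t) = e^(K t) (x0 + eta_0 D + E)],
    where [D > 0] is the integral of [sqrt gam_0 psi_0 e^(-K)] and [E] is the
    same integral of the rest of [b].  The truncated quantities [K_N, D_N, E_N]
    depend only on the remaining coefficients, so independence and an affine
    change of variables give
      [f_1^N(x) = E[g ((x e^(-K_N) - E_N - x0) / D_N) e^(-K_N) / D_N]]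
    with [g] the density of [eta_0].  As the [xi_j] are bounded and the [nu_j]
    are summable, [K_N] is bounded and [D_N] is bounded away from 0 uniformly
    in [N]; since [g] is bounded and Lipschitz, [f_1^N] converges, uniformly for
    bounded [x], to the same expectation with [K, D, E], at a rate controlled by
    the L2 errors of the two expansions.  The limit is the density of [x(t)]:
    [f_1^N] is the density of the truncated solution, and one passes to the
    limit against compactly supported Lipschitz test functions. *)

Require Import Defs.
From HB Require Import structures.
From mathcomp Require Import all_boot all_order all_algebra.
From mathcomp Require Import all_classical all_reals all_analysis.
From mathcomp Require Import measurable_realfun ring lra.
Set Implicit Arguments.
Unset Strict Implicit.
Unset Printing Implicit Defensive.
Import Order.TTheory GRing.Theory Num.Theory.
Import numFieldNormedType.Exports.
Local Open Scope classical_set_scope.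
Local Open Scope ring_scope.

(** * Densities and independence *)

(** Three obstacles shape the argument. The density of [x0] appears in [f_1^N] but carries no
    regularity. Exchanging the integration over [eta 0] for one over [x0] moves the dependence on
    [x] into [g], which is Lipschitz, and bounded because it also has integral at most 1.

    The resulting kernel is Lipschitz in [(K, D, E)], but a change of [D] is multiplied by
    [|x0| + |E|], which is unbounded. The Lipschitz constant is therefore a square integrable random
    weight, and the mean of weight times error vanishes because the time-[L1] errors of both
    expansions tend to 0 in [L2] of the probability space.

    In the limit, [E] is built from [b] minus its first mode, not from the remaining coefficients.
    Independence is used only for truncations, where the vector is finite, and the limit inherits
    the law. Likewise the bound on the drift is proved first for truncations, by Parseval on each
    path, and then transferred to [a] through [L2] convergence alone. *)

Lemma pushforward_measure_exists d1 d2 (T1 : measurableType d1)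
    (T2 : measurableType d2) (R : realType) (m : {measure set T1 -> \bar R})
    (f : T1 -> T2) : measurable_fun setT f ->
  exists m' : {measure set T2 -> \bar R}, forall A, m' A = m (f @^-1` A).
Proof.
move=> mf.
by unshelve eexists; first by refine [the {measure set T2 -> \bar R} of pushforward m f].
Qed.

(** The right-hand side is a measure in [A]. On a half-open interval the preimage has its length
    divided by [c], so the measure gives back the length, and uniqueness of Lebesgue measure
    concludes. *)
Lemma lebesgue_measure_affine (R : realType) (c r : R) (A : set R) :
  0 < c -> measurable A ->
  @lebesgue_measure R A =
  (c%:E * @lebesgue_measure R ((fun x => c * x + r)%R @^-1` A))%E.
Proof.
move=> c0 mA.
have mf : measurable_fun setT (fun x : measurableTypeR R => c * x + r : measurableTypeR R).
  by apply: measurable_funD => //; apply: measurable_funM.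
have [m' m'E] := pushforward_measure_exists (@lebesgue_measure R) mf.
have mE B : mscale (NngNum (ltW c0)) m' B =
    (c%:E * @lebesgue_measure R ((fun x => c * x + r)%R @^-1` B))%E.
  by rewrite /mscale m'E.
rewrite -mE; apply: lebesgue_measure_unique => //.
move=> _ [[a b]] _ <-; apply: (etrans _ (esym (mE _))).
rewrite (_ : _ @^-1` _ = `](a - r) / c, (b - r) / c]%classic); last first.
  apply/seteqP; split => x /=; rewrite !in_itv/= ltr_pdivrMr// ler_pdivlMr//;
    rewrite ltrBlDr lerBrDr (mulrC x); exact.
rewrite !lebesgue_measure_itv/= !lte_fin ltr_pM2r ?invr_gt0// ltrD2r.
case: ifPn => _; last by rewrite mule0.
by rewrite -!EFinD -EFinM; congr (_%:E); field; rewrite gt_eqF.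
Qed.

Lemma ge0_integral_affine (R : realType) (c r : R) (f : R -> \bar R) :
  0 < c -> measurable_fun setT f -> (forall x, 0 <= f x)%E ->
  (\int[@lebesgue_measure R]_x f (c * x + r)%R =
   c^-1%:E * \int[@lebesgue_measure R]_x f x)%E.
Proof.
move=> c0 mf f0.
have ma : measurable_fun setT (fun x : measurableTypeR R => c * x + r : measurableTypeR R).
  by apply: measurable_funD => //; apply: measurable_funM.
have [m' m'E] := pushforward_measure_exists (@lebesgue_measure R) ma.
have mE B : mscale (NngNum (ltW c0)) m' B =
    (c%:E * @lebesgue_measure R ((fun x => c * x + r)%R @^-1` B))%E.
  by rewrite /mscale m'E.
rewrite [in RHS](eq_measure_integral (mscale (NngNum (ltW c0)) m')); last first.
  move=> A mA _; apply: (etrans _ (esym (mE _))).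
  exact: lebesgue_measure_affine.
rewrite ge0_integral_mscale//= muleA -EFinM mulVf ?gt_eqF// mul1e.
rewrite [RHS](eq_measure_integral (pushforward (@lebesgue_measure R)
  (fun x : measurableTypeR R => c * x + r : measurableTypeR R))).
  by rewrite ge0_integral_pushforward.
by move=> A mA _; rewrite m'E.
Qed.

Lemma ge0_integral_opp (R : realType) (f : R -> \bar R) :
  measurable_fun setT f -> (forall x, 0 <= f x)%E ->
  (\int[@lebesgue_measure R]_x f (- x)%R = \int[@lebesgue_measure R]_x f x)%E.
Proof.
move=> mf f0.
rewrite [in RHS](eq_measure_integral
  (pushforward (@lebesgue_measure R) (-%R : _ -> measurableTypeR R))); last first.
  by move=> A mA _; apply/esym; exact: lebesgue_measureN.
by rewrite ge0_integral_pushforward.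
Qed.

Section density.
Local Open Scope ereal_scope.
Context d d' (Omega : measurableType d) (T : measurableType d') (R : realType).
Variables (P : probability Omega R) (m : {measure set T -> \bar R}).
Import HBNNSimple.

(** The hypothesis is the case of indicators. Simple functions follow by summing over level sets,
    and the general case by monotone convergence. The target [T] is arbitrary so that the lemma
    serves both real variables and pairs of tuples. *)
Lemma ge0_integral_law_density (X : Omega -> T) (f : T -> R) :
  measurable_fun setT X -> measurable_fun setT f -> (forall x, 0 <= f x)%R ->
  (forall B, measurable B -> P (X @^-1` B) = \int[m]_(y in B) (f y)%:E) ->
  forall h : T -> \bar R, measurable_fun setT h -> (forall y, 0 <= h y) ->
  \int[P]_w h (X w) = \int[m]_y (h y * (f y)%:E).
Proof.
move=> mX mf f0 PX h mh h0.
pose Z : {mfun Omega >-> T} := mfun_Sub (mem_set mX).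
have -> : \int[P]_w h (X w) = \int[distribution P Z]_y h y.
  by rewrite ge0_integral_distribution.
pose h_ := nnsfun_approx measurableT mh.
have hE x : h x = limn (fun n => (h_ n x)%:E).
  by apply/esym/cvg_lim => //; exact: cvg_nnsfun_approx.
have mh_ n : measurable_fun setT (fun y => (h_ n y)%:E * (f y)%:E).
  by apply: emeasurable_funM; exact/measurable_EFinP.
transitivity (limn (fun n => \int[distribution P Z]_y (h_ n y)%:E)).
  rewrite -monotone_convergence//.
  - by apply: eq_integral => y _; rewrite hE.
  - by move=> n; exact/measurable_EFinP.
  - by move=> n y _; rewrite lee_fin.
  - by move=> y _ i j ij; rewrite lee_fin; exact/lefP/nd_nnsfun_approx.
transitivity (limn (fun n => \int[m]_y ((h_ n y)%:E * (f y)%:E))); last first.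
  rewrite -monotone_convergence//.
  - apply: eq_integral => y _; apply/cvg_lim => //.
    by apply: cvgeZr => //; exact: cvg_nnsfun_approx.
  - by move=> n y _; rewrite mule_ge0// lee_fin.
  - move=> y _ i j ij; rewrite lee_wpmul2r ?lee_fin//.
    exact/lefP/nd_nnsfun_approx.
congr (limn _); apply/funext => n.
transitivity (\sum_(k \in range (h_ n)) (k%:E * distribution P Z (h_ n @^-1` [set k]))).
  under eq_integral do rewrite fimfunE -fsumEFin//.
  rewrite ge0_integral_fsum//; last 2 first.
  - by move=> y; exact/measurable_EFinP/measurable_funM.
  - by move=> y x _; rewrite nnfun_muleindic_ge0.
  apply: eq_fsbigr => k _; rewrite integralZl_indic_nnsfun// integral_indic//=.
  by rewrite setIT.
transitivity (\sum_(k \in range (h_ n)) \int[m]_y ((k * \1_(h_ n @^-1` [set k]) y)%:E * (f y)%:E)).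
  apply: eq_fsbigr => k; rewrite inE => -[x _ <-].
  under [RHS]eq_integral do rewrite EFinM -muleA.
  rewrite ge0_integralZl_EFin//.
  - congr (_ * _).
    have -> : distribution P Z (h_ n @^-1` [set h_ n x]) = P (X @^-1` (h_ n @^-1` [set h_ n x])) by [].
    rewrite PX// integral_mkcond; apply: eq_integral => y _.
    by rewrite patchE indicE; case: ifPn => _ /=; rewrite ?mul1e ?mul0e.
  - by move=> y _; rewrite mule_ge0// lee_fin.
  - by apply: emeasurable_funM; exact/measurable_EFinP.
rewrite -ge0_integral_fsum//.
- apply: eq_integral => y _; rewrite (fimfunE (h_ n) y) -fsumEFin//.
  rewrite ge0_mule_fsuml// => k.
  by rewrite nnfun_muleindic_ge0.
- by move=> k; apply: emeasurable_funM; apply/measurable_EFinP => //; exact: measurable_funM.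
- by move=> k y _; rewrite mule_ge0 ?lee_fin// -lee_fin nnfun_muleindic_ge0.
Qed.

End density.

Definition independent2 d d1 d2 (Omega : measurableType d)
    (T1 : measurableType d1) (T2 : measurableType d2) (R : realType)
    (P : probability Omega R) (X : Omega -> T1) (Y : Omega -> T2) :=
  forall A B, measurable A -> measurable B ->
    P (X @^-1` A `&` Y @^-1` B) = (P (X @^-1` A) * P (Y @^-1` B))%E.

Section independence.
Local Open Scope ereal_scope.
Context d d1 d2 d3 (Omega : measurableType d) (T1 : measurableType d1)
  (T2 : measurableType d2) (T3 : measurableType d3) (R : realType).
Variable P : probability Omega R.

(** Taking the first event to be everything removes [X1]. The third variable comes first in the
    result because in use it is the vector that gets frozen. *)
Lemma independent3_23 (X1 : Omega -> T1) (X2 : Omega -> T2) (X3 : Omega -> T3) :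
  independent3 P X1 X2 X3 -> independent2 P X3 X2.
Proof.
move=> H A B mA mB; have := H setT B A measurableT mB mA.
by rewrite preimage_setT setTI probability_setT mul1e setIC muleC.
Qed.

Lemma independent3_13 (X1 : Omega -> T1) (X2 : Omega -> T2) (X3 : Omega -> T3) :
  independent3 P X1 X2 X3 -> independent2 P X3 X1.
Proof.
move=> H A B mA mB; have := H B setT A mB measurableT mA.
by rewrite preimage_setT setIT probability_setT mule1 setIC muleC.
Qed.

(** For fixed [B], both sides are finite measures in [A]. They agree on rectangles, which form a
    generating family stable under intersection, hence everywhere. *)
Lemma independent3_pair (X1 : Omega -> T1) (X2 : Omega -> T2) (X3 : Omega -> T3) :
  measurable_fun setT X1 -> measurable_fun setT X2 -> measurable_fun setT X3 ->
  independent3 P X1 X2 X3 -> independent2 P (fun w => (X1 w, X3 w)) X2.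
Proof.
move=> m1 m2 m3 H A B mA mB.
have mXB : measurable (X2 @^-1` B) by rewrite -[X in measurable X]setTI; exact: m2.
have mZ : measurable_fun setT (fun w => (X1 w, X3 w)) by exact: measurable_fun_pair.
pose Z : {mfun Omega >-> (T1 * T3)%type} := mfun_Sub (mem_set mZ).
have [mu1 mu1E] := pushforward_measure_exists (mrestr P mXB) mZ.
have Pfin : P (X2 @^-1` B) \is a fin_num by exact: fin_num_measure.
have c0 : (0 <= fine (P (X2 @^-1` B)))%R by rewrite fine_ge0.
pose mu2 := mscale (NngNum c0) (distribution P Z).
suff : mu1 A = mu2 A.
  rewrite mu1E /mu2 /mscale/= /mrestr => ->.
  by rewrite fineK// muleC.
apply: (measure_unique [set A `*` B | A in measurable & B in measurable] (fun=> setT)) => //.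
- exact: measurable_prod_measurableType.
- move=> _ _ [A1 mA1 [B1 mB1 <-]] [A2 mA2 [B2 mB2 <-]].
  exists (A1 `&` A2); first exact: measurableI.
  exists (B1 `&` B2); first exact: measurableI.
  by rewrite setXI.
- by move=> _; exists setT => //; exists setT => //; rewrite setXTT.
- by rewrite bigcup_const.
- move=> _ [A1 mA1 [A3 mA3 <-]].
  rewrite mu1E /= /mscale/= fineK//.
  rewrite (_ : distribution P Z _ = P ((fun w => (X1 w, X3 w)) @^-1` (A1 `*` A3)))//.
  have E : (fun w => (X1 w, X3 w)) @^-1` (A1 `*` A3) = X1 @^-1` A1 `&` X3 @^-1` A3 by [].
  (* One use of [H] factors the triple event. A second one, with the whole space for [X2], factors
     the pair [(X1, X3)]. *)
  rewrite /mrestr E setIAC H// (muleC _ (P (X2 @^-1` B))) -muleA; congr (_ * _).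
  have := H A1 setT A3 mA1 measurableT mA3.
  by rewrite preimage_setT setIT probability_setT mule1.
- move=> k; rewrite mu1E; apply: (@le_lt_trans _ _ 1); last exact: ltry.
  by apply: probability_le1; apply: measurableI => //; rewrite preimage_setT.
Qed.

(** Independence says that the joint law is the product of the two laws, by uniqueness of the
    product measure. Tonelli then lets the second variable be averaged with the first one frozen. *)
Lemma ge0_integral_independent2 (X : Omega -> T1) (Y : Omega -> T2)
    (F : T1 * T2 -> \bar R) :
  measurable_fun setT X -> measurable_fun setT Y -> independent2 P X Y ->
  measurable_fun setT F -> (forall z, 0 <= F z) ->
  \int[P]_w F (X w, Y w) = \int[P]_w \int[P]_w' F (X w, Y w').
Proof.
move=> mX mY XY mF F0.
have mZ : measurable_fun setT (fun w => (X w, Y w)) by exact: measurable_fun_pair.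
pose X' : {mfun Omega >-> T1} := mfun_Sub (mem_set mX).
pose Y' : {mfun Omega >-> T2} := mfun_Sub (mem_set mY).
pose Z : {mfun Omega >-> (T1 * T2)%type} := mfun_Sub (mem_set mZ).
have -> : \int[P]_w F (X w, Y w) = \int[distribution P Z]_y F y.
  by rewrite ge0_integral_distribution.
rewrite (eq_measure_integral (distribution P X' \x distribution P Y')); last first.
  move=> A mA _; apply/esym; apply: product_measure_unique => // B C mB mC.
rewrite fubini_tonelli1// /fubini_F ge0_integral_distribution//.
- apply: eq_integral => w _ /=; rewrite ge0_integral_distribution//.
  exact: measurableT_comp.
- exact: measurable_fun_fubini_tonelli_F.
- by move=> y; exact: integral_ge0.
Qed.

End independence.

(** * Iterated Lebesgue integrals as integrals against a measure *)

Section sigma_finite_measure_of.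
Context d (T : measurableType d) (R : realType).
Variables (m : {measure set T -> \bar R}) (msf : sigma_finite setT m).

(** An alias of [m] that carries the proof of sigma-finiteness as an argument, so that a measure
    known only through an existential can receive the corresponding structure. *)
Definition sigma_finite_of (_ : sigma_finite setT m) : set T -> \bar R := m.

HB.instance Definition _ := Measure.on (sigma_finite_of msf).
HB.instance Definition _ :=
  Measure_isSigmaFinite.Build _ _ _ (sigma_finite_of msf) msf.

End sigma_finite_measure_of.

Section iterated_integral.
Local Open Scope ereal_scope.
Context (R : realType).

(** In dimension [n.+1] the measure is the image of Lebesgue measure times the previous one under
    [cons_tuple], and Tonelli unfolds one level of [iint]. Sigma-finiteness is kept along the
    induction because Tonelli requires it. *)
Lemma iint_measureE n :
  exists m : {sigma_finite_measure set (n.-tuple R) -> \bar R},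
  forall f : n.-tuple R -> \bar R, measurable_fun setT f ->
    (forall v, 0 <= f v) -> iint f = \int[m]_v f v.
Proof.
elim: n => [|n [m mE]].
  exists (\d_([tuple] : 0.-tuple R)) => f mf f0 /=.
  by rewrite integral_dirac// diracT mul1e.
have mc : measurable_fun setT
    (fun z : measurableTypeR R * n.-tuple R => cons_tuple z.1 z.2 : n.+1.-tuple R).
  exact: measurable_cons.
have mu : measurable_fun setT
    (fun v : n.+1.-tuple R => (thead v, behead_tuple v) : measurableTypeR R * n.-tuple R).
  apply: measurable_fun_pair; first exact: measurable_tnth.
  exact: measurable_behead.
have [m' m'E] := pushforward_measure_exists (@lebesgue_measure R \x m) mc.
have sf : sigma_finite setT m'.
  have /sigma_finiteP[F [TF ndF Foo]] := sigma_finiteT (@lebesgue_measure R).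
  have /sigma_finiteP[G [TG ndG Goo]] := sigma_finiteT m.
  (* Both exhaustions are nondecreasing, so the diagonal rectangles [F k] times [G k] already cover
     the product. Their preimages under the inverse of [cons_tuple] exhaust the tuples. *)
  exists (fun k => (fun v : n.+1.-tuple R =>
      (thead v, behead_tuple v) : measurableTypeR R * n.-tuple R) @^-1` (F k `*` G k)).
    rewrite -preimage_bigcup (_ : \bigcup_i _ = setT) ?preimage_setT//.
    apply/seteqP; split => // -[x y] _.
    have [i _ Fi] : (\bigcup_i F i) x by rewrite -TF.
    have [j _ Gj] : (\bigcup_i G i) y by rewrite -TG.
    exists (maxn i j) => //; split => /=.
    - by move: Fi; apply/subsetPset/ndF/leq_maxl.
    - by move: Gj; apply/subsetPset/ndG/leq_maxr.
  move=> k; have [mFk Fk] := Foo k; have [mGk Gk] := Goo k; split.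
    by rewrite -[X in measurable X]setTI; apply: mu => //; exact: measurableX.
  rewrite m'E (_ : _ @^-1` _ = F k `*` G k); last first.
    have bh (x : R) (v : n.-tuple R) : behead_tuple (cons_tuple x v) = v.
      exact: val_inj.
    by apply/seteqP; split => -[x v]; rewrite /preimage/= bh.
  apply: (@le_lt_trans _ _ (@lebesgue_measure R (F k) * m (G k))).
    by rewrite le_eqVlt; apply/orP; left; apply/eqP; exact: product_measure1E.
  by rewrite lte_mul_pinfty// ge0_fin_numE.
exists [the {sigma_finite_measure set (n.+1.-tuple R) -> \bar R} of sigma_finite_of sf] => f mf f0 /=.
rewrite (eq_measure_integral (pushforward (@lebesgue_measure R \x m)
    (fun z : measurableTypeR R * n.-tuple R => cons_tuple z.1 z.2 : n.+1.-tuple R))) //=.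
- rewrite ge0_integral_pushforward// preimage_setT.
  have mfc : measurable_fun setT (f \o (fun z : measurableTypeR R * n.-tuple R =>
      cons_tuple z.1 z.2 : n.+1.-tuple R)) by exact: measurableT_comp.
  rewrite (fubini_tonelli1 (f \o (fun z : measurableTypeR R * n.-tuple R =>
      cons_tuple z.1 z.2 : n.+1.-tuple R)))//; last by move=> z; exact: f0.
  apply: eq_integral => x _; rewrite mE//.
  apply: measurableT_comp => //; exact: (measurable_cons (measurable_cst _)).
- by move=> A mA _; exact: m'E.
Qed.

End iterated_integral.

(** Once the two iterated integrals are written as one integral over a product measure, the defining
    identity of a joint density is the indicator case of the statement. This is what turns [f1N]
    into an expectation. *)
Lemma ge0_integral_joint_density d (Omega : measurableType d) (R : realType)
    (P : probability Omega R) n1 n2 (X : Omega -> n1.-tuple R * n2.-tuple R)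
    (f : n1.-tuple R -> n2.-tuple R -> R) (h : n1.-tuple R -> n2.-tuple R -> R) :
  is_joint_density P X f ->
  measurable_fun setT (fun z => h z.1 z.2) -> (forall u v, 0 <= h u v) ->
  (iint (fun u => iint (fun v => (h u v * f u v)%:E)) =
   \int[P]_w (h (X w).1 (X w).2)%:E)%E.
Proof.
move=> [mX f0 mf PX] mh h0.
have [m1 m1E] := iint_measureE R n1.
have [m2 m2E] := iint_measureE R n2.
have key (k : n1.-tuple R * n2.-tuple R -> R) :
    measurable_fun setT k -> (forall z, 0 <= k z) ->
    (iint (fun u => iint (fun v => (k (u, v))%:E)) = \int[m1 \x m2]_z (k z)%:E)%E.
  move=> mk k0.
  have mkE : measurable_fun setT (EFin \o k) by exact/measurable_EFinP.
  have -> : (fun u => iint (fun v => (k (u, v))%:E)) = fubini_F m2 (EFin \o k).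
    apply/funext => u; rewrite m2E//; last by move=> v; rewrite lee_fin.
    apply/measurable_EFinP; exact: measurableT_comp.
  rewrite m1E.
  - rewrite fubini_tonelli1//= => z; by rewrite lee_fin.
  - by apply: measurable_fun_fubini_tonelli_F => //= z; rewrite lee_fin.
  - by move=> u; apply: integral_ge0 => v _; rewrite lee_fin.
rewrite (key (fun z => h z.1 z.2 * f z.1 z.2)); last 2 first.
  - exact: measurable_funM.
  - by move=> z; rewrite mulr_ge0.
under eq_integral do rewrite EFinM.
rewrite -(@ge0_integral_law_density _ _ _ _ _ P (m1 \x m2)%E X
  (fun z => f z.1 z.2) mX mf _ _ (fun z => (h z.1 z.2)%:E))//.
- move=> B mB; rewrite PX// (key (fun z => \1_B z * f z.1 z.2)); last 2 first.
  + by apply: measurable_funM.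
  + by move=> z; rewrite mulr_ge0.
  rewrite [RHS]integral_mkcond; apply: eq_integral => z _.
  by rewrite patchE indicE; case: ifPn => _ /=; rewrite ?mul1r ?mul0r.
- exact/measurable_EFinP.
- by move=> z; rewrite lee_fin.
Qed.

(** * Integrability, Cauchy-Schwarz, and measurability in a parameter *)

Lemma integrable_cst_lty d (T : measurableType d) (R : realType)
    (mu : {measure set T -> \bar R}) (D : set T) (k : R) :
  measurable D -> (mu D < +oo)%E -> mu.-integrable D (EFin \o cst k).
Proof.
move=> mD Doo; apply/integrableP; split; first exact/measurable_EFinP/measurable_cst.
by rewrite (integral_cst _ mD (`|k|%:E)) lte_mul_pinfty// lee_fin.
Qed.

Section integrable_EFin.
Context d (T : measurableType d) (R : realType).
Variables (mu : {measure set T -> \bar R}) (D : set T) (mD : measurable D).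
Implicit Types f g : T -> R.

Lemma integrableZl_EFin k f : mu.-integrable D (EFin \o f) ->
  mu.-integrable D (EFin \o (fun x => k * f x)).
Proof. exact: integrableZl. Qed.

Lemma integrableD_EFin f g : mu.-integrable D (EFin \o f) ->
  mu.-integrable D (EFin \o g) -> mu.-integrable D (EFin \o (fun x => f x + g x)).
Proof. exact: integrableD. Qed.

Lemma integrableB_EFin f g : mu.-integrable D (EFin \o f) ->
  mu.-integrable D (EFin \o g) -> mu.-integrable D (EFin \o (fun x => f x - g x)).
Proof. exact: integrableB. Qed.

End integrable_EFin.

Lemma integrable_sqr d (T : measurableType d) (R : realType)
    (mu : {measure set T -> \bar R}) (D : set T) (f : T -> R) :
  measurable D -> (mu D < +oo)%E -> measurable_fun D f ->
  (\int[mu]_(x in D) (f x ^+ 2)%:E < +oo)%E ->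
  mu.-integrable D (EFin \o f).
Proof.
move=> mD Doo mf f2oo.
have i1 : mu.-integrable D (EFin \o (fun x => 1 + f x ^+ 2)).
  rewrite (_ : _ \o _ = ((EFin \o cst 1%R) \+ (EFin \o (fun x => f x ^+ 2)%R))%E)//.
  apply: integrableD => //; first exact: integrable_cst_lty.
  apply/integrableP; split; first exact/measurable_EFinP/measurable_funX.
  under eq_integral do rewrite gee0_abs ?lee_fin ?sqr_ge0//.
  exact: f2oo.
apply: le_integrable i1 => //; first exact/measurable_EFinP.
move=> x _ /=; rewrite lee_fin [leRHS]ger0_norm ?addr_ge0 ?sqr_ge0//.
by rewrite -(real_normK (num_real (f x))); have := sqr_ge0 (`|f x| - 1); nra.
Qed.

(** Cauchy-Schwarz against the constant 1, obtained by integrating the square of [|f| - l]. If [f]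
    is not square integrable the right-hand side is infinite, since [mu D] is positive. *)
Lemma sqr_Rintegral_le d (T : measurableType d) (R : realType)
    (mu : {measure set T -> \bar R}) (D : set T) (f : T -> R) :
  measurable D -> (0 < mu D)%E -> (mu D < +oo)%E -> measurable_fun D f ->
  (((\int[mu]_(x in D) `|f x|) ^+ 2)%:E <=
     mu D * \int[mu]_(x in D) (f x ^+ 2)%:E)%E.
Proof.
move=> mD D0 Doo mf.
have [|f2oo] := leP +oo%E (\int[mu]_(x in D) (f x ^+ 2)%:E)%E.
  by rewrite leye_eq => /eqP ->; rewrite gt0_muley// leey.
have if1 := integrable_sqr mD Doo mf f2oo.
have ifa : mu.-integrable D (EFin \o (fun x => `|f x|)) by exact: integrable_norm.
have if2 : mu.-integrable D (EFin \o (fun x => f x ^+ 2)).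
  apply/integrableP; split; first exact/measurable_EFinP/measurable_funX.
  by under eq_integral do rewrite gee0_abs ?lee_fin ?sqr_ge0//.
have Dfin : mu D \is a fin_num by rewrite ge0_fin_numE// ltW.
set A := \int[mu]_(x in D) `|f x|.
set c := fine (mu D).
have c0 : 0 < c by rewrite fine_gt0// D0.
have -> : (\int[mu]_(x in D) (f x ^+ 2)%:E = (\int[mu]_(x in D) (f x ^+ 2))%:E)%E.
  by rewrite fineK//; exact: integrable_fin_num if2.
rewrite -(fineK Dfin) -EFinM lee_fin -/c.
(* The mean of [|f|], which minimises the integral of the square of [|f| - l]. *)
pose l := A / c.
have ic k : mu.-integrable D (EFin \o cst k) by exact: integrable_cst_lty.
have iZ : mu.-integrable D (EFin \o (fun x => (2 * l) * `|f x|)).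
  exact: integrableZl_EFin.
have iB : mu.-integrable D (EFin \o (fun x => f x ^+ 2 - (2 * l) * `|f x|)).
  exact: integrableB_EFin.
have : 0 <= \int[mu]_(x in D) ((f x ^+ 2 - (2 * l) * `|f x|) + l ^+ 2).
  apply: Rintegral_ge0 => x _.
  by rewrite -(real_normK (num_real (f x))); have := sqr_ge0 (`|f x| - l); nra.
rewrite RintegralD//; last exact: (ic (l ^+ 2)).
rewrite RintegralB// RintegralZl// Rintegral_cst// -/A -/c.
set Q := \int[mu]_(x in D) (f x ^+ 2).
move=> H.
have lc : l * c = A by rewrite /l divfK// gt_eqF.
have : 0 <= c * (Q - 2 * l * A + l ^+ 2 * c) by rewrite mulr_ge0// ltW.
by rewrite (_ : c * _ = c * Q - 2 * (l * c) * A + (l * c) ^+ 2); [rewrite lc; nra|ring].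
Qed.

(** Tonelli applies to the positive and negative parts separately, and [fine] is measurable.
    Sections that are not integrable are thus covered, with the value that [fine] assigns to
    them. *)
Lemma measurable_Rintegral_param d1 d2 (T1 : measurableType d1)
    (T2 : measurableType d2) (R : realType)
    (m : {sigma_finite_measure set T2 -> \bar R}) (F : T1 * T2 -> R) :
  measurable_fun setT F ->
  measurable_fun setT (fun x => \int[m]_y F (x, y)).
Proof.
move=> mF; rewrite /Rintegral.
apply: measurableT_comp; first exact: fine_measurable.
have mE : measurable_fun setT (EFin \o F) by exact/measurable_EFinP.
under eq_fun do rewrite integralE.
have Hp : measurable_fun setT (fubini_F m ((EFin \o F)^\+)%E).
  by apply: measurable_fun_fubini_tonelli_F => //; exact: measurable_funepos.
have Hn : measurable_fun setT (fubini_F m ((EFin \o F)^\-)%E).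
  by apply: measurable_fun_fubini_tonelli_F => //; exact: measurable_funeneg.
apply: (eq_measurable_fun _ _ (emeasurable_funB Hp Hn)) => x _ /=.
by congr (_ - _)%E; apply: eq_integral => y _; rewrite ?funeposE ?funenegE.
Qed.

(** On the unit interval to the right of [x] the function stays above [g x - |C|], and its integral
    there is at most 1. *)
Lemma lipschitz_density_bounded (R : realType) (g : R -> R) (C : R) :
  measurable_fun setT g -> (forall x, 0 <= g x) ->
  (\int[@lebesgue_measure R]_x (g x)%:E <= 1)%E ->
  (forall x y, `|g x - g y| <= C * `|x - y|) ->
  forall x, g x <= 1 + `|C|.
Proof.
move=> mg g0 g1 gC x.
rewrite -lerBlDr -lee_fin; apply: le_trans g1.
set J := `[x, x + 1]%classic.
apply: (@le_trans _ _ (\int[@lebesgue_measure R]_(y in J) (g y)%:E)%E); last first.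
  apply: ge0_subset_integral => //.
  - exact: measurable_itv.
  - exact/measurable_EFinP.
  by move=> y _; rewrite lee_fin.
have [H|H] := leP (g x - `|C|) 0.
  apply: (@le_trans _ _ 0%E); first by rewrite lee_fin.
  by apply: integral_ge0 => y _; rewrite lee_fin.
apply: (@le_trans _ _ (\int[@lebesgue_measure R]_(y in J) (g x - `|C|)%:E)%E).
  have J1 : @lebesgue_measure R J = 1%E.
    by rewrite /J lebesgue_measure_itv/= lte_fin ltrDl ltr01 -EFinD addrAC subrr add0r.
  rewrite integral_cst; last exact: measurable_itv.
  apply: (@le_trans _ _ ((g x - `|C|)%:E * @lebesgue_measure R J)%E) => //.
  by rewrite J1 mule1.
apply: ge0_le_integral => //.
- exact: measurable_itv.
- by move=> y _; rewrite lee_fin ltW.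
- by apply/measurable_EFinP; exact: measurable_funS mg.
- move=> y; rewrite /J/= in_itv/= => /andP[xy yx]; rewrite lee_fin.
  have H1 := gC x y.
  have xy1 : `|x - y| <= 1 by rewrite ler0_norm; lra.
  have : C * `|x - y| <= `|C|.
    apply: (@le_trans _ _ (`|C| * `|x - y|)); first by rewrite ler_wpM2r// ler_norm.
    by rewrite ler_piMr.
  move: H1; rewrite ler_norml => /andP[]; lra.
Qed.

Section density_measure.
Local Open Scope ereal_scope.
Context {R : realType}.
Variables (f : R -> R) (f0 : forall x, (0 <= f x)%R) (mf : measurable_fun setT f).

(** The proofs of nonnegativity and measurability are arguments so that the measure structure can be
    inferred from the term itself. *)
Definition density_measure (_ : forall x, (0 <= f x)%R) (_ : measurable_fun setT f)
  (A : set (measurableTypeR R)) : \bar R := \int[@lebesgue_measure R]_(x in A) (f x)%:E.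

Local Notation nu := (density_measure f0 mf).

Let nu0 : nu set0 = 0.
Proof. by rewrite /density_measure integral_set0. Qed.

Let nu_ge0 A : 0 <= nu A.
Proof. by apply: integral_ge0 => x _; rewrite lee_fin. Qed.

Let nu_sigma_additive : semi_sigma_additive nu.
Proof.
move=> /= A mA tA mUA.
rewrite /density_measure/= ge0_integral_bigcup//=.
- apply: is_cvg_ereal_nneg_natsum_cond => n _ _.
  by apply: integral_ge0 => /= x ?; rewrite lee_fin.
- by apply/measurable_EFinP; exact: measurable_funS mf.
- by move=> x _; rewrite lee_fin.
Qed.

HB.instance Definition _ := isMeasure.Build _ _ _ nu nu0 nu_ge0 nu_sigma_additive.

End density_measure.

(** * Lipschitz estimates for the affine model *)

Section lipschitz_aux.
Context {R : realType}.
Implicit Types u v x y k C e : R.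

Lemma dist_min u u' v v' e : `|u - v| <= e -> `|u' - v'| <= e ->
  `|Num.min u u' - Num.min v v'| <= e.
Proof.
rewrite !ler_norml => /andP[? ?] /andP[? ?].
by case: (leP u u') => ?; case: (leP v v') => ?; apply/andP; split; lra.
Qed.

Lemma dist_max u u' v v' e : `|u - v| <= e -> `|u' - v'| <= e ->
  `|Num.max u u' - Num.max v v'| <= e.
Proof.
rewrite !ler_norml => /andP[? ?] /andP[? ?].
by case: (leP u u') => ?; case: (leP v v') => ?; apply/andP; split; lra.
Qed.

(** For [k' <= k], the graph of the exponential lies above its tangent at [k], whose slope is at
    most [expR C]. *)
Lemma dist_expR C k k' : `|k| <= C -> `|k'| <= C ->
  `|expR k - expR k'| <= expR C * `|k - k'|.
Proof.
wlog kk' : k k' / k' <= k.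
  move=> H kC k'C; have [|/ltW] := leP k' k; first by move/H; exact.
  by move/H => /(_ k'C kC); rewrite distrC (distrC k).
move=> kC _; have kleC : k <= C by apply: le_trans kC; exact: ler_norm.
rewrite !ger0_norm ?subr_ge0// ?ler_expR//.
have H := expR_ge1Dx (k' - k); rewrite expRB in H.
have e0 := expR_gt0 k.
have : expR k * (1 + (k' - k)) <= expR k'.
  by apply: le_trans (ler_wpM2l (ltW e0) H) _; rewrite mulrC divfK// gt_eqF.
have : expR k * (k - k') <= expR C * (k - k').
  by apply: ler_wpM2r; rewrite ?subr_ge0// ler_expR.
lra.
Qed.

End lipschitz_aux.

(* The density at [x] of [e^k (x0 + y D + E)] when [y] has density [g] and
   the other quantities are frozen. *)
Definition affine_density (R : realType) (g : R -> R) (k D E x0 x : R) : R :=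
  g ((x * expR (- k) - E - x0) / D) * (expR (- k) / D).

Section affine_density.
Context {R : realType}.
Variables (g : R -> R).

Lemma affine_density_ge0 k D E x0 x : (forall y, 0 <= g y) -> 0 < D ->
  0 <= affine_density g k D E x0 x.
Proof. by move=> g0 D0; rewrite mulr_ge0// divr_ge0 ?expR_ge0// ltW. Qed.

Lemma ge0_integral_affine_density (h : R -> R) k D E x0 :
  measurable_fun setT g -> (forall y, 0 <= g y) -> 0 < D ->
  measurable_fun setT h -> (forall y, 0 <= h y) ->
  (\int[@lebesgue_measure R]_y (h (expR k * (x0 + y * D + E)) * g y)%:E =
   \int[@lebesgue_measure R]_x (h x * affine_density g k D E x0 x)%:E)%E.
Proof.
move=> mg g0 D0 mh h0.
have c0 : 0 < expR k * D by rewrite mulr_gt0// expR_gt0.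
pose f x := (h x * g ((x * expR (- k) - E - x0) / D))%:E.
have mf : measurable_fun setT f.
  apply/measurable_EFinP; apply: measurable_funM => //.
  apply: measurableT_comp => //; apply: measurable_funM => //.
  by apply: measurable_funB => //; apply: measurable_funB => //; apply: measurable_funM.
have f0 x : (0 <= f x)%E by rewrite lee_fin mulr_ge0.
have D1 : D != 0 by rewrite gt_eqF.
have k1 : expR k != 0 by rewrite gt_eqF// expR_gt0.
transitivity (\int[@lebesgue_measure R]_y f (expR k * D * y + expR k * (x0 + E))%R)%E.
  apply: eq_integral => y _; rewrite /f; congr (_%:E).
  have -> : expR k * D * y + expR k * (x0 + E) = expR k * (x0 + y * D + E) by ring.
  congr (_ * g _); rewrite expRN; field; exact/andP.
rewrite ge0_integral_affine// -ge0_integralZl_EFin//; last by rewrite invr_ge0 ltW.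
apply: eq_integral => x _; rewrite /f -EFinM /affine_density; congr (_%:E).
by rewrite expRN; field; exact/andP.
Qed.

(** The substitution [z = x e^(-k) - (y D + E)] exchanges the roles of the two independent
    variables. On the left [f] is evaluated and [y] has density [g]. On the right [g] is evaluated
    and [z] has density [f]. *)
Lemma ge0_integral_reflected_density (f : R -> R) k D E x :
  measurable_fun setT g -> (forall y, 0 <= g y) -> 0 < D ->
  measurable_fun setT f -> (forall y, 0 <= f y) ->
  (\int[@lebesgue_measure R]_y
     (f (x * expR (- k) - (y * D + E)) * expR (- k) * g y)%:E =
   \int[@lebesgue_measure R]_z (affine_density g k D E z x * f z)%:E)%E.
Proof.
move=> mg g0 D0 mf f0.
pose F z := (f z * g ((x * expR (- k) - E - z) / D) * expR (- k))%:E.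
have mF : measurable_fun setT F.
  apply/measurable_EFinP; apply: measurable_funM => //; apply: measurable_funM => //.
  apply: measurableT_comp => //; apply: measurable_funM => //.
  exact: measurable_funB.
have F0 z : (0 <= F z)%E by rewrite lee_fin !mulr_ge0// expR_ge0.
have D1 : D != 0 by rewrite gt_eqF.
have mF' : measurable_fun setT (fun y => F (D * y + (x * expR (- k) - E))).
  apply: measurableT_comp => //; apply: measurable_funD => //.
(* The substitution has slope [-D]. It is split into a reflection and an affine map of positive
   slope [D]. *)
transitivity (\int[@lebesgue_measure R]_y F (D * (- y) + (x * expR (- k) - E))%R)%E.
  apply: eq_integral => y _; rewrite /F; congr (_%:E).
  have -> : D * - y + (x * expR (- k) - E) = x * expR (- k) - (y * D + E) by ring.
  rewrite mulrAC; congr (_ * g _ * _); by field.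
rewrite (ge0_integral_opp mF')//.
rewrite ge0_integral_affine// -ge0_integralZl_EFin//; last by rewrite invr_ge0 ltW.
by apply: eq_integral => z _; rewrite /F -EFinM /affine_density; congr (_%:E); ring.
Qed.

(** The constant [c] bounds the factor [e^(-k) / D] and is also a Lipschitz constant for it: [d0^-1]
    accounts for a change of [k] and [d0^-1 ^+ 2] for a change of [D]. In the argument of [g], a
    change of [1 / D] is multiplied by [E' + x0], whence [W], and a change of [e^(-k) / D] by [x],
    whence [X]. The two terms of the final constant come from the oscillation of [g] and from its
    supremum. *)
Lemma affine_density_dist (M Cg C d0 k k' D D' E E' x0 x X W : R) :
  (forall y, 0 <= g y <= M) -> 0 <= Cg ->
  (forall y z, `|g y - g z| <= Cg * `|y - z|) ->
  0 < d0 -> `|k| <= C -> `|k'| <= C -> d0 <= D -> d0 <= D' -> `|x| <= X ->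
  1 <= W -> `|x0| + `|E'| <= W ->
  let c := expR C * (d0^-1 + d0^-1 ^+ 2) in
  (`|affine_density g k D E x0 x - affine_density g k' D' E' x0 x| <=
  (Cg * c ^+ 2 * (1 + X) + M * c) * (W * (`|k - k'| + `|D - D'|) + `|E - E'|) : Prop).
Proof.
move=> gM Cg0 gL d00 kC k'C dD dD' xX W1 WE c.
set q : R := `|k - k'| + `|D - D'|.
have D0 : 0 < D by exact: lt_le_trans dD.
have D'0 : 0 < D' by exact: lt_le_trans dD'.
have C0 : 0 <= C by apply: le_trans kC.
have X0 : 0 <= X by apply: le_trans xX.
have eC1 : 1 <= expR C by have := expR_ge1Dx C; lra.
have i0 : 0 < d0^-1 by rewrite invr_gt0.
have iD : D^-1 <= d0^-1 by rewrite lef_pV2.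
have iD' : D'^-1 <= d0^-1 by rewrite lef_pV2.
have iD0 : 0 < D^-1 by rewrite invr_gt0.
have iD'0 : 0 < D'^-1 by rewrite invr_gt0.
have q0 : 0 <= q by rewrite addr_ge0.
have M0 : 0 <= M by have /andP[a b] := gM 0; exact: le_trans b.
have cd : d0^-1 <= c.
  rewrite /c; apply: (@le_trans _ _ (1 * d0^-1)); first by rewrite mul1r.
  by apply: ler_pM => //; [exact: ltW|rewrite lerDl sqr_ge0].
have c0 : 0 < c by exact: lt_le_trans cd.
have dinv : `|D^-1 - D'^-1| <= d0^-1 ^+ 2 * `|D - D'|.
  have -> : D^-1 - D'^-1 = (D^-1 * D'^-1) * - (D - D') by field; rewrite !gt_eqF.
  rewrite normrM normrN ger0_norm; last by rewrite mulr_ge0// ltW.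
  by apply: ler_wpM2r => //; rewrite expr2; apply: ler_pM => //; exact: ltW.
have dinv' : `|D^-1 - D'^-1| <= c * q.
  apply: le_trans dinv _; apply: ler_pM; rewrite ?sqr_ge0//.
    rewrite /c; apply: (@le_trans _ _ (1 * d0^-1 ^+ 2)); first by rewrite mul1r.
    by apply: ler_pM => //; [exact: sqr_ge0|rewrite lerDr ltW].
  by rewrite lerDr.
have ek : `|expR (- k) - expR (- k')| <= expR C * `|k - k'|.
  have -> : `|k - k'| = `|- k - - k'| by rewrite -opprD normrN.
  by apply: dist_expR; rewrite normrN.
have ek'C : expR (- k') <= expR C.
  by rewrite ler_expR; apply: le_trans k'C; rewrite -normrN ler_norm.
have ekC : expR (- k) <= expR C.
  by rewrite ler_expR; apply: le_trans kC; rewrite -normrN ler_norm.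
set p := expR (- k) / D; set p' := expR (- k') / D'.
have pp : `|p - p'| <= c * q.
  have -> : p - p' = (expR (- k) - expR (- k')) * D^-1 + expR (- k') * (D^-1 - D'^-1).
    by rewrite /p /p'; ring.
  apply: (le_trans (ler_normD _ _)); rewrite !normrM.
  apply: (@le_trans _ _ ((expR C * `|k - k'|) * d0^-1 + expR C * (d0^-1 ^+ 2 * `|D - D'|))).
    apply: lerD; apply: ler_pM => //; first by rewrite ger0_norm// ltW.
    by rewrite ger0_norm// expR_ge0.
  have gen (e i a b : R) : 0 <= e -> 0 <= i -> 0 <= a -> 0 <= b ->
      e * a * i + e * (i ^+ 2 * b) <= e * (i + i ^+ 2) * (a + b).
    move=> e0 i1 a0 b0.
    have -> : e * (i + i ^+ 2) * (a + b) =
      e * a * i + e * (i ^+ 2 * b) + (e * (i * b) + e * (i ^+ 2 * a)) by ring.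
    by rewrite lerDl addr_ge0// !mulr_ge0// sqr_ge0.
  by apply: gen; rewrite ?expR_ge0// ltW.
have pc : `|p| <= c.
  rewrite ger0_norm; last by rewrite mulr_ge0 ?expR_ge0// ltW.
  apply: (@le_trans _ _ (expR C * d0^-1)).
    by apply: ler_pM; rewrite ?expR_ge0// ltW.
  by rewrite /c ler_wpM2l ?expR_ge0// lerDl sqr_ge0.
set u := (x * expR (- k) - E - x0) / D; set u' := (x * expR (- k') - E' - x0) / D'.
set S := W * q + `|E - E'|.
have S0 : 0 <= S by rewrite addr_ge0// mulr_ge0//; lra.
have qW : q <= W * q by rewrite ler_peMl.
have uu : `|u - u'| <= c * (1 + X) * S.
  have -> : u - u' = x * (p - p') - (E - E') * D^-1 - (E' + x0) * (D^-1 - D'^-1).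
    by rewrite /u /u' /p /p'; ring.
  apply: (@le_trans _ _ (X * (c * q) + `|E - E'| * c + W * (c * q))).
    apply: (le_trans (ler_normB _ _)); apply: lerD.
      apply: (le_trans (ler_normB _ _)); apply: lerD; rewrite normrM.
        exact: ler_pM.
      apply: ler_pM => //; rewrite ger0_norm; last exact: ltW.
      exact: le_trans cd.
    rewrite normrM; apply: ler_pM => //.
    by apply: (le_trans (ler_normD _ _)); rewrite addrC.
  have -> : X * (c * q) + `|E - E'| * c + W * (c * q) = c * (X * q + S) by rewrite /S; ring.
  rewrite -mulrA ler_wpM2l//; first exact: ltW.
  rewrite mulrDl mul1r addrC lerD2l; apply: ler_wpM2l => //.
  by apply: (le_trans qW); rewrite lerDl.
rewrite /affine_density -/p -/p' -/u -/u'.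
have -> : g u * p - g u' * p' = (g u - g u') * p + g u' * (p - p') by ring.
apply: (le_trans (ler_normD _ _)); rewrite (normrM (g u - g u')) (normrM (g u')).
apply: (@le_trans _ _ ((Cg * (c * (1 + X) * S)) * c + M * (c * q))).
  apply: lerD; apply: ler_pM => //.
    by apply: (le_trans (gL _ _)); rewrite ler_wpM2l.
  by have /andP[g0 g1] := gM u'; rewrite ger0_norm.
have -> : (Cg * c ^+ 2 * (1 + X) + M * c) * S = Cg * (c * (1 + X) * S) * c + M * (c * S) by ring.
rewrite lerD2l; apply: ler_wpM2l => //; apply: ler_wpM2l; first exact: ltW.
by apply: (le_trans qW); rewrite lerDl.
Qed.

(** The same error quantity that controls the kernel also controls the solution itself, so that a
    single [Delta] serves for both. The condition [1 <= d1] lets [d1 * W] dominate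
    [|x0| + |y| D' + |E'|]. *)
Lemma affine_solution_dist (C d1 k k' D D' E E' x0 y W Delta : R) :
  `|k| <= C -> `|k'| <= C -> 0 <= D' -> D' <= d1 -> 1 <= d1 ->
  `|x0| + `|y| + `|E'| <= W ->
  W * (`|k - k'| + `|D - D'|) + `|E - E'| <= Delta ->
  `|expR k * (x0 + y * D + E) - expR k' * (x0 + y * D' + E')| <=
  expR C * (1 + d1) * Delta.
Proof.
move=> kC k'C D'0 D'd d11 WE err.
have -> : expR k * (x0 + y * D + E) - expR k' * (x0 + y * D' + E') =
  expR k * (y * (D - D') + (E - E')) + (expR k - expR k') * (x0 + y * D' + E') by ring.
have ekC : expR k <= expR C by rewrite ler_expR; apply: le_trans kC; exact: ler_norm.
have e0 := expR_ge0 C.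
have y0 := normr_ge0 y; have x00 := normr_ge0 x0; have E'0 := normr_ge0 E'.
have dk0 := normr_ge0 (k - k'); have dD0 := normr_ge0 (D - D').
have W0 : 0 <= W by lra.
have S1 : `|y * (D - D') + (E - E')| <= Delta.
  apply: le_trans err; apply: (le_trans (ler_normD _ _)); rewrite lerD2r normrM.
  by apply: ler_pM => //; lra.
have S2 : `|x0 + y * D' + E'| <= d1 * W.
  apply: (@le_trans _ _ (`|x0| + `|y| * D' + `|E'|)).
    apply: (le_trans (ler_normD _ _)); rewrite lerD2r.
    apply: (le_trans (ler_normD _ _)); rewrite lerD2l normrM (ger0_norm D'0)//.
  by nra.
apply: (le_trans (ler_normD _ _)); rewrite !normrM.
have -> : expR C * (1 + d1) * Delta = expR C * Delta + expR C * (d1 * Delta) by ring.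
apply: lerD; first by apply: ler_pM => //; rewrite ger0_norm// expR_ge0.
apply: (@le_trans _ _ ((expR C * `|k - k'|) * (d1 * W))).
  by apply: ler_pM => //; exact: dist_expR.
rewrite -mulrA ler_wpM2l// mulrCA ler_wpM2l//; first lra.
apply: le_trans err; rewrite mulrC.
have : 0 <= `|E - E'| by [].
have : 0 <= W * `|D - D'| by rewrite mulr_ge0.
lra.
Qed.

End affine_density.

Section ae_integral.
Context d (T : measurableType d) (R : realType) (mu : {measure set T -> \bar R}).
Implicit Types F G Delta : T -> R.

Lemma integrable_ae_le F G : measurable_fun setT F -> (forall x, 0 <= G x) ->
  mu.-integrable setT (EFin \o G) -> {ae mu, forall x, `|F x| <= G x} ->
  mu.-integrable setT (EFin \o F).
Proof.
move=> mF G0 iG FG; apply/integrableP; split; first exact/measurable_EFinP.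
move/integrableP : (iG) => [mG]; apply: le_lt_trans.
apply: ae_ge0_le_integral => //=.
- by do 2 apply: measurableT_comp => //.
- by do 2 apply: measurableT_comp => //; exact/measurable_EFinP.
- apply: filterS FG => x FG _; rewrite lee_fin; apply: (le_trans FG).
  exact: ler_norm.
Qed.

Lemma Rintegral_ae_dist F G Delta c : 0 <= c -> measurable_fun setT Delta ->
  (forall x, 0 <= Delta x) ->
  mu.-integrable setT (EFin \o F) -> mu.-integrable setT (EFin \o G) ->
  {ae mu, forall x, `|F x - G x| <= c * Delta x} ->
  (`|\int[mu]_x F x - \int[mu]_x G x|%:E <= c%:E * \int[mu]_x (Delta x)%:E)%E.
Proof.
move=> c0 mD D0 iF iG FG.
have iFG : mu.-integrable setT (EFin \o (fun x => F x - G x)) by exact: integrableB_EFin.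
have mFG := measurable_int _ iFG.
rewrite -RintegralB//; apply: (@le_trans _ _ (\int[mu]_x `|F x - G x|)%:E).
  by rewrite lee_fin le_normr_Rintegral.
rewrite -ge0_integralZl_EFin//; last 2 first.
  - by move=> x _; rewrite lee_fin.
  - exact/measurable_EFinP.
rewrite /Rintegral fineK; last first.
  by apply: (integrable_fin_num measurableT); exact: integrable_norm iFG.
apply: ae_ge0_le_integral => //=.
- by do 2 apply: measurableT_comp => //; exact/measurable_EFinP.
- by move=> x _; rewrite mule_ge0// lee_fin.
- apply/measurable_EFinP => /=; exact: measurable_funM.
- by apply: filterS FG => x FG _; rewrite -EFinM lee_fin.
Qed.

End ae_integral.

(* Rays generate the Borel sets, and the indicator of a ray is an increasing
   limit of compactly supported Lipschitz functions. *)
Lemma is_density_of_test_functions d (Omega : measurableType d) (R : realType)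
    (P : probability Omega R) (X : Omega -> R) (f : R -> R) :
  measurable_fun setT X -> (forall x, 0 <= f x) -> measurable_fun setT f ->
  (forall (h : R -> R) (K B : R), measurable_fun setT h ->
     (forall x, 0 <= h x <= 1) ->
     (forall x y, `|h x - h y| <= K * `|x - y|) ->
     (forall x, B < `|x| -> h x = 0) ->
     (\int[P]_w (h (X w))%:E = \int[@lebesgue_measure R]_x (h x * f x)%:E)%E) ->
  is_density P X f.
Proof.
move=> mX f0 mf test.
pose Z : {mfun Omega >-> measurableTypeR R} :=
  @mfun_Sub _ _ _ (measurableTypeR R) _ (mem_set mX).
split => // B mB.
pose m1 : {measure set (measurableTypeR R) -> \bar R} := distribution P Z.
pose m2 : {measure set (measurableTypeR R) -> \bar R} := density_measure f0 mf.
suff : m1 B = m2 B by [].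
have mray (y : R) : measurable (`]y, +oo[%classic : set (measurableTypeR R)).
  exact: measurable_itv.
apply: (@measure_unique _ R (measurableTypeR R) (@RGenOInfty.G R)
  (fun k : nat => `](- k%:R)%R, +oo[%classic) _ _ _ _ m1 m2) => //.
- exact: RGenOInfty.measurableE.
- move=> _ _ [x ->] [y ->]; exists (Num.max x y).
  apply/seteqP; split => z /=; rewrite !in_itv/= !andbT gt_max.
    by move=> [-> ->].
  by move=> /andP[].
- by move=> i; eexists.
- apply/seteqP; split => // x _.
  exists (Num.bound `|x|) => //=; rewrite in_itv/= andbT.
  by rewrite ltrNl; apply: le_lt_trans (archi_boundP _) => //; rewrite -normrN ler_norm.
- move=> _ [y ->].
  (* Ramps of slope [m]: [h m] vanishes up to [y] and beyond [m], and equals 1 where both [x - y]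
     and [m - x] are at least [1 / m]. It is [m]-Lipschitz and grows with [m]. *)
  pose h (m : nat) (x : R) : R :=
    Num.min 1 (m%:R * Num.max 0 (Num.min (x - y) (m%:R - x))).
  have h01 m x : 0 <= h m x <= 1.
    rewrite /h le_min ler01/= ge_min lexx/= andbT mulr_ge0// le_max lexx//.
  have mh m : measurable_fun setT (h m).
    apply: measurable_minr => //; apply: measurable_funM => //.
    apply: measurable_maxr => //; apply: measurable_minr => //.
    exact: measurable_funB. exact: measurable_funB.
  have hL m x x' : `|h m x - h m x'| <= m%:R * `|x - x'|.
    apply: dist_min; first by rewrite subrr normr0 mulr_ge0.
    rewrite -mulrBr normrM ger0_norm// ler_wpM2l//.
    apply: dist_max; first by rewrite subrr normr0.
    apply: dist_min; first by rewrite opprB addrA subrK.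
    by rewrite opprB addrC addrA subrK distrC.
  have hS m x : Num.max `|y| m%:R < `|x| -> h m x = 0.
    rewrite gt_max => /andP[yx mx]; rewrite /h.
    suff -> : Num.max 0 (Num.min (x - y) (m%:R - x)) = 0 by rewrite mulr0 min_r.
    apply/max_idPl; rewrite ge_min.
    have [x0|x0] := leP 0 x.
      by apply/orP; right; rewrite (ger0_norm x0) in mx; lra.
    apply/orP; left; rewrite (ltr0_norm x0) in yx.
    by have := ler_norm (- y); rewrite normrN; lra.
  have h_nd x : {homo h ^~ x : n m / (n <= m)%N >-> n <= m}.
    move=> n m nm; rewrite /h; have nm' : n%:R <= m%:R :> R by rewrite ler_nat.
    rewrite le_min ge_min lexx/= ge_min; apply/orP; right.
    apply: ler_pM => //; first by rewrite le_max lexx.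
    rewrite ge_max !le_max lexx/= le_min; apply/orP; right; apply/andP.
    by split; rewrite ge_min ?lexx//; apply/orP; right; lra.
  have h_cvg x : (fun m => h m x) @ \oo --> (\1_(`]y, +oo[%classic) x : R).
    rewrite indicE; have [yx|xy] := ltP y x; last first.
      rewrite memNset ?/=; last by rewrite in_itv/= andbT => /lt_geF; rewrite xy.
      rewrite (_ : (fun m => h m x) = cst 0); first exact: cvg_cst.
      apply/funext => m; rewrite /h.
      suff -> : Num.max 0 (Num.min (x - y) (m%:R - x)) = 0 by rewrite mulr0 min_r.
      by apply/max_idPl; rewrite ge_min subr_le0 xy.
    rewrite mem_set ?/=; last by rewrite in_itv/= yx.
    apply: cvg_near_cst.
    (* From this index on, [m (x - y) >= 1] thanks to the last summand, and [m (m - x) >= 1] thanks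
       to the first two, so the outer minimum is 1. *)
    pose b := Num.bound (`|x| + 1 + (x - y)^-1).
    have xy0 : 0 < x - y by rewrite subr_gt0.
    have bP : `|x| + 1 + (x - y)^-1 < b%:R.
      by apply: archi_boundP; rewrite !addr_ge0// invr_ge0 ltW.
    exists b => // m /= bm; rewrite /h; apply/min_idPl.
    have bm' : b%:R <= m%:R :> R by rewrite ler_nat.
    have xx := ler_norm x; have i0 : 0 < (x - y)^-1 by rewrite invr_gt0.
    have n0 : 0 <= `|x| by [].
    have mge1 : 1 <= m%:R :> R by lra.
    case: (leP (x - y) (m%:R - x)) => H.
      rewrite (max_r (ltW xy0)); apply: (@le_trans _ _ ((x - y)^-1 * (x - y))).
        by rewrite mulVf// gt_eqF.
      by apply: ler_wpM2r; [exact: ltW|lra].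
    rewrite max_r; last by lra.
    by rewrite -[X in X <= _]mulr1; apply: ler_pM => //; lra.
  have E1 : distribution P Z `]y, +oo[%classic =
      limn (fun m => (\int[P]_w (h m (X w))%:E)%E).
    rewrite -monotone_convergence//; last 3 first.
    - by move=> m; apply/measurable_EFinP; exact: measurableT_comp.
    - by move=> m w _; rewrite lee_fin; have /andP[] := h01 m (X w).
    - by move=> w _ n m nm; rewrite lee_fin h_nd.
    transitivity (\int[P]_w (\1_(`]y, +oo[%classic) (X w) : R)%:E)%E.
      have -> : (fun w => (\1_(`]y, +oo[%classic) (X w) : R)%:E) =
          (fun w => (\1_(X @^-1` `]y, +oo[%classic) w : R)%:E).
        by apply/funext => w; rewrite !indicE.
      rewrite integral_indic// ?setIT//.
      by rewrite -[X in measurable X]setTI; apply: (mX measurableT); exact: measurable_itv.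
    apply: eq_integral => w _; apply/esym/cvg_lim => //.
    by apply: cvg_EFin; [exact: nearW|exact: h_cvg].
  have E2 : density_measure f0 mf `]y, +oo[%classic =
      limn (fun m => (\int[@lebesgue_measure R]_x (h m x * f x)%:E)%E).
    rewrite -monotone_convergence//; last 3 first.
    - by move=> m; apply/measurable_EFinP; exact: (measurable_funM (mh m) mf).
    - by move=> m x _; rewrite lee_fin mulr_ge0//; have /andP[] := h01 m x.
    - by move=> x _ n m nm; rewrite lee_fin ler_wpM2r// h_nd.
    rewrite /density_measure [LHS]integral_mkcond; apply: eq_integral => x _.
    transitivity ((\1_(`]y, +oo[%classic) x : R) * f x)%:E.
      by rewrite patchE indicE; case: ifPn => _; rewrite ?mul1r ?mul0r.
    apply/esym/cvg_lim => //; apply: cvg_EFin; first exact: nearW.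
    by apply: cvgM; [exact: h_cvg|exact: cvg_cst].
  apply: (etrans E1 (etrans _ (esym E2))); congr (limn _); apply/funext => m.
  exact: (test (h m) m%:R (Num.max `|y| m%:R) (mh m) (h01 m) (hL m) (hS m)).
- move=> k; apply: (@le_lt_trans _ _ 1%E); last exact: ltry.
  exact: probability_le1.
Qed.

Lemma measurable_affine_density d (T : measurableType d) (R : realType)
    (g : R -> R) (k D E x0 x : T -> R) :
  measurable_fun setT g -> measurable_fun setT k -> measurable_fun setT D ->
  measurable_fun setT E -> measurable_fun setT x0 -> measurable_fun setT x ->
  (forall t, 0 < D t) ->
  measurable_fun setT (fun t => affine_density g (k t) (D t) (E t) (x0 t) (x t)).
Proof.
move=> mg mk mD mE mx0 mx D0.
have mek : measurable_fun setT (fun t => expR (- k t)).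
  by apply: measurableT_comp => //; exact: measurable_funN.
(* Since [D] is positive everywhere, its inverse is [exp (- ln D)], a composition of measurable
   maps. Positivity almost everywhere would not give this equality of functions. *)
have mDi : measurable_fun setT (fun t => (D t)^-1).
  rewrite (_ : (fun t => (D t)^-1) = (fun t => expR (- ln (D t)))); last first.
    by apply/funext => t; rewrite expRN lnK// posrE.
  apply: measurableT_comp => //; apply: measurable_funN.
  by apply: measurableT_comp => //; exact: measurable_ln.
apply: measurable_funM; last exact: measurable_funM.
apply: measurableT_comp => //; apply: measurable_funM => //.
by do 2 apply: measurable_funB => //; exact: measurable_funM.
Qed.

Lemma ge0_integral_density d (Omega : measurableType d) (R : realType)
    (P : probability Omega R) (X : Omega -> R) (f : R -> R) (h : R -> \bar R) :
  is_density P X f -> measurable_fun setT h -> (forall y, 0 <= h y)%E ->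
  (\int[P]_w h (X w) = \int[@lebesgue_measure R]_y (h y * (f y)%:E))%E.
Proof.
move=> [mX f0 mf XP] mh h0.
exact: (@ge0_integral_law_density _ _ _ (measurableTypeR R) _ P (@lebesgue_measure R)).
Qed.

Lemma Rintegral_probability_cst d (Omega : measurableType d) (R : realType)
  (P : probability Omega R) (r : R) : \int[P]_w r = r.
Proof.
apply: (etrans (Rintegral_cst P measurableT r)); rewrite -[RHS]mulr1; congr (_ * _).
exact: (congr1 fine (@probability_setT _ _ _ P)).
Qed.

(** * Law of the affine model with random coefficients *)

Section affine_law.
Context d dV (Omega : measurableType d) (TV : measurableType dV) (R : realType).
Variables (P : probability Omega R) (g f0 : R -> R) (x0 eta : Omega -> R).
Variables (V : Omega -> TV) (k D E : TV -> R).
Hypotheses (eta_g : is_density P eta g) (mx0 : measurable_fun setT x0).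
Hypotheses (mV : measurable_fun setT V) (mk : measurable_fun setT k).
Hypotheses (mD : measurable_fun setT D) (mE : measurable_fun setT E).
Hypothesis D_gt0 : forall v, 0 < D v.

(** With [(x0, V)] frozen, averaging over [eta] is the deterministic change of variables. Tonelli
    then moves the expectation inside, so the mean of the kernel is the density of the affine
    expression. *)
Lemma ge0_integral_affine_law (h : R -> R) :
  independent2 P (fun w => (x0 w, V w)) eta ->
  measurable_fun setT h -> (forall x, 0 <= h x) ->
  (\int[P]_w (h (expR (k (V w)) * (x0 w + eta w * D (V w) + E (V w))))%:E =
   \int[@lebesgue_measure R]_x ((h x)%:E *
     \int[P]_w (affine_density g (k (V w)) (D (V w)) (E (V w)) (x0 w) x)%:E))%E.
Proof.
move=> ind mh h0; have [meta g0 mg etaP] := eta_g.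
pose F (z : (R * TV) * R) :=
  (h (expR (k z.1.2) * (z.1.1 + z.2 * D z.1.2 + E z.1.2)))%:E.
have mF : measurable_fun setT F.
  apply/measurable_EFinP; apply: measurableT_comp => //.
  have m12 : measurable_fun setT (fun z : (R * TV) * R => z.1.2).
    exact: measurableT_comp.
  have m11 : measurable_fun setT (fun z : (R * TV) * R => z.1.1).
    exact: measurableT_comp.
  apply: measurable_funM.
    by apply: measurableT_comp => //; exact: measurableT_comp.
  apply: measurable_funD; last exact: measurableT_comp.
  apply: measurable_funD => //; apply: measurable_funM => //.
  exact: measurableT_comp.
have F0 z : (0 <= F z)%E by rewrite lee_fin.
transitivity (\int[P]_w F ((x0 w, V w), eta w))%E => //.
have mxV : measurable_fun setT (fun w => (x0 w, V w)) by exact: measurable_fun_pair.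
rewrite (ge0_integral_independent2 mxV meta ind mF F0).
pose G (z : Omega * measurableTypeR R) :=
  (h z.2 * affine_density g (k (V z.1)) (D (V z.1)) (E (V z.1)) (x0 z.1) z.2)%:E.
have mV1 (q : TV -> R) : measurable_fun setT q ->
    measurable_fun setT (fun z : Omega * measurableTypeR R => q (V z.1)).
  by move=> mq; apply: measurableT_comp => //; exact: measurableT_comp.
have maff : measurable_fun setT (fun z : Omega * measurableTypeR R =>
    affine_density g (k (V z.1)) (D (V z.1)) (E (V z.1)) (x0 z.1) z.2).
  apply: measurable_affine_density => //; try exact: mV1.
  exact: measurableT_comp.
have aff0 w x : 0 <= affine_density g (k (V w)) (D (V w)) (E (V w)) (x0 w) x.
  exact: affine_density_ge0.
have mG : measurable_fun setT G.
  by apply/measurable_EFinP; apply: measurable_funM => //; exact: measurableT_comp.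
transitivity (\int[P]_w \int[@lebesgue_measure R]_x G (w, x))%E.
  apply: eq_integral => w _.
  have mFw : measurable_fun setT (fun y => F ((x0 w, V w), y)).
    by apply: measurableT_comp => //; exact: measurable_fun_pair.
  rewrite (ge0_integral_density eta_g mFw)//.
  under eq_integral do rewrite /F/= -EFinM.
  exact: ge0_integral_affine_density.
rewrite (fubini_tonelli G mG); last by move=> z; rewrite lee_fin mulr_ge0.
apply: eq_integral => x _; rewrite -ge0_integralZl_EFin//.
- by move=> w _; rewrite lee_fin.
- by apply/measurable_EFinP; apply: measurable_affine_density => //; exact: measurableT_comp.
Qed.

(** With [V] frozen, the left side is an average over [eta] with [f0] evaluated, and the right side
    an average over [x0] with [g] evaluated. The reflected substitution identifies them, and the
    dependence on [x] passes from [f0] to the Lipschitz function [g]. *)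
Lemma integral_affine_density_x0 (x : R) : is_density P x0 f0 ->
  independent2 P V eta -> independent2 P V x0 ->
  (\int[P]_w (f0 (x * expR (- k (V w)) - (eta w * D (V w) + E (V w))) *
     expR (- k (V w)))%:E =
   \int[P]_w (affine_density g (k (V w)) (D (V w)) (E (V w)) (x0 w) x)%:E)%E.
Proof.
move=> x0_f0 iVe iVx; have [_ f00 mf0 _] := x0_f0; have [meta g0 mg etaP] := eta_g.
have mv1 (q : TV -> R) : measurable_fun setT q ->
    measurable_fun setT (fun z : TV * R => q z.1).
  by move=> mq; exact: measurableT_comp.
pose F (z : TV * R) :=
  (f0 (x * expR (- k z.1) - (z.2 * D z.1 + E z.1)) * expR (- k z.1))%:E.
have mek : measurable_fun setT (fun z : TV * R => expR (- k z.1)).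
  by apply: measurableT_comp => //; apply: measurable_funN; exact: mv1.
have mF : measurable_fun setT F.
  apply/measurable_EFinP; apply: measurable_funM => //.
  apply: measurableT_comp => //; apply: measurable_funB; first exact: measurable_funM.
  by apply: measurable_funD; [apply: measurable_funM => //|]; exact: mv1.
have F0 z : (0 <= F z)%E by rewrite lee_fin mulr_ge0// expR_ge0.
pose G (z : TV * R) :=
  (affine_density g (k z.1) (D z.1) (E z.1) z.2 x)%:E.
have mG : measurable_fun setT G.
  by apply/measurable_EFinP; apply: measurable_affine_density => //; exact: mv1.
have G0 z : (0 <= G z)%E by rewrite lee_fin affine_density_ge0.
transitivity (\int[P]_w F (V w, eta w))%E => //.
transitivity (\int[P]_w G (V w, x0 w))%E => //.
rewrite (ge0_integral_independent2 mV meta iVe mF F0).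
rewrite (ge0_integral_independent2 mV mx0 iVx mG G0).
apply: eq_integral => w _.
have mFw : measurable_fun setT (fun y => F (V w, y)).
  by apply: measurableT_comp => //; exact: measurable_fun_pair.
have mGw : measurable_fun setT (fun y => G (V w, y)).
  by apply: measurableT_comp => //; exact: measurable_fun_pair.
rewrite (ge0_integral_density eta_g mFw)//.
rewrite (ge0_integral_density x0_f0 mGw)//.
under eq_integral do rewrite /F/= -EFinM.
under [RHS]eq_integral do rewrite /G/= -EFinM.
exact: ge0_integral_reflected_density.
Qed.

End affine_law.

(** * Passage to the limit in the density *)

Section density_limit.
Context d (Omega : measurableType d) (R : realType) (P : probability Omega R).
Variables (g : R -> R) (M Cg C d0 d1 : R).
Variables (x0 eta k D E W X : Omega -> R) (k_ D_ E_ Delta : nat -> Omega -> R).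
Hypotheses (mg : measurable_fun setT g) (gM : forall y, 0 <= g y <= M).
Hypotheses (Cg_ge0 : 0 <= Cg) (gL : forall y z, `|g y - g z| <= Cg * `|y - z|).
Hypotheses (d0_gt0 : 0 < d0) (d1_ge1 : 1 <= d1).
Hypotheses (mx0 : measurable_fun setT x0) (meta : measurable_fun setT eta).
Hypotheses (mk : measurable_fun setT k) (mD : measurable_fun setT D).
Hypotheses (mE : measurable_fun setT E) (mX : measurable_fun setT X).
Hypotheses (mk_ : forall n, measurable_fun setT (k_ n)).
Hypotheses (mD_ : forall n, measurable_fun setT (D_ n)).
Hypotheses (mE_ : forall n, measurable_fun setT (E_ n)).
Hypotheses (mDelta : forall n, measurable_fun setT (Delta n)).
Hypotheses (Delta_ge0 : forall n w, 0 <= Delta n w).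
Hypotheses (D_gt0 : forall w, 0 < D w) (D_n_gt0 : forall n w, 0 < D_ n w).
Hypothesis lim_bounds : {ae P, forall w,
  [/\ `|k w| <= C, d0 <= D w, D w <= d1, 1 <= W w & `|x0 w| + `|eta w| + `|E w| <= W w]}.
Hypothesis n_bounds : forall n, {ae P, forall w, `|k_ n w| <= C /\ d0 <= D_ n w}.
Hypothesis errors : forall n, {ae P, forall w,
  W w * (`|k_ n w - k w| + `|D_ n w - D w|) + `|E_ n w - E w| <= Delta n w}.
Hypothesis Delta_cvg0 : forall e, 0 < e ->
  \forall n \near \oo, (\int[P]_w (Delta n w)%:E <= e%:E)%E.
Hypothesis XE : {ae P, forall w, X w = expR (k w) * (x0 w + eta w * D w + E w)}.
Hypothesis law_n : forall n (h : R -> R), measurable_fun setT h ->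
  (forall x, 0 <= h x) ->
  (\int[P]_w (h (expR (k_ n w) * (x0 w + eta w * D_ n w + E_ n w)))%:E =
   \int[@lebesgue_measure R]_x ((h x)%:E *
     \int[P]_w (affine_density g (k_ n w) (D_ n w) (E_ n w) (x0 w) x)%:E))%E.

Let f_ n x := \int[P]_w affine_density g (k_ n w) (D_ n w) (E_ n w) (x0 w) x.
Let f x := \int[P]_w affine_density g (k w) (D w) (E w) (x0 w) x.

Let c := expR C * (d0^-1 + d0^-1 ^+ 2).

Let M_ge0 : 0 <= M.
Proof. by have /andP[a b] := gM 0; exact: le_trans b. Qed.

Let aff_le kk DD EE xx x : `|kk| <= C -> d0 <= DD ->
  `|affine_density g kk DD EE xx x| <= M * (expR C / d0).
Proof.
move=> kC dD; have D0 : 0 < DD by exact: lt_le_trans dD.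
rewrite ger0_norm; last by apply: affine_density_ge0 => // y; have /andP[] := gM y.
apply: ler_pM.
- by have /andP[] := gM ((x * expR (- kk) - EE - xx) / DD).
- by rewrite divr_ge0 ?expR_ge0// ltW.
- by have /andP[] := gM ((x * expR (- kk) - EE - xx) / DD).
- apply: ler_pM; rewrite ?expR_ge0// ?invr_ge0 ?(ltW D0)// ?lef_pV2// ler_expR.
  by apply: le_trans kC; rewrite -normrN ler_norm.
Qed.

Let int_cst (B : R) : P.-integrable setT (EFin \o (fun=> B)).
Proof.
have PT : (P setT < +oo)%E by rewrite probability_setT ltry.
exact: integrable_cst_lty.
Qed.

Let int_aff x : P.-integrable setT
  (EFin \o (fun w => affine_density g (k w) (D w) (E w) (x0 w) x)).
Proof.
apply: (@integrable_ae_le _ _ _ _ _ (fun=> M * (expR C / d0))).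
- exact: measurable_affine_density.
- by move=> _; rewrite mulr_ge0// divr_ge0 ?expR_ge0// ltW.
- exact: int_cst.
- by apply: filterS lim_bounds => w [? ? _ _ _]; exact: aff_le.
Qed.

Let int_aff_ n x : P.-integrable setT
  (EFin \o (fun w => affine_density g (k_ n w) (D_ n w) (E_ n w) (x0 w) x)).
Proof.
apply: (@integrable_ae_le _ _ _ _ _ (fun=> M * (expR C / d0))).
- exact: measurable_affine_density.
- by move=> _; rewrite mulr_ge0// divr_ge0 ?expR_ge0// ltW.
- exact: int_cst.
- by apply: filterS (n_bounds n) => w [? ?]; exact: aff_le.
Qed.

Lemma integrable_affine_density_n n x : P.-integrable setT
  (EFin \o (fun w => affine_density g (k_ n w) (D_ n w) (E_ n w) (x0 w) x)).
Proof. exact: int_aff_. Qed.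

(** The kernel estimate, with [X := |B|], has a constant [L] that depends neither on [x] in the ball
    nor on [n]. The difference is therefore at most [L] times the mean of [Delta n]. *)
Lemma density_limit_cvg (B eps : R) : 0 < eps ->
  \forall n \near \oo, forall x, `|x| <= B -> `|f_ n x - f x| <= eps.
Proof.
move=> eps0; pose L := Cg * c ^+ 2 * (1 + `|B|) + M * c.
have c0 : 0 <= c by rewrite mulr_ge0 ?expR_ge0// addr_ge0 ?sqr_ge0// invr_ge0 ltW.
have L0 : 0 <= L.
  by rewrite /L addr_ge0// mulr_ge0// ?addr_ge0// mulr_ge0// sqr_ge0.
(* The denominator is [L + 1] because [L] may be 0. *)
have e0 : 0 < eps / (L + 1) by rewrite divr_gt0//; lra.
apply: filterS (Delta_cvg0 e0) => n Hn x xB.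
have H : (`|f_ n x - f x|%:E <= L%:E * \int[P]_w (Delta n w)%:E)%E.
  apply: Rintegral_ae_dist => //.
  apply: filterS3 lim_bounds (n_bounds n) (errors n) => w [kC dD _ W1 WE] [knC dDn] err.
  have WE' : `|x0 w| + `|E w| <= W w by have := normr_ge0 (eta w); lra.
  have xB' : `|x| <= `|B| by apply: (le_trans xB); exact: ler_norm.
  apply: (le_trans (affine_density_dist (E_ n w) gM Cg_ge0 gL d0_gt0 knC kC dDn dD xB' W1 WE')).
  by apply: ler_wpM2l.
rewrite -lee_fin; apply: (le_trans H).
apply: (@le_trans _ _ (L%:E * (eps / (L + 1))%:E)%E); first by rewrite lee_wpmul2l// lee_fin.
rewrite -EFinM lee_fin mulrCA ler_piMr// ?ltW//.
by rewrite ltr_pdivrMr; lra.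
Qed.

(** For a test function [h], the law of the [n]-th approximation gives [E h(X_n) = \int h f_n]. The
    left side tends to [E h(X)] because [h] is Lipschitz, and the right side to [\int h f] because
    [f_n] converges uniformly on the bounded support of [h]. *)
Lemma density_limit_is_density : is_density P X f.
Proof.
have g0 y : 0 <= g y by have /andP[] := gM y.
have f_ge0 x : 0 <= f x.
  by apply: Rintegral_ge0 => w _; exact: affine_density_ge0.
have mpair (q : Omega -> R) : measurable_fun setT q ->
    measurable_fun setT (fun z : R * Omega => q z.2).
  by move=> mq; exact: measurableT_comp.
have mf : measurable_fun setT f.
  apply: (@measurable_Rintegral_param _ _ _ _ _ P (fun z : R * Omega =>
    affine_density g (k z.2) (D z.2) (E z.2) (x0 z.2) z.1)).
  by apply: measurable_affine_density => //; exact: mpair.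
have mf_ n : measurable_fun setT (f_ n).
  apply: (@measurable_Rintegral_param _ _ _ _ _ P (fun z : R * Omega =>
    affine_density g (k_ n z.2) (D_ n z.2) (E_ n z.2) (x0 z.2) z.1)).
  by apply: measurable_affine_density => //; exact: mpair.
have f__ge0 n x : 0 <= f_ n x.
  by apply: Rintegral_ge0 => w _; exact: affine_density_ge0.
have fbd x : f x <= M * (expR C / d0).
  rewrite /f; apply: (@le_trans _ _ (\int[P]_w (M * (expR C / d0)))).
    rewrite -lee_fin /Rintegral !fineK; last 2 first.
    - exact: (integrable_fin_num measurableT (int_cst _)).
    - exact: (integrable_fin_num measurableT (int_aff _)).
    apply: ae_ge0_le_integral => //.
    - by move=> w _; rewrite lee_fin affine_density_ge0.
    - exact: (measurable_int _ (int_aff x)).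
    - by move=> w _; rewrite lee_fin mulr_ge0// divr_ge0 ?expR_ge0// ltW.
    - apply: filterS lim_bounds => w [? ? _ _ _] _; rewrite lee_fin.
      by apply: le_trans (aff_le _ _ _ _ _); first exact: ler_norm.
  by rewrite Rintegral_probability_cst.
have f_bd n x : f_ n x <= M * (expR C / d0).
  rewrite /f_; apply: (@le_trans _ _ (\int[P]_w (M * (expR C / d0)))).
    rewrite -lee_fin /Rintegral !fineK; last 2 first.
    - exact: (integrable_fin_num measurableT (int_cst _)).
    - exact: (integrable_fin_num measurableT (int_aff_ _ _)).
    apply: ae_ge0_le_integral => //.
    - by move=> w _; rewrite lee_fin affine_density_ge0.
    - exact: (measurable_int _ (int_aff_ n x)).
    - by move=> w _; rewrite lee_fin mulr_ge0// divr_ge0 ?expR_ge0// ltW.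
    - apply: filterS (n_bounds n) => w [? ?] _; rewrite lee_fin.
      by apply: le_trans (aff_le _ _ _ _ _); first exact: ler_norm.
  by rewrite Rintegral_probability_cst.
apply: is_density_of_test_functions => // h K B mh h01 hL hB.
have h0 x : 0 <= h x by have /andP[] := h01 x.
pose X_ n w := expR (k_ n w) * (x0 w + eta w * D_ n w + E_ n w).
have mX_ n : measurable_fun setT (X_ n).
  apply: measurable_funM; first exact: measurableT_comp.
  by do 2 apply: measurable_funD => //; exact: measurable_funM.
have inth (Y : Omega -> R) : measurable_fun setT Y ->
    P.-integrable setT (EFin \o (fun w => h (Y w))).
  move=> mY; apply: (@integrable_ae_le _ _ _ _ _ (fun=> 1)) => //.
    exact: measurableT_comp.
  by apply: aeW => w; rewrite ger0_norm//; have /andP[] := h01 (Y w).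
(* Outside this interval [h] vanishes. The absolute value is there because [B] may be negative. *)
pose I : set R := `[- `|B|, `|B|]%classic.
have mI : measurable I by exact: measurable_itv.
have Ioo : (@lebesgue_measure R I < +oo)%E.
  by rewrite /I lebesgue_measure_itv/=; case: ifPn => _ //; rewrite -EFinD ltry.
have hI x : ~~ (x \in I) -> h x = 0.
  move=> xI; apply: hB; apply: (@le_lt_trans _ _ `|B|); first exact: ler_norm.
  by rewrite ltNge; apply: contra xI => xB; rewrite inE /I/= in_itv/= -ler_norml.
have intI : (@lebesgue_measure R).-integrable setT (EFin \o (\1_I : R -> R)).
  apply/integrableP; split; first exact/measurable_EFinP.
  under eq_integral do rewrite gee0_abs ?lee_fin//.
  by rewrite integral_indic// setIT.
have inthf (q : R -> R) : measurable_fun setT q -> (forall x, 0 <= q x <= M * (expR C / d0)) ->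
    (@lebesgue_measure R).-integrable setT (EFin \o (fun x => h x * q x)).
  move=> mq q0.
  apply: (@integrable_ae_le _ (measurableTypeR R) R (@lebesgue_measure R) _
    (fun x => (M * (expR C / d0)) * (\1_I x : R))).
  - exact: measurable_funM.
  - by move=> x; rewrite mulr_ge0// mulr_ge0// divr_ge0 ?expR_ge0// ltW.
  - exact: integrableZl_EFin.
  - apply: aeW => x; have /andP[q1 q2] := q0 x; rewrite ger0_norm ?mulr_ge0//.
    rewrite indicE; have [xI|xI] := boolP (x \in I); last by rewrite hI// mul0r mulr0.
    rewrite mulr1 -[leRHS]mul1r; apply: ler_pM => //.
    by have /andP[] := h01 x.
have intf := inthf f mf (fun x => introT andP (conj (f_ge0 x) (fbd x))).
have intf_ n := inthf (f_ n) (mf_ n) (fun x => introT andP (conj (f__ge0 n x) (f_bd n x))).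
have lawE n : \int[P]_w h (X_ n w) = \int[@lebesgue_measure R]_x (h x * f_ n x).
  rewrite /Rintegral /X_ law_n//; congr fine; apply: eq_integral => x _.
  by rewrite EFinM fineK//; exact: (integrable_fin_num measurableT (int_aff_ n x)).
suff : \int[P]_w h (X w) = \int[@lebesgue_measure R]_x (h x * f x).
  move=> H; have f1 := integrable_fin_num measurableT (inth X mX).
  have f2 := integrable_fin_num measurableT intf.
  by rewrite -(fineK f1) -(fineK f2); exact: (congr1 EFin H).
apply/eqP; rewrite -subr_eq0 -normr_eq0; apply/eqP/le_anti/andP; split => //.
suff small (e : R) : 0 < e ->
    `|\int[P]_w h (X w) - \int[@lebesgue_measure R]_x (h x * f x)| <= e.
  by apply/ler_addgt0Pr => e e0; rewrite add0r; exact: small.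
move=> e0; pose L : R := `|K| * (expR C * (1 + d1)).
have d10 : 0 <= 1 + d1 by rewrite addr_ge0// (le_trans ler01).
have L0 : 0 <= L by rewrite /L mulr_ge0// mulr_ge0// expR_ge0.
have e1 : 0 < e / 2 / (L + 1) by rewrite !divr_gt0//; lra.
(* The interval [I] has length [2 |B|], so a uniform error [e'] on it contributes at most
   [e / 2]. *)
pose e' : R := e / 2 / (2 * `|B| + 1).
have e2 : 0 < e'.
  by rewrite /e' !divr_gt0//; have := normr_ge0 B; lra.
near \oo => n.
have Hn : (\int[P]_w (Delta n w)%:E <= (e / 2 / (L + 1))%:E)%E.
  by near: n; exact: Delta_cvg0.
have Hf : forall x, `|x| <= `|B| -> `|f_ n x - f x| <= e'.
  by near: n; exact: density_limit_cvg.
have A1 : `|\int[P]_w h (X_ n w) - \int[P]_w h (X w)| <= e / 2.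
  rewrite -lee_fin; apply: (@le_trans _ _ (L%:E * \int[P]_w (Delta n w)%:E)%E).
    apply: Rintegral_ae_dist => //; [exact: inth|exact: inth|].
    apply: filterS2 XE (filterI lim_bounds (filterI (n_bounds n) (errors n))) =>
      w XEw [[kC dD Dd1 W1 WE] [[knC dDn] err]].
    apply: (le_trans (hL _ _)); rewrite -mulrA.
    apply: (@le_trans _ _ (`|K| * `|X_ n w - X w|)).
      by rewrite ler_wpM2r// ler_norm.
    apply: ler_wpM2l => //; rewrite XEw.
    exact: (affine_solution_dist knC kC (ltW (D_gt0 w)) Dd1 d1_ge1 WE err).
  apply: (@le_trans _ _ (L%:E * (e / 2 / (L + 1))%:E)%E); first by rewrite lee_wpmul2l// lee_fin.
  rewrite -EFinM lee_fin mulrCA ler_piMr//; first lra.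
  by rewrite ler_pdivrMr; lra.
have A2 : `|\int[@lebesgue_measure R]_x (h x * f_ n x) -
            \int[@lebesgue_measure R]_x (h x * f x)| <= e / 2.
  rewrite -lee_fin; apply: (@le_trans _ _ (e'%:E * \int[@lebesgue_measure R]_x (\1_I x : R)%:E)%E).
    apply: Rintegral_ae_dist => //; first exact: ltW.
    apply: aeW => x; rewrite -mulrBr normrM ger0_norm// indicE.
    have [xI|xI] := boolP (x \in I); last by rewrite hI// mul0r mulr0.
    rewrite mulr1 -[leRHS]mul1r; apply: ler_pM => //.
      by have /andP[] := h01 x.
    by apply: Hf; move: xI; rewrite inE /I/= in_itv/= -ler_norml.
  rewrite integral_indic// setIT.
  apply: (@le_trans _ _ (e'%:E * (2 * `|B|)%:E)%E).
    apply: lee_wpmul2l; first by rewrite lee_fin ltW.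
    apply: (@le_trans _ _ (@lebesgue_measure R I)) => //.
    rewrite /I lebesgue_measure_itv/=; case: ifPn => _.
      by rewrite -EFinD lee_fin; lra.
    by rewrite lee_fin mulr_ge0.
  have B0 := normr_ge0 B.
  rewrite -EFinM lee_fin.
  have -> : e' * (2 * `|B|) = e / 2 * (2 * `|B| / (2 * `|B| + 1)) by rewrite /e'; ring.
  rewrite ler_piMr//; first lra.
  by rewrite ler_pdivrMr; lra.
rewrite lawE in A1.
apply: (le_trans (ler_distD (\int[@lebesgue_measure R]_x (h x * f_ n x)) _ _)).
by rewrite [leRHS]splitr; apply: lerD; [rewrite distrC; exact: A1|exact: A2].
Unshelve. all: by end_near. Qed.

End density_limit.

(** * Integrals along a single path *)

Section integral_itv.
Context d (X : measurableType d) (R : realType).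
Local Notation leb := (@lebesgue_measure R).

(** Moving endpoints are absorbed into the integrand as a jointly measurable cut-off, which leaves
    an integral over the whole line depending on a parameter. *)
Lemma measurable_integral_itv (F : X * R -> R) (l u : X -> R) :
  measurable_fun setT F -> measurable_fun setT l -> measurable_fun setT u ->
  measurable_fun setT (fun x => \int[leb]_(r in `[l x, u x]%classic) F (x, r)).
Proof.
move=> mF ml mu.
pose G (z : X * measurableTypeR R) :=
  if l z.1 <= z.2 then (if z.2 <= u z.1 then F z else 0) else 0.
have mG : measurable_fun setT G.
  have m1 (q : X -> R) : measurable_fun setT q ->
      measurable_fun setT (fun z : X * measurableTypeR R => q z.1).
    by move=> mq; exact: measurableT_comp.
  have m2 : measurable_fun setT (fun z : X * measurableTypeR R => z.2 : R).
    exact: measurable_snd.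
  apply: measurable_fun_ifT => //.
    by apply: measurable_fun_ler => //; exact: m1.
  apply: measurable_fun_ifT => //.
  by apply: measurable_fun_ler => //; exact: m1.
rewrite (_ : (fun x => _) = fun x => \int[leb]_r G (x, r)).
  exact: measurable_Rintegral_param.
apply/funext => x; rewrite Rintegral_mkcond; apply: eq_Rintegral => r _.
rewrite patchE /G/= mem_setE in_itv/=.
by case: (l x <= r) => //=.
Qed.

End integral_itv.

Section path.
Context {R : realType} (t0 T : R).
Local Notation leb := (@lebesgue_measure R).
Local Notation I := (`[t0, T]%classic).
Implicit Types (f h al be ka : R -> R) (s t C : R).

Definition primitive f s := \int[leb]_(r in `[t0, s]%classic) f r.

Let subI s : s <= T -> `[t0, s]%classic `<=` I.
Proof. by move=> sT r /=; rewrite !in_itv/= => /andP[-> /le_trans]; apply. Qed.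

Lemma integrable_sub_itv f s : s <= T -> leb.-integrable I (EFin \o f) ->
  leb.-integrable `[t0, s]%classic (EFin \o f).
Proof. by move=> sT; apply: integrableS => //; exact: subI. Qed.

Lemma Rintegral_norm_subset f s : s <= T -> leb.-integrable I (EFin \o f) ->
  \int[leb]_(r in `[t0, s]%classic) `|f r| <= \int[leb]_(r in I) `|f r|.
Proof.
move=> sT fI.
have nI : leb.-integrable I (EFin \o (fun r => `|f r|)) by exact: integrable_norm.
have ns := integrable_sub_itv sT nI.
apply: fine_le.
- exact: (integrable_fin_num _ ns).
- exact: (integrable_fin_num _ nI).
- apply: ge0_subset_integral => //; last exact: subI.
  exact: (measurable_int _ nI).
Qed.

Lemma primitive_le f s : s <= T -> leb.-integrable I (EFin \o f) ->
  `|primitive f s| <= \int[leb]_(r in I) `|f r|.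
Proof.
move=> sT fI; apply: le_trans (Rintegral_norm_subset sT fI).
by apply: le_normr_Rintegral => //; exact: integrable_sub_itv fI.
Qed.

Lemma primitive_dist f h s : s <= T -> leb.-integrable I (EFin \o f) ->
  leb.-integrable I (EFin \o h) ->
  `|primitive f s - primitive h s| <= \int[leb]_(r in I) `|f r - h r|.
Proof.
move=> sT fI hI; rewrite /primitive -RintegralB//; last 2 first.
- exact: integrable_sub_itv fI.
- exact: integrable_sub_itv hI.
by apply: (@primitive_le (fun r => f r - h r)) => //; exact: integrableB_EFin.
Qed.

Lemma measurable_primitive f : measurable_fun setT f ->
  measurable_fun setT (primitive f).
Proof.
move=> mf.
by apply: (@measurable_integral_itv _ R R (f \o snd) (cst t0) id) => //; exact: measurableT_comp.
Qed.

Lemma integrable_weight be ka C : leb.-integrable I (EFin \o be) ->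
  measurable_fun setT ka -> (forall s, t0 <= s <= T -> `|ka s| <= C) ->
  leb.-integrable I (EFin \o (fun s => be s * expR (- ka s))).
Proof.
move=> bI mk kC.
have bI' : leb.-integrable I (EFin \o (fun s => expR C * be s)) by exact: integrableZl_EFin.
apply: le_integrable bI' => //.
- apply/measurable_EFinP; apply: measurable_funM.
    by apply/measurable_EFinP; exact: (measurable_int _ bI).
  apply: measurable_funS (_ : measurable_fun setT _) => //.
  by apply: measurableT_comp => //; exact: measurable_funN.
- move=> s; rewrite /= in_itv/= => sI; rewrite lee_fin !normrM mulrC.
  rewrite ler_wpM2r// !ger0_norm ?expR_ge0// ler_expR.
  by apply: le_trans (kC s sI); rewrite -normrN ler_norm.
Qed.

Section weighted.
Variables (C t : R) (tT : t <= T).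

Lemma weighted_integral_le be al :
  leb.-integrable I (EFin \o be) -> measurable_fun setT al ->
  leb.-integrable I (EFin \o al) -> \int[leb]_(r in I) `|al r| <= C ->
  `|\int[leb]_(s in `[t0, t]%classic) (be s * expR (- primitive al s))| <=
  expR C * \int[leb]_(r in I) `|be r|.
Proof.
move=> bI mal aI aC.
have kC s : t0 <= s <= T -> `|primitive al s| <= C.
  by move=> /andP[_ sT]; apply: le_trans aC; exact: primitive_le.
have mk := measurable_primitive mal.
have wI := integrable_weight bI mk kC.
apply: (le_trans (primitive_le tT wI)).
have nbI : leb.-integrable I (EFin \o (fun r => `|be r|)) by exact: integrable_norm.
rewrite -RintegralZl//; apply: le_Rintegral => //.
- exact: integrable_norm wI.
- exact: integrableZl_EFin.
- move=> s; rewrite /= in_itv/= => sI; rewrite normrM mulrC ler_wpM2r//.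
  rewrite ger0_norm ?expR_ge0// ler_expR.
  by apply: le_trans (kC s sI); rewrite -normrN ler_norm.
Qed.

(** The error in the drift is multiplied by the mass of [be'] only. With the limit in the primed
    position, the estimate involves the mass of the limiting source and never that of the
    truncations. *)
Lemma weighted_integral_dist be be' al al' :
  leb.-integrable I (EFin \o be) -> leb.-integrable I (EFin \o be') ->
  measurable_fun setT al -> measurable_fun setT al' ->
  leb.-integrable I (EFin \o al) -> leb.-integrable I (EFin \o al') ->
  \int[leb]_(r in I) `|al r| <= C -> \int[leb]_(r in I) `|al' r| <= C ->
  `|\int[leb]_(s in `[t0, t]%classic) (be s * expR (- primitive al s)) -
    \int[leb]_(s in `[t0, t]%classic) (be' s * expR (- primitive al' s))| <=
  expR C * \int[leb]_(r in I) `|be r - be' r| +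
  expR C * (\int[leb]_(r in I) `|be' r| * \int[leb]_(r in I) `|al r - al' r|).
Proof.
move=> bI b'I mal mal' aI a'I aC a'C.
have kC s : t0 <= s <= T -> `|primitive al s| <= C.
  by move=> /andP[_ sT]; apply: le_trans aC; exact: primitive_le.
have k'C s : t0 <= s <= T -> `|primitive al' s| <= C.
  by move=> /andP[_ sT]; apply: le_trans a'C; exact: primitive_le.
have wI := integrable_weight bI (measurable_primitive mal) kC.
have w'I := integrable_weight b'I (measurable_primitive mal') k'C.
apply: (le_trans (primitive_dist tT wI w'I)).
set A := \int[leb]_(r in I) `|al r - al' r|.
have dI : leb.-integrable I (EFin \o (fun s => be s - be' s)) by exact: integrableB_EFin.
have nd : leb.-integrable I (EFin \o (fun r => `|be r - be' r|)) by exact: integrable_norm dI.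
have nb' : leb.-integrable I (EFin \o (fun r => `|be' r|)) by exact: integrable_norm.
have i1 : leb.-integrable I (EFin \o (fun r => expR C * `|be r - be' r|)) by exact: integrableZl_EFin.
have i2 : leb.-integrable I (EFin \o (fun r => (expR C * A) * `|be' r|)) by exact: integrableZl_EFin.
have -> : expR C * (\int[leb]_(r in I) `|be' r| * A) =
    \int[leb]_(r in I) ((expR C * A) * `|be' r|).
  by rewrite RintegralZl//; ring.
rewrite -RintegralZl// -RintegralD//; apply: le_Rintegral => //.
- exact: integrable_norm (integrableB_EFin _ wI w'I).
- exact: integrableD_EFin.
move=> s; rewrite /= in_itv/= => sI; have /andP[_ sT] := sI.
have -> : be s * expR (- primitive al s) - be' s * expR (- primitive al' s) =
  expR (- primitive al s) * (be s - be' s) +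
  (expR (- primitive al s) - expR (- primitive al' s)) * be' s by ring.
apply: (le_trans (ler_normD _ _)); rewrite !normrM; apply: lerD.
  rewrite ler_wpM2r// ger0_norm ?expR_ge0// ler_expR.
  by apply: le_trans (kC s sI); rewrite -normrN ler_norm.
rewrite ler_wpM2r//.
have kN : `|- primitive al s| <= C by rewrite normrN kC.
have k'N : `|- primitive al' s| <= C by rewrite normrN k'C.
apply: (le_trans (dist_expR kN k'N)); rewrite ler_wpM2l ?expR_ge0//.
by rewrite -opprD normrN primitive_dist.
Qed.

Hypothesis t0t : t0 < t.

(** The leading eigenfunction is positive only on the open interval, so the endpoints have to be
    discarded before positivity can be used. *)
Lemma Rintegral_itvoo f : leb.-integrable I (EFin \o f) ->
  \int[leb]_(s in `[t0, t]%classic) f s = \int[leb]_(s in `]t0, t[%classic) f s.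
Proof.
move=> fI; have fct := integrable_sub_itv tT fI.
have oc : leb.-integrable `]t0, t]%classic (EFin \o f).
  by apply: integrableS fct => //; exact: subset_itv_oc_cc.
have oo : leb.-integrable `]t0, t[%classic (EFin \o f).
  by apply: integrableS fct => //; exact: subset_itv_oo_cc.
by rewrite Rintegral_itv_bndo_bndc// Rintegral_itv_obnd_cbnd.
Qed.

(** If the integral vanished, [f] would be 0 almost everywhere on an interval of positive length on
    which it is positive. *)
Lemma Rintegral_gt0 f : leb.-integrable I (EFin \o f) ->
  (forall s, t0 < s < T -> 0 < f s) ->
  0 < \int[leb]_(s in `[t0, t]%classic) f s.
Proof.
move=> fI f0; rewrite Rintegral_itvoo//.
set J := `]t0, t[%classic.
have mJ : measurable (J : set (measurableTypeR R)) by exact: measurable_itv.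
have oo : leb.-integrable J (EFin \o f).
  apply: integrableS fI => // s; rewrite /J /= !in_itv/= => /andP[/ltW -> /ltW st].
  exact: le_trans tT.
have fJ s : J s -> 0 < f s.
  by rewrite /J/= in_itv/= => /andP[s0 st]; apply: f0; rewrite s0 (lt_le_trans st).
rewrite lt_neqAle Rintegral_ge0 ?andbT; last by move=> s /fJ/ltW.
apply/eqP => H.
have H0 : (\int[leb]_(s in J) `|(EFin \o f) s| = 0)%E.
  transitivity (\int[leb]_(s in J) (f s)%:E)%E.
    by apply: eq_integral => s /set_mem sJ /=; rewrite ger0_norm// ltW// fJ.
  by rewrite -[LHS]fineK ?(integrable_fin_num _ oo)//; exact: (congr1 EFin (esym H)).
have /(ae_eq_integral_abs leb mJ (measurable_int _ oo))[N [mN N0 JN]] := H0.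
have : (leb J <= leb N)%E.
  apply: le_measure; rewrite ?inE// => s sJ; apply: JN => /= /(_ sJ) [] fs0.
  by have := fJ s sJ; rewrite fs0 ltxx.
rewrite [X in (_ <= X)%E -> _]N0 /J lebesgue_measure_itv/= lte_fin t0t -EFinD lee_fin.
by rewrite leNgt subr_gt0 t0t.
Qed.

(** The lower bound depends on the drift only through [C]. This makes the coefficient of [eta 0]
    bounded below by one positive constant for almost every path and every truncation. *)
Lemma weighted_integral_ge be al :
  leb.-integrable I (EFin \o be) -> (forall s, t0 < s < T -> 0 < be s) ->
  measurable_fun setT al -> leb.-integrable I (EFin \o al) ->
  \int[leb]_(r in I) `|al r| <= C ->
  expR (- C) * \int[leb]_(s in `[t0, t]%classic) be s <=
  \int[leb]_(s in `[t0, t]%classic) (be s * expR (- primitive al s)).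
Proof.
move=> bI b0 mal aI aC.
have kC s : t0 <= s <= T -> `|primitive al s| <= C.
  by move=> /andP[_ sT]; apply: le_trans aC; exact: primitive_le.
have wI := integrable_weight bI (measurable_primitive mal) kC.
rewrite (Rintegral_itvoo bI) (Rintegral_itvoo wI).
have sub : `]t0, t[%classic `<=` I.
  move=> s; rewrite /= !in_itv/= => /andP[/ltW -> /ltW st]; exact: le_trans tT.
have bJ : leb.-integrable `]t0, t[%classic (EFin \o be) by apply: integrableS bI.
have wJ : leb.-integrable `]t0, t[%classic (EFin \o (fun s => be s * expR (- primitive al s))).
  by apply: integrableS wI.
rewrite -RintegralZl//; apply: le_Rintegral => //; first exact: integrableZl_EFin.
move=> s sJ; have sI := sub s sJ; move: sJ sI.
rewrite /= !in_itv/= => /andP[s0 st] sI.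
rewrite mulrC ler_wpM2l//; first by rewrite ltW// b0// s0 (lt_le_trans st).
rewrite ler_expR lerN2; apply: le_trans (kC s sI); exact: ler_norm.
Qed.

End weighted.

End path.

(** * Truncated Karhunen-Loeve expansions *)

Lemma in_range_trunc_len L N j : (j < trunc_len L N)%N -> in_range L j.
Proof. by case: L => //= m; rewrite leq_min => /andP[]. Qed.

Lemma trunc_len_homo L : {homo trunc_len L : m n / (m <= n)%N}.
Proof. by case: L => //= k m n mn; rewrite leq_min !geq_min mn leqnn orbT. Qed.

Lemma cvge0_le (R : realType) (u : nat -> \bar R) (e : R) :
  u @ \oo --> 0%E -> 0 < e -> \forall n \near \oo, (u n <= e%:E)%E.
Proof.
move=> u0 e0.
have H : nbhs (0%E : \bar R) [set x | x < e%:E]%E.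
  by apply: open_nbhs_nbhs; split; [exact: open_ereal_lt_ereal|rewrite /= lte_fin].
have H' : \forall n \near \oo, (u n < e%:E)%E by exact: (u0 _ H).
by apply: filterS H' => n /ltW.
Qed.

Lemma integral_probability_cst d (Omega : measurableType d) (R : realType)
  (P : probability Omega R) (r : R) : (\int[P]_w r%:E = r%:E)%E.
Proof.
rewrite integral_cst//.
exact: (etrans (congr1 (fun x => r%:E * x)%E (@probability_setT _ _ _ P)) (mule1 _)).
Qed.

Section square_integrals.
Context {R : realType} d (Omega : measurableType d) (P : probability Omega R).
Context (t0 T : R) (t0T : t0 < T).
Local Notation leb := (@lebesgue_measure R).
Local Notation I := (`[t0, T]%classic).

Lemma lebesgue_measure_I : leb I = (T - t0)%:E.
Proof. by rewrite lebesgue_measure_itv/= lte_fin t0T EFinD. Qed.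

(** Cauchy-Schwarz in time for each [w], then Tonelli. It converts an error in [L2] of the product
    into a path distance in [L2] of the probability space. *)
Lemma integral_sqr_Rintegral_le (F : R * Omega -> R) : measurable_fun setT F ->
  (\int[P]_w ((\int[leb]_(s in I) `|F (s, w)|) ^+ 2)%:E <=
   (T - t0)%:E * \int[leb \x P]_z (F z ^+ 2)%:E)%E.
Proof.
move=> mF.
have mF2 : measurable_fun setT (fun z : measurableTypeR R * Omega => (F z ^+ 2)%:E).
  by apply/measurable_EFinP; exact: measurable_funX.
have F20 (z : measurableTypeR R * Omega) : (0 <= (F z ^+ 2)%:E)%E.
  by rewrite lee_fin sqr_ge0.
have mFw w : measurable_fun setT (fun s : measurableTypeR R => F (s, w)).
  by apply: measurableT_comp => //; exact: measurable_fun_pair.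
rewrite (fubini_tonelli2 (fun z : measurableTypeR R * Omega => (F z ^+ 2)%:E) mF2 F20).
rewrite -ge0_integralZl_EFin//; last 3 first.
- by move=> w _; apply: integral_ge0 => s _; rewrite lee_fin sqr_ge0.
- exact: (measurable_fun_fubini_tonelli_G _ mF2 F20).
- by rewrite subr_ge0 ltW.
apply: ge0_le_integral => //.
- by move=> w _; rewrite lee_fin sqr_ge0.
- apply/measurable_EFinP; apply: measurable_funX.
  apply: (@measurable_integral_itv _ _ _ (fun z : Omega * R => `|F (z.2, z.1)|)) => //.
  apply: measurableT_comp => //; apply: measurableT_comp => //.
  exact: measurable_fun_pair.
- apply: emeasurable_funM => //.
  exact: (measurable_fun_fubini_tonelli_G _ mF2 F20).
move=> w _; have mI : measurable (I : set (measurableTypeR R)) by exact: measurable_itv.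
have mFI : measurable_fun (I : set (measurableTypeR R)) (fun s => F (s, w)).
  exact: measurable_funS (mFw w).
have I0 : (0 < leb I)%E by rewrite lebesgue_measure_I lte_fin subr_gt0.
have Ioo : (leb I < +oo)%E by rewrite lebesgue_measure_I ltry.
apply: (le_trans (sqr_Rintegral_le mI I0 Ioo mFI)).
rewrite -lebesgue_measure_I; apply: lee_wpmul2l; first exact: ltW.
apply: ge0_subset_integral => //.
by apply/measurable_EFinP; apply: measurable_funX.
Qed.

End square_integrals.

Section KL_process.
Context {R : realType} d (Omega : measurableType d) (P : probability Omega R).
Context (t0 T : R) (t0T : t0 < T) (a : R -> Omega -> R).
Local Notation leb := (@lebesgue_measure R).
Local Notation I := (`[t0, T]%classic).
Hypothesis aL2 : L2_process P t0 T a.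

(** The path extended by 0 outside [[t0, T]]. Measurability of the process is assumed for this
    extension, so paths and means are taken from it. *)
Definition path_on (w : Omega) (s : R) : R := restr t0 T a (s, w).

Definition mean_on (s : R) : R := \int[P]_w restr t0 T a (s, w).

Lemma mean_onE s : t0 <= s <= T -> mean_on s = mean_fun P a s.
Proof. by move=> sI; apply: eq_Rintegral => w _; rewrite /restr/= sI. Qed.

Lemma measurable_mean_on : measurable_fun setT mean_on.
Proof.
by have [ma _] := aL2; exact: (@measurable_Rintegral_param _ _ _ _ _ P).
Qed.

Lemma measurable_path_on w : measurable_fun setT (path_on w).
Proof.
have [ma _] := aL2; apply: measurableT_comp => //; exact: measurable_fun_pair.
Qed.

Let ma2 : measurable_fun setT
  (fun z : measurableTypeR R * Omega => (restr t0 T a z ^+ 2)%:E).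
Proof. by have [ma _] := aL2; apply/measurable_EFinP; exact: measurable_funX. Qed.

Let a20 (z : measurableTypeR R * Omega) : (0 <= (restr t0 T a z ^+ 2)%:E)%E.
Proof. by rewrite lee_fin sqr_ge0. Qed.

(** At each time, the square of the mean is at most the mean of the square. Tonelli integrates this
    over time. *)
Lemma integral_sqr_mean_on_le :
  (\int[leb]_s (mean_on s ^+ 2)%:E <= \int[leb \x P]_z (restr t0 T a z ^+ 2)%:E)%E.
Proof.
have [ma _] := aL2.
rewrite (fubini_tonelli1 _ ma2 a20); apply: ge0_le_integral => //.
- by move=> s _; rewrite lee_fin sqr_ge0.
- by apply/measurable_EFinP; apply: measurable_funX; exact: measurable_mean_on.
- exact: (measurable_fun_fubini_tonelli_F _ ma2 a20).
move=> s _; rewrite /fubini_F.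
have mas : measurable_fun setT (fun w => restr t0 T a (s, w)).
  by apply: measurableT_comp => //; exact: measurable_fun_pair.
have PT : P setT = 1%E by exact: probability_setT.
have [|oo] := leP +oo%E (\int[P]_w (restr t0 T a (s, w) ^+ 2)%:E)%E.
  by rewrite leye_eq => /eqP ->; exact: leey.
have P0 : (0 < P setT)%E by rewrite PT.
have Poo : (P setT < +oo)%E by rewrite PT ltry.
have ia := integrable_sqr measurableT Poo mas oo.
have E1 : (P setT * \int[P]_w (restr t0 T a (s, w) ^+ 2)%:E <=
    \int[P]_w (restr t0 T a (s, w) ^+ 2)%:E)%E by rewrite PT mul1e.
apply: le_trans (le_trans (sqr_Rintegral_le measurableT P0 Poo mas) E1).
rewrite lee_fin -(real_normK (num_real (mean_on s))) ler_sqr ?nnegrE//.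
  exact: le_normr_Rintegral.
exact: Rintegral_ge0.
Qed.

Lemma ae_sqr_path_on :
  {ae P, forall w, (\int[leb]_s (path_on w s ^+ 2)%:E < +oo)%E}.
Proof.
have [ma aoo] := aL2.
have int2 : P.-integrable setT (fun w => \int[leb]_s (path_on w s ^+ 2)%:E)%E.
  apply/integrableP; split; first exact: (measurable_fun_fubini_tonelli_G _ ma2 a20).
  have q0 w : (0 <= \int[leb]_s (path_on w s ^+ 2)%:E)%E.
    by apply: integral_ge0 => s _; rewrite lee_fin sqr_ge0.
  under eq_integral do rewrite gee0_abs//.
  by rewrite -(fubini_tonelli2 _ ma2 a20).
have := integrable_ae measurableT int2; apply: filterS => w /(_ Logic.I).
by rewrite ge0_fin_numE// integral_ge0// => s _; rewrite lee_fin sqr_ge0.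
Qed.

Lemma integrable_on_sqr (f : R -> R) : measurable_fun setT f ->
  (\int[leb]_s (f s ^+ 2)%:E < +oo)%E -> leb.-integrable I (EFin \o f).
Proof.
move=> mf f2.
have mI : measurable (I : set (measurableTypeR R)) by exact: measurable_itv.
have Ioo : (leb I < +oo)%E by rewrite (lebesgue_measure_I t0T) ltry.
have mfI : measurable_fun (I : set (measurableTypeR R)) f by exact: measurable_funS mf.
apply: (integrable_sqr mI Ioo mfI); apply: le_lt_trans f2.
apply: ge0_subset_integral => //.
  by apply/measurable_EFinP; apply: measurable_funX.
by move=> s _; rewrite lee_fin sqr_ge0.
Qed.

Lemma integrable_mean_on : leb.-integrable I (EFin \o mean_on).
Proof.
have [_ aoo] := aL2; apply: integrable_on_sqr; first exact: measurable_mean_on.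
exact: le_lt_trans integral_sqr_mean_on_le aoo.
Qed.

Lemma ae_integrable_path_on :
  {ae P, forall w, leb.-integrable I (EFin \o path_on w)}.
Proof.
apply: filterS ae_sqr_path_on => w; apply: integrable_on_sqr.
exact: measurable_path_on.
Qed.

Section truncated.
Variables (nu : nat -> R) (phi : nat -> R -> R) (n : nat).
Hypothesis mphi : forall j, (j < n)%N -> measurable_fun I (phi j).
Hypothesis iphi : forall j, (j < n)%N -> leb.-integrable I (EFin \o phi j).

Definition phi_on (f : R -> R) (s : R) : R := if t0 <= s <= T then f s else 0.

Lemma measurable_phi_on f : measurable_fun I f -> measurable_fun setT (phi_on f).
Proof.
move=> mf; have mI : measurable I by exact: measurable_itv.
rewrite (_ : phi_on f = f \_ I); first exact/(measurable_restrictT _ mI).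
by apply/funext => s; rewrite patchE mem_setE in_itv.
Qed.

(** The eigenvalues and eigenfunctions are free parameters, so that the families shifted by [S] can
    describe an expansion without its first mode. *)
Definition KL_on (v : n.-tuple R) : R -> R := phi_on (KL_sum P a nu phi v).

Lemma KL_onE v s : KL_on v s =
  phi_on mean_on s + \sum_(j < n) Num.sqrt (nu j) * phi_on (phi j) s * tnth v j.
Proof.
rewrite /KL_on /phi_on; case: ifPn => sI; first by rewrite /KL_sum mean_onE.
by rewrite big1 ?addr0// => j _; rewrite mulr0 mul0r.
Qed.

Lemma measurable_KL_on :
  measurable_fun setT (fun z : n.-tuple R * R => KL_on z.1 z.2).
Proof.
under eq_fun do rewrite KL_onE.
apply: measurable_funD.
  apply: measurableT_comp; last exact: measurable_snd.
  apply: measurable_phi_on; exact: measurable_funS measurable_mean_on.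
apply: measurable_sum => j; apply: measurable_funM.
  apply: measurable_funM => //; apply: measurableT_comp; last exact: measurable_snd.
  by apply: measurable_phi_on; exact: mphi.
exact: (measurableT_comp (measurable_tnth j) measurable_fst).
Qed.

Lemma integrable_KL_on v : leb.-integrable I (EFin \o KL_on v).
Proof.
have mI : measurable (I : set (measurableTypeR R)) by exact: measurable_itv.
pose G s := mean_on s + \sum_(j < n) Num.sqrt (nu j) * tnth v j * phi j s.
have E : {in I, EFin \o G =1 EFin \o KL_on v}.
  move=> s; rewrite inE /= in_itv/= => sI; rewrite KL_onE /phi_on sI /G; congr (_ + _)%:E.
  by apply: eq_bigr => j _; rewrite mulrAC.
apply: (@eq_integrable _ (measurableTypeR R) R leb I mI _ _ E).
apply: integrableD_EFin => //; first exact: integrable_mean_on.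
have -> : EFin \o (fun s => \sum_(j < n) Num.sqrt (nu j) * tnth v j * phi j s) =
    (fun s => \sum_(j < n) (Num.sqrt (nu j) * tnth v j * phi j s)%:E)%E.
  by apply/funext => s /=; rewrite sumEFin.
apply: integrable_sum => // j _.
exact: (integrableZl_EFin mI (Num.sqrt (nu j) * tnth v j) (iphi (ltn_ord j))).
Qed.

End truncated.

End KL_process.

Section Rintegral_sum.
Context d (T : measurableType d) (R : realType) (mu : {measure set T -> \bar R}).
Variables (D : set T) (mD : measurable D) (J : Type) (f : J -> T -> R).
Hypothesis fI : forall j, mu.-integrable D (EFin \o f j).

Lemma integrable_sum_EFin (r : seq J) :
  mu.-integrable D (EFin \o (fun x => \sum_(j <- r) f j x)).
Proof.
elim: r => [|j r IH].
  under eq_fun do rewrite big_nil; exact: integrable0.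
by under eq_fun do rewrite big_cons; exact: integrableD_EFin.
Qed.

Lemma Rintegral_sum (r : seq J) :
  \int[mu]_(x in D) (\sum_(j <- r) f j x) = \sum_(j <- r) \int[mu]_(x in D) f j x.
Proof.
elim: r => [|j r IH].
  rewrite big_nil; under eq_Rintegral do rewrite big_nil.
  by rewrite /Rintegral integral0.
rewrite big_cons -IH; under eq_Rintegral do rewrite big_cons.
by rewrite RintegralD//; exact: integrable_sum_EFin.
Qed.

End Rintegral_sum.

Section KL_bounds.
Context {R : realType} d (Omega : measurableType d) (P : probability Omega R).
Context (t0 T : R) (t0T : t0 < T) (a : R -> Omega -> R).
Context (L : option nat) (nu : nat -> R) (phi : nat -> R -> R) (xi : nat -> Omega -> R).
Local Notation leb := (@lebesgue_measure R).
Local Notation I := (`[t0, T]%classic).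
Hypotheses (aL2 : L2_process P t0 T a) (KL : KL_expansion P t0 T a L nu phi xi).

Let mI : measurable (I : set (measurableTypeR R)).
Proof. exact: measurable_itv. Qed.

Let Ioo : (leb I < +oo)%E.
Proof. by rewrite (lebesgue_measure_I t0T) ltry. Qed.

Lemma KL_measurable_phi j : in_range L j -> measurable_fun I (phi j).
Proof. by have [_ H _] := KL; exact: H. Qed.

(** Orthonormality is stated with the real-valued integral, in which [fine] sends infinity to 0. The
    value 1 thus excludes an infinite integral. *)
Lemma KL_integral_phi_sqr j : in_range L j ->
  (\int[leb]_(s in I) (phi j s ^+ 2)%:E = 1)%E.
Proof.
move=> jL; have [_ _ [ortho _ _]] := KL.
have := ortho j j jL jL; rewrite eqxx /Rintegral.
have : (0 <= \int[leb]_(s in I) (phi j s ^+ 2)%:E)%E.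
  by apply: integral_ge0 => s _; rewrite lee_fin sqr_ge0.
rewrite (_ : (fun x => (phi j x * phi j x)%:E) = (fun x => (phi j x ^+ 2)%:E))//.
case: (integral _ _ _) => [r| |] //= _; first by move=> ->.
by move=> /esym/eqP; rewrite oner_eq0.
Qed.

Lemma KL_integrable_phi_sqr j : in_range L j ->
  leb.-integrable I (EFin \o (fun s => phi j s ^+ 2)).
Proof.
move=> jL; apply/integrableP; split.
  apply/measurable_EFinP; apply: measurable_funX; exact: KL_measurable_phi.
under eq_integral do rewrite gee0_abs ?lee_fin ?sqr_ge0//.
by rewrite KL_integral_phi_sqr// ltry.
Qed.

Lemma KL_integrable_phi j : in_range L j -> leb.-integrable I (EFin \o phi j).
Proof.
move=> jL; apply: (integrable_sqr mI Ioo); first exact: KL_measurable_phi.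
by rewrite KL_integral_phi_sqr// ltry.
Qed.

Lemma KL_integrable_phiM i j : in_range L i -> in_range L j ->
  leb.-integrable I (EFin \o (fun s => phi i s * phi j s)).
Proof.
move=> iL jL.
have H := integrableD_EFin mI (KL_integrable_phi_sqr iL) (KL_integrable_phi_sqr jL).
apply: le_integrable H => //.
  by apply/measurable_EFinP; apply: measurable_funM; exact: KL_measurable_phi.
move=> s _ /=; rewrite lee_fin [leRHS]ger0_norm ?addr_ge0 ?sqr_ge0//.
rewrite ler_norml; apply/andP; split.
  by have := sqr_ge0 (phi i s + phi j s); have := sqr_ge0 (phi i s);
    have := sqr_ge0 (phi j s); nra.
by have := sqr_ge0 (phi i s - phi j s); have := sqr_ge0 (phi i s);
  have := sqr_ge0 (phi j s); nra.
Qed.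

Section parseval.
Variables (n : nat) (c : 'I_n -> R).
Hypothesis nL : forall j, (j < n)%N -> in_range L j.

Let sqrE s : (\sum_(j < n) c j * phi j s) ^+ 2 =
  \sum_(i < n) \sum_(j < n) (c i * c j) * (phi i s * phi j s).
Proof.
rewrite expr2 big_distrlr/=; apply: eq_bigr => i _; apply: eq_bigr => j _; ring.
Qed.

Let iij (i j : 'I_n) :
  leb.-integrable I (EFin \o (fun s => (c i * c j) * (phi i s * phi j s))).
Proof.
exact: (integrableZl_EFin mI _ (KL_integrable_phiM (nL (ltn_ord i)) (nL (ltn_ord j)))).
Qed.

Let ii (i : 'I_n) : leb.-integrable I
  (EFin \o (fun s => \sum_(j < n) (c i * c j) * (phi i s * phi j s))).
Proof. exact: integrable_sum_EFin. Qed.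

Lemma KL_integrable_sum_sqr : leb.-integrable I
  (EFin \o (fun s => (\sum_(j < n) c j * phi j s) ^+ 2)).
Proof.
rewrite (_ : (fun s => _) = fun s =>
  \sum_(i < n) \sum_(j < n) (c i * c j) * (phi i s * phi j s)).
  exact: integrable_sum_EFin.
by apply/funext => s; rewrite sqrE.
Qed.

(** The coefficients are plain reals because the lemma is applied path by path, with
    [sqrt (nu j) * xi j w] for a fixed [w]. *)
Lemma KL_parseval :
  \int[leb]_(s in I) ((\sum_(j < n) c j * phi j s) ^+ 2) = \sum_(j < n) c j ^+ 2.
Proof.
have [_ _ [ortho _ _]] := KL.
under eq_Rintegral do rewrite sqrE.
rewrite Rintegral_sum//; apply: eq_bigr => i _; rewrite Rintegral_sum//.
rewrite (bigD1 i)//= big1 ?addr0.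
  rewrite RintegralZl//; last by apply: KL_integrable_phiM; exact: nL.
  rewrite ortho ?eqxx ?mulr1 ?expr2//; exact: nL.
move=> j ji; rewrite RintegralZl//; last by apply: KL_integrable_phiM; exact: nL.
rewrite ortho; [|exact: nL|exact: nL].
by rewrite (_ : (i == j :> nat) = false) ?mulr0//; apply/negbTE; rewrite eq_sym.
Qed.

End parseval.

Definition KL_error N (z : R * Omega) : R :=
  restr t0 T (fun s w => a s w - KL_sum P a nu phi (vec L xi N w) s) z.

Lemma KL_errorE N s w :
  KL_error N (s, w) = path_on t0 T a w s - KL_on P t0 T a nu phi (vec L xi N w) s.
Proof. by rewrite /KL_error /path_on /KL_on /phi_on /restr/=; case: ifPn; rewrite ?subr0. Qed.

Lemma KL_measurable_xi j : in_range L j -> measurable_fun setT (xi j).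
Proof. by have [_ _ [_ _ [H _ _]]] := KL => /H[]. Qed.

Lemma measurable_vec N : measurable_fun setT (vec L xi N).
Proof.
apply/measurable_fun_tnthP => i; rewrite (_ : _ \o _ = xi i).
  apply: KL_measurable_xi; exact: in_range_trunc_len (ltn_ord i).
by apply/funext => w /=; rewrite tnth_mktuple.
Qed.

Lemma measurable_KL_on_vec N :
  measurable_fun setT (fun z : R * Omega => KL_on P t0 T a nu phi (vec L xi N z.2) z.1).
Proof.
have mK := @measurable_KL_on R d Omega P t0 T a aL2 nu phi (trunc_len L N)
  (fun j jn => KL_measurable_phi (in_range_trunc_len jn)).
have mp : measurable_fun setT (fun z : R * Omega => (vec L xi N z.2, z.1)).
  apply: measurable_fun_pair => //.
  by apply: measurableT_comp => //; exact: measurable_vec.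
exact: (measurableT_comp mK mp).
Qed.

Lemma measurable_KL_error N : measurable_fun setT (KL_error N).
Proof.
have [ma _] := aL2.
rewrite (_ : KL_error N = fun z => restr t0 T a z -
    KL_on P t0 T a nu phi (vec L xi N z.2) z.1).
  apply: measurable_funB => //; exact: measurable_KL_on_vec.
by apply/funext => -[s w]; rewrite KL_errorE.
Qed.

Let eN N := (\int[leb \x P]_z (KL_error N z ^+ 2)%:E)%E.

Lemma KL_error_cvg0 e : 0 < e -> \forall N \near \oo, (eN N <= e%:E)%E.
Proof. by move=> e0; have [_ _ [_ _ [_ _ H]]] := KL; exact: cvge0_le H e0. Qed.

(** The truncated expansion without its mean, cut off outside [[t0, T]]. *)
Definition KL_fluct N (z : R * Omega) : R :=
  \sum_(j < trunc_len L N) Num.sqrt (nu j) * phi_on t0 T (phi j) z.1 * xi j z.2.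

Lemma KL_onE_fluct N s w : KL_on P t0 T a nu phi (vec L xi N w) s =
  phi_on t0 T (mean_on P t0 T a) s + KL_fluct N (s, w).
Proof.
by rewrite KL_onE; congr (_ + _); apply: eq_bigr => j _; rewrite tnth_mktuple.
Qed.

Lemma integral_KL_fluct_sqr N w :
  \int[leb]_(s in I) (KL_fluct N (s, w) ^+ 2) =
    \sum_(j < trunc_len L N) nu j * xi j w ^+ 2
  /\ leb.-integrable I (EFin \o (fun s => KL_fluct N (s, w) ^+ 2)).
Proof.
have nL j : (j < trunc_len L N)%N -> in_range L j by exact: in_range_trunc_len.
pose c (j : 'I_(trunc_len L N)) := Num.sqrt (nu j) * xi j w.
have E s : s \in I -> KL_fluct N (s, w) ^+ 2 = (\sum_(j < trunc_len L N) c j * phi j s) ^+ 2.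
  rewrite inE/= in_itv/= => sI; congr (_ ^+ 2); apply: eq_bigr => j _.
  by rewrite /phi_on/= sI /c mulrAC.
split.
  rewrite (eq_Rintegral leb E) KL_parseval//; apply: eq_bigr => j _.
  have [nu0 _ _] := KL.
  by rewrite /c exprMn sqr_sqrtr// ltW// nu0// nL.
have E' : {in I, EFin \o (fun s => (\sum_(j < trunc_len L N) c j * phi j s) ^+ 2) =1
    EFin \o (fun s => KL_fluct N (s, w) ^+ 2)}.
  by move=> s sI /=; rewrite E.
apply: (@eq_integrable _ (measurableTypeR R) R leb I mI _ _ E').
exact: KL_integrable_sum_sqr.
Qed.

Lemma measurable_KL_fluct N : measurable_fun setT (KL_fluct N).
Proof.
apply: measurable_sum => j; have jL := in_range_trunc_len (ltn_ord j).
apply: measurable_funM.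
  apply: measurable_funM => //; apply: measurableT_comp; last exact: measurable_fst.
  by apply: measurable_phi_on; exact: KL_measurable_phi.
by apply: measurableT_comp => //; exact: KL_measurable_xi.
Qed.

(** Parseval on each path gives the sum of [nu j * xi j w ^+ 2], and each [xi j] has second moment
    1. *)
Lemma sum_nu_eq N :
  ((\sum_(j < trunc_len L N) nu j)%:E = \int[leb \x P]_z (KL_fluct N z ^+ 2)%:E)%E.
Proof.
have [nu0 _ [_ _ [_ cov _]]] := KL.
have nL j : (j < trunc_len L N)%N -> in_range L j by exact: in_range_trunc_len.
have mF : measurable_fun setT (fun z : measurableTypeR R * Omega => (KL_fluct N z ^+ 2)%:E).
  by apply/measurable_EFinP; apply: measurable_funX; exact: measurable_KL_fluct.
have F0 (z : measurableTypeR R * Omega) : (0 <= (KL_fluct N z ^+ 2)%:E)%E.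
  by rewrite lee_fin sqr_ge0.
rewrite (fubini_tonelli2 _ mF F0) /fubini_G.
transitivity (\int[P]_w (\sum_(j < trunc_len L N) (nu j)%:E * (xi j w ^+ 2)%:E))%E; last first.
  apply: eq_integral => w _.
  have [E int] := integral_KL_fluct_sqr N w.
  transitivity (\int[leb]_(s in I) (KL_fluct N (s, w) ^+ 2)%:E)%E.
    transitivity ((\sum_(j < trunc_len L N) nu j * xi j w ^+ 2)%:E).
      by rewrite -sumEFin; apply: eq_bigr => j _; rewrite EFinM.
    by rewrite -E /Rintegral fineK//; exact: (integrable_fin_num mI int).
  rewrite [LHS]integral_mkcond; apply: eq_integral => s _; rewrite patchE mem_setE in_itv/=.
  case: ifPn => // sI; congr (_%:E); apply/esym/eqP; rewrite sqrf_eq0; apply/eqP.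
  by apply: big1 => j _; rewrite /phi_on/= (negbTE sI) mulr0 mul0r.
rewrite ge0_integral_sum//.
- rewrite -sumEFin; apply: eq_bigr => j _; rewrite ge0_integralZl_EFin//.
  + rewrite (_ : (\int[P]_w (xi j w ^+ 2)%:E = 1)%E) ?mule1//.
    by have := cov j j (nL _ (ltn_ord j)) (nL _ (ltn_ord j)); rewrite eqxx.
  + by move=> w _; rewrite lee_fin sqr_ge0.
  + by apply/measurable_EFinP; apply: measurable_funX; apply: KL_measurable_xi; exact: nL.
  + by rewrite ltW// nu0// nL.
- move=> j; apply: emeasurable_funM => //.
  by apply/measurable_EFinP; apply: measurable_funX; apply: KL_measurable_xi; exact: nL.
- by move=> j w _; rewrite mule_ge0// lee_fin ?sqr_ge0// ltW// nu0// nL.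
Qed.

(** The fluctuation is the process minus the error minus the mean, so its squared norm is at most
    three times the sum of the three squared norms. The mean is bounded by the process, and the
    error is eventually at most 1. *)
Lemma sum_nu_bounded : exists S : R, 0 <= S /\
  forall N, \sum_(j < trunc_len L N) nu j <= S.
Proof.
have [nu0 _ _] := KL; have [ma aoo] := aL2.
set A2 := (\int[leb \x P]_z (restr t0 T a z ^+ 2)%:E)%E in aoo.
have A20 : (0 <= A2)%E by apply: integral_ge0 => z _; rewrite lee_fin sqr_ge0.
have A2E : A2 = (fine A2)%:E by rewrite fineK// ge0_fin_numE.
have bound N : ((\sum_(j < trunc_len L N) nu j)%:E <= 3%:E * (eN N + A2 + A2))%E.
  rewrite sum_nu_eq.
  have mm : measurable_fun setT (fun z : R * Omega => phi_on t0 T (mean_on P t0 T a) z.1).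
    apply: measurableT_comp; last exact: measurable_fst.
    apply: measurable_phi_on; exact: measurable_funS (measurable_mean_on aL2).
  have m1 : measurable_fun setT (fun z : measurableTypeR R * Omega => (KL_error N z ^+ 2)%:E).
    by apply/measurable_EFinP; apply: measurable_funX; exact: measurable_KL_error.
  have m2 : measurable_fun setT (fun z : measurableTypeR R * Omega => (restr t0 T a z ^+ 2)%:E).
    by apply/measurable_EFinP; apply: measurable_funX.
  have m3 : measurable_fun setT (fun z : measurableTypeR R * Omega =>
      (phi_on t0 T (mean_on P t0 T a) z.1 ^+ 2)%:E).
    by apply/measurable_EFinP; apply: measurable_funX.
  have q0 (f : R * Omega -> R) (z : measurableTypeR R * Omega) : (0 <= (f z ^+ 2)%:E)%E.
    by rewrite lee_fin sqr_ge0.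
  have H3 : (\int[leb \x P]_z (phi_on t0 T (mean_on P t0 T a) z.1 ^+ 2)%:E <= A2)%E.
    rewrite (fubini_tonelli1 _ m3); last by move=> z; rewrite lee_fin sqr_ge0.
    apply: le_trans (integral_sqr_mean_on_le aL2); apply: ge0_le_integral => //.
    - by move=> s _; apply: integral_ge0 => w _; rewrite lee_fin sqr_ge0.
    - by apply: (measurable_fun_fubini_tonelli_F _ m3) => z; rewrite lee_fin sqr_ge0.
    - by apply/measurable_EFinP; apply: measurable_funX; exact: measurable_mean_on.
    - move=> s _; rewrite /fubini_F/= integral_probability_cst lee_fin.
      by rewrite /phi_on; case: ifPn => // _; rewrite expr0n/= sqr_ge0.
  apply: (@le_trans _ _ (3%:E * (eN N + A2 +
    \int[leb \x P]_z (phi_on t0 T (mean_on P t0 T a) z.1 ^+ 2)%:E))%E); last first.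
    by rewrite lee_wpmul2l// leeD2l.
  have m12 : measurable_fun setT (fun z : measurableTypeR R * Omega =>
    (KL_error N z ^+ 2)%:E + (restr t0 T a z ^+ 2)%:E)%E by exact: emeasurable_funD.
  have m123 : measurable_fun setT (fun z : measurableTypeR R * Omega =>
      (KL_error N z ^+ 2)%:E + (restr t0 T a z ^+ 2)%:E +
      (phi_on t0 T (mean_on P t0 T a) z.1 ^+ 2)%:E)%E by exact: emeasurable_funD.
  apply: (@le_trans _ _ (\int[leb \x P]_z (3%:E * ((KL_error N z ^+ 2)%:E +
      (restr t0 T a z ^+ 2)%:E + (phi_on t0 T (mean_on P t0 T a) z.1 ^+ 2)%:E)))%E); last first.
    rewrite ge0_integralZl_EFin//; last by move=> z _; rewrite !adde_ge0// lee_fin sqr_ge0.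
    rewrite ge0_integralD//; last 2 first.
    - by move=> z _; rewrite adde_ge0.
    - by move=> z _; rewrite lee_fin sqr_ge0.
    by rewrite ge0_integralD.
  apply: ge0_le_integral => //.
  - by apply/measurable_EFinP; apply: measurable_funX; exact: measurable_KL_fluct.
  - exact: emeasurable_funM.
  move=> [s w] _; rewrite -!EFinD -EFinM lee_fin /=.
  have -> : KL_fluct N (s, w) = path_on t0 T a w s - KL_error N (s, w) -
      phi_on t0 T (mean_on P t0 T a) s.
    by rewrite KL_errorE KL_onE_fluct; ring.
  rewrite /path_on; set x := restr _ _ _ _; set y := KL_error _ _; set u := phi_on _ _ _ _.
  have := sqr_ge0 (x + y); have := sqr_ge0 (x + u); have := sqr_ge0 (y - u).
  by nra.
exists (3 * (1 + fine A2 + fine A2)); split.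
  by rewrite mulr_ge0// !addr_ge0// fine_ge0.
move=> N; have [N0 _ HN0] := KL_error_cvg0 ltr01.
(* Partial sums increase with the length, so a small [N] is replaced by an index at which the error
   is already at most 1. *)
set M := maxn N N0.
apply: (@le_trans _ _ (\sum_(j < trunc_len L M) nu j)).
  have NM : (trunc_len L N <= trunc_len L M)%N by apply: trunc_len_homo; exact: leq_maxl.
  rewrite -!(big_mkord xpredT nu) (big_cat_nat (leq0n _) NM)//= lerDl big_nat_cond sumr_ge0//.
  move=> j /andP[/andP[_ jM] _]; rewrite ltW// nu0//; exact: in_range_trunc_len jM.
rewrite -lee_fin; apply: (le_trans (bound M)).
rewrite EFinM lee_wpmul2l// !EFinD -A2E !leeD2r//.
by apply: HN0; exact: leq_maxr.
Qed.

Definition KL_dist N (w : Omega) : R :=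
  \int[leb]_(s in I) `|KL_on P t0 T a nu phi (vec L xi N w) s - path_on t0 T a w s|.

Lemma KL_distE N w : KL_dist N w = \int[leb]_(s in I) `|KL_error N (s, w)|.
Proof. by apply: eq_Rintegral => s _; rewrite KL_errorE distrC. Qed.

Lemma KL_dist_ge0 N w : 0 <= KL_dist N w.
Proof. exact: Rintegral_ge0. Qed.

Lemma measurable_KL_dist N : measurable_fun setT (KL_dist N).
Proof.
rewrite (_ : KL_dist N = fun w => \int[leb]_(s in I) `|KL_error N (s, w)|); last first.
  by apply/funext => w; rewrite KL_distE.
apply: (@measurable_integral_itv _ _ _ (fun z : Omega * R => `|KL_error N (z.2, z.1)|)) => //.
apply: measurableT_comp => //; apply: measurableT_comp; first exact: measurable_KL_error.
exact: measurable_fun_pair.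
Qed.

Lemma KL_dist_cvg0 e : 0 < e ->
  \forall N \near \oo, (\int[P]_w (KL_dist N w ^+ 2)%:E <= e%:E)%E.
Proof.
move=> e0; have TT : 0 < T - t0 by rewrite subr_gt0.
have e1 : 0 < e / (T - t0) by rewrite divr_gt0.
apply: filterS (KL_error_cvg0 e1) => N HN.
under eq_integral do rewrite KL_distE.
apply: (le_trans (integral_sqr_Rintegral_le P t0T (measurable_KL_error N))).
apply: (@le_trans _ _ ((T - t0)%:E * (e / (T - t0))%:E)%E).
  by rewrite lee_wpmul2l// lee_fin ltW.
by rewrite -EFinM lee_fin mulrCA divff ?mulr1// gt_eqF.
Qed.

Lemma integrable_KL_on_vec N w :
  leb.-integrable I (EFin \o KL_on P t0 T a nu phi (vec L xi N w)).
Proof.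
apply: integrable_KL_on => // j jN; apply: KL_integrable_phi.
exact: in_range_trunc_len jN.
Qed.

(** For a truncation, Parseval bounds the squared norm of the fluctuation on almost every path by
    [A ^+ 2] times the sum of the [nu j], uniformly in [N]. The process inherits the same [C],
    because its mass exceeds that of a truncation by at most [KL_dist], which tends to 0 in mean
    square. *)
Lemma KL_drift_bound (A : R) :
  (forall j, in_range L j -> P [set w | - A <= xi j w <= A] = 1%E) ->
  exists C : R,
    (forall N, {ae P, forall w,
       \int[leb]_(s in I) `|KL_on P t0 T a nu phi (vec L xi N w) s| <= C}) /\
    {ae P, forall w, \int[leb]_(s in I) `|path_on t0 T a w s| <= C}.
Proof.
move=> xiA; have [nu0 _ _] := KL; have [_ aoo] := aL2.
have [S [S0 SN]] := sum_nu_bounded.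
set mo := mean_on P t0 T a.
have mmo : measurable_fun setT mo by exact: measurable_mean_on.
have imo2 : leb.-integrable I (EFin \o (fun s => mo s ^+ 2)).
  apply/integrableP; split.
    apply/measurable_EFinP; apply: measurable_funX; exact: measurable_funS mmo.
  under eq_integral do rewrite gee0_abs ?lee_fin ?sqr_ge0//.
  apply: le_lt_trans (le_lt_trans (integral_sqr_mean_on_le aL2) aoo).
  apply: ge0_subset_integral => //.
    by apply/measurable_EFinP; apply: measurable_funX.
  by move=> s _; rewrite lee_fin sqr_ge0.
(* The integral over [[t0, T]] of [|m + f| <= 1/2 + m^2 + f^2], for [m] the mean and [f] the
   fluctuation. This trades a time-[L1] norm for squares without a square root. *)
pose C := 2^-1 * (T - t0) + \int[leb]_(s in I) (mo s ^+ 2) + A ^+ 2 * S.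
have xiae : {ae P, forall w, forall j, in_range L j -> - A <= xi j w <= A}.
  apply: ae_foralln => j; have [jL|jL] := boolP (in_range L j); last exact: aeW.
  have mj : measurable [set w | - A <= xi j w <= A].
    have -> : [set w | - A <= xi j w <= A] = xi j @^-1` `[- A, A]%classic.
      by apply/seteqP; split => w /=; rewrite in_itv.
    by rewrite -[X in measurable X]setTI; apply: (KL_measurable_xi jL).
  exists (~` [set w | - A <= xi j w <= A]); split.
  - exact: measurableC.
  - by have := probability_setC P mj; rewrite xiA// subee.
  - by move=> w /= H1 H2; apply: H1.
have bN N : {ae P, forall w,
    \int[leb]_(s in I) `|KL_on P t0 T a nu phi (vec L xi N w) s| <= C}.
  apply: filterS xiae => w xiw.
  have [E int] := integral_KL_fluct_sqr N w.
  have ic : leb.-integrable I (EFin \o (fun=> 2^-1)) by exact: integrable_cst_lty.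
  have i12 := integrableD_EFin mI ic imo2.
  have i123 := integrableD_EFin mI i12 int.
  apply: (@le_trans _ _ (\int[leb]_(s in I) (2^-1 + mo s ^+ 2 + KL_fluct N (s, w) ^+ 2))).
    apply: le_Rintegral => //; first exact: integrable_norm (integrable_KL_on_vec N w).
    move=> s; rewrite /= in_itv/= => sI; rewrite KL_onE_fluct /phi_on sI -/mo.
    set x := mo s; set y := KL_fluct _ _.
    rewrite ler_norml; apply/andP; split.
      by have := sqr_ge0 (x + 2^-1); have := sqr_ge0 (y + 2^-1); nra.
    by have := sqr_ge0 (x - 2^-1); have := sqr_ge0 (y - 2^-1); nra.
  rewrite RintegralD// RintegralD// E /C Rintegral_cst//.
  have -> : fine (leb I) = T - t0 by rewrite (lebesgue_measure_I t0T).
  rewrite lerD2l; apply: (@le_trans _ _ (A ^+ 2 * \sum_(j < trunc_len L N) nu j)); last first.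
    by rewrite ler_wpM2l// sqr_ge0.
  rewrite mulr_sumr; apply: ler_sum => j _.
  have jL := in_range_trunc_len (ltn_ord j).
  rewrite mulrC ler_wpM2r//; first by rewrite ltW// nu0.
  have /andP[x1 x2] := xiw j jL.
  by rewrite -(real_normK (num_real (xi j w))) -(real_normK (num_real A)) ler_sqr ?nnegrE//;
    apply: (@le_trans _ _ A); [rewrite ler_norml x1 x2|exact: ler_norm].
exists C; split => //.
(* The excess of the path over [C]. It is almost surely at most [KL_dist N] for every [N], so its
   second moment is 0. *)
pose p w := Num.max 0 (\int[leb]_(s in I) `|path_on t0 T a w s| - C).
have mpath : measurable_fun setT (fun w => \int[leb]_(s in I) `|path_on t0 T a w s|).
  apply: (@measurable_integral_itv _ _ _ (fun z : Omega * R => `|path_on t0 T a z.1 z.2|)) => //.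
  have [ma _] := aL2; apply: measurableT_comp => //.
  apply: (measurableT_comp ma); exact: measurable_fun_pair.
have mp : measurable_fun setT p.
  by apply: measurable_maxr => //; exact: measurable_funB.
have p0 w : 0 <= p w by rewrite /p le_max lexx.
have pN N : (\int[P]_w (p w ^+ 2)%:E <= \int[P]_w (KL_dist N w ^+ 2)%:E)%E.
  apply: ae_ge0_le_integral => //.
  - by move=> w _; rewrite lee_fin sqr_ge0.
  - by apply/measurable_EFinP; exact: measurable_funX.
  - by move=> w _; rewrite lee_fin sqr_ge0.
  - by apply/measurable_EFinP; apply: measurable_funX; exact: measurable_KL_dist.
  apply: filterS2 (bN N) (ae_integrable_path_on t0T aL2) => w bw iw _.
  rewrite lee_fin ler_sqr ?nnegrE ?KL_dist_ge0//.
  rewrite /p ge_max KL_dist_ge0/= lerBlDr.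
  have iK := integrable_KL_on_vec N w.
  have iD := integrable_norm (integrableB_EFin mI iK iw).
  have inK := integrable_norm iK.
  have inD := integrableD_EFin mI iD inK.
  apply: (@le_trans _ _ (KL_dist N w +
      \int[leb]_(s in I) `|KL_on P t0 T a nu phi (vec L xi N w) s|)); last by rewrite lerD2l.
  rewrite /KL_dist -RintegralD//; apply: le_Rintegral => //.
    exact: integrable_norm.
  move=> s _; rewrite distrC -[leLHS]/(`|path_on t0 T a w s|).
  by apply: le_trans (ler_normD _ _); rewrite subrK.
have pz : (\int[P]_w (p w ^+ 2)%:E = 0)%E.
  apply/eqP; rewrite eq_le; apply/andP; split; last first.
    by apply: integral_ge0 => w _; rewrite lee_fin sqr_ge0.
  apply/lee_addgt0Pr => e e0; rewrite add0e.
  have [N0 _ HN] := KL_dist_cvg0 e0.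
  by apply: (le_trans (pN N0)); apply: HN => /=.
have pz' : (\int[P]_w `|(p w ^+ 2)%:E| = 0)%E.
  by under eq_integral do rewrite gee0_abs ?lee_fin ?sqr_ge0//.
have mp2 : measurable_fun setT (fun w => (p w ^+ 2)%:E).
  by apply/measurable_EFinP; exact: measurable_funX.
have := (ae_eq_integral_abs P measurableT mp2).1 pz'.
apply: filterS => w /(_ Logic.I) [] /eqP; rewrite sqrf_eq0 => /eqP pw.
by rewrite -subr_le0 -pw /p le_max lexx orbT.
Qed.

End KL_bounds.

(** A weighted arithmetic-geometric inequality stands in for Cauchy-Schwarz: the integrand is at
    most [de * W^2 + ka * (al^2 + be^2)]. First [de] is chosen to make the first mean at most
    [e / 2]. This fixes [ka], and a large [n] then makes the second at most [e / 2]. *)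
Lemma product_sqr_cvg0 d (Omega : measurableType d) (R : realType)
    (P : probability Omega R) (W : Omega -> R) (al be : nat -> Omega -> R) (c : R) :
  measurable_fun setT W -> (forall n, measurable_fun setT (al n)) ->
  (forall n, measurable_fun setT (be n)) ->
  0 <= c -> (forall w, 0 <= W w) -> (forall n w, 0 <= al n w) ->
  (forall n w, 0 <= be n w) ->
  (\int[P]_w (W w ^+ 2)%:E < +oo)%E ->
  (forall e, 0 < e -> \forall n \near \oo, (\int[P]_w (al n w ^+ 2)%:E <= e%:E)%E) ->
  (forall e, 0 < e -> \forall n \near \oo, (\int[P]_w (be n w ^+ 2)%:E <= e%:E)%E) ->
  forall e, 0 < e ->
    \forall n \near \oo, (\int[P]_w (c * W w * (al n w + be n w))%:E <= e%:E)%E.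
Proof.
move=> mW mal mbe c0 W0 al0 be0 Woo al_cvg be_cvg e e0.
have Wge0 : (0 <= \int[P]_w (W w ^+ 2)%:E)%E.
  by apply: integral_ge0 => w _; rewrite lee_fin sqr_ge0.
have WE : (\int[P]_w (W w ^+ 2)%:E = (fine (\int[P]_w (W w ^+ 2)%:E))%:E)%E.
  by rewrite fineK// ge0_fin_numE.
set w2 := fine _ in WE.
have w20 : 0 <= w2 by rewrite fine_ge0.
pose de : R := e / (2 * (w2 + 1)).
have de0 : 0 < de by rewrite divr_gt0//; lra.
pose ka : R := c ^+ 2 / (2 * de).
have ka0 : 0 <= ka by rewrite divr_ge0 ?sqr_ge0//; lra.
pose e' : R := e / (4 * (ka + 1)).
have e'0 : 0 < e' by rewrite divr_gt0//; lra.
apply: filterS2 (al_cvg e' e'0) (be_cvg e' e'0) => n Ha Hb.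
have mW2 : measurable_fun setT (fun w => (W w ^+ 2)%:E).
  by apply/measurable_EFinP; exact: measurable_funX.
have ma2 : measurable_fun setT (fun w => (al n w ^+ 2)%:E).
  by apply/measurable_EFinP; exact: measurable_funX.
have mb2 : measurable_fun setT (fun w => (be n w ^+ 2)%:E).
  by apply/measurable_EFinP; exact: measurable_funX.
have q0 (f : Omega -> R) w : setT w -> (0 <= (f w ^+ 2)%:E)%E by rewrite lee_fin sqr_ge0.
have mab : measurable_fun setT (fun w => (al n w ^+ 2)%:E + (be n w ^+ 2)%:E)%E.
  exact: emeasurable_funD.
apply: (@le_trans _ _ (\int[P]_w (de%:E * (W w ^+ 2)%:E +
    ka%:E * ((al n w ^+ 2)%:E + (be n w ^+ 2)%:E)))%E).
  apply: ge0_le_integral => //.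
  - by move=> w _; rewrite lee_fin !mulr_ge0// addr_ge0.
  - apply/measurable_EFinP; apply: measurable_funM; last exact: measurable_funD.
    exact: measurable_funM.
  - by apply: emeasurable_funD; exact: emeasurable_funM.
  move=> w _.
  rewrite -[leRHS]/((de * W w ^+ 2 + ka * (al n w ^+ 2 + be n w ^+ 2))%:E) lee_fin.
  have hk : ka * (2 * de) = c ^+ 2 by rewrite /ka divfK// gt_eqF//; lra.
  set x := W w; set y := al n w; set z := be n w.
  (* AM-GM: [2 de] times the difference is [(2 de x - c (y+z))^2 / 2 + c^2 (y-z)^2 / 2] *)
  have H : 0 <= (2 * de) * (de * x ^+ 2 + ka * (y ^+ 2 + z ^+ 2) - c * x * (y + z)).
    have -> : (2 * de) * (de * x ^+ 2 + ka * (y ^+ 2 + z ^+ 2) - c * x * (y + z)) =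
      2 * de ^+ 2 * x ^+ 2 + (ka * (2 * de)) * (y ^+ 2 + z ^+ 2) - 2 * de * c * x * (y + z) by ring.
    rewrite hk.
    have -> : 2 * de ^+ 2 * x ^+ 2 + c ^+ 2 * (y ^+ 2 + z ^+ 2) - 2 * de * c * x * (y + z) =
      ((2 * de * x - c * (y + z)) ^+ 2 + c ^+ 2 * (y - z) ^+ 2) / 2 by field.
    by rewrite divr_ge0// addr_ge0 ?sqr_ge0// mulr_ge0 ?sqr_ge0.
  by rewrite -subr_ge0; rewrite pmulr_rge0 in H => //; lra.
rewrite ge0_integralD//; last 4 first.
- by move=> w _; rewrite mule_ge0 ?lee_fin ?sqr_ge0// ltW.
- exact: emeasurable_funM.
- by move=> w _; apply: mule_ge0; [rewrite lee_fin|apply: adde_ge0; rewrite lee_fin sqr_ge0].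
- exact: emeasurable_funM.
rewrite ge0_integralZl_EFin//; [|exact: (q0 W)|exact: ltW].
rewrite ge0_integralZl_EFin//; last by move=> w _; apply: adde_ge0; rewrite lee_fin sqr_ge0.
rewrite ge0_integralD//; [|exact: (q0 (al n))|exact: (q0 (be n))].
rewrite WE.
apply: (@le_trans _ _ (de%:E * w2%:E + ka%:E * (e'%:E + e'%:E))%E).
  by apply: leeD2l; apply: lee_wpmul2l; [rewrite lee_fin|exact: leeD].
rewrite -[leLHS]/((de * w2 + ka * (e' + e'))%:E) lee_fin.
have h1 : de * w2 <= e / 2.
  rewrite /de mulrAC ler_pdivrMr; last lra.
  by rewrite (_ : e / 2 * (2 * (w2 + 1)) = e * (w2 + 1)); [nra|field].
have h2 : ka * (e' + e') <= e / 2.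
  rewrite /e' (_ : ka * _ = (ka * e) / (2 * (ka + 1))); last by field; rewrite gt_eqF//; lra.
  rewrite ler_pdivrMr; last lra.
  by rewrite (_ : e / 2 * (2 * (ka + 1)) = e * (ka + 1)); [nra|field].
lra.
Qed.

(** * Weighted path integrals and the solution formula *)

Section weighted_paths.
Context {R : realType} (t0 T t : R).
Hypotheses (t0T : t0 < T) (t0t : t0 < t) (tT : t <= T).
Local Notation leb := (@lebesgue_measure R).
Local Notation I := (`[t0, T]%classic).

Definition wint (be al : R -> R) : R :=
  \int[leb]_(s in `[t0, t]%classic) (be s * expR (- primitive t0 al s)).

Lemma measurable_wint d (X : measurableType d) (be al : X * R -> R) :
  measurable_fun setT be -> measurable_fun setT al ->
  measurable_fun setT (fun x => wint (fun s => be (x, s)) (fun s => al (x, s))).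
Proof.
move=> mbe mal.
apply: (@measurable_integral_itv _ _ _ (fun z : X * R =>
  be z * expR (- primitive t0 (fun s => al (z.1, s)) z.2))) => //.
apply: measurable_funM => //; apply: measurableT_comp => //; apply: measurable_funN.
apply: (@measurable_integral_itv _ (X * R)%type _ (fun y : (X * R) * R => al (y.1.1, y.2))
  (cst t0) snd) => //.
apply: measurableT_comp => //; apply: measurable_fun_pair => //.
by apply: measurableT_comp.
Qed.

Lemma wint_linear c (be1 be2 al : R -> R) : leb.-integrable I (EFin \o be1) ->
  leb.-integrable I (EFin \o be2) -> measurable_fun setT al ->
  leb.-integrable I (EFin \o al) ->
  wint (fun s => c * be1 s + be2 s) al = c * wint be1 al + wint be2 al.
Proof.
move=> i1 i2 mal ial.
have kC s : t0 <= s <= T -> `|primitive t0 al s| <= \int[leb]_(r in I) `|al r|.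
  by move=> /andP[_ sT]; exact: primitive_le.
have mk := @measurable_primitive _ t0 _ mal.
have w1 := integrable_sub_itv tT (integrable_weight i1 mk kC).
have w2 := integrable_sub_itv tT (integrable_weight i2 mk kC).
rewrite /wint -RintegralZl// -RintegralD//; last exact: integrableZl_EFin.
by apply: eq_Rintegral => s _; ring.
Qed.

Lemma eq_wint (be be' al : R -> R) : (forall s, t0 <= s <= t -> be s = be' s) ->
  wint be al = wint be' al.
Proof. by move=> E; apply: eq_Rintegral => s; rewrite inE/= in_itv/= => /E ->. Qed.

Lemma wint_gt0 (be al : R -> R) : leb.-integrable I (EFin \o be) ->
  (forall s, t0 < s < T -> 0 < be s) -> measurable_fun setT al ->
  leb.-integrable I (EFin \o al) -> 0 < wint be al.
Proof.
move=> ib b0 mal ial.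
have H := weighted_integral_ge tT ib b0 mal ial (lexx _).
apply: lt_le_trans H.
by rewrite mulr_gt0 ?expR_gt0// (Rintegral_gt0 tT t0t ib).
Qed.

End weighted_paths.

Section solution_path.
Context {R : realType} d (Omega : measurableType d) (t0 T t : R).
Hypotheses (t0T : t0 < T) (t0t : t0 < t) (tT : t <= T).
Local Notation leb := (@lebesgue_measure R).
Local Notation I := (`[t0, T]%classic).
Variables (x0 : Omega -> R) (a b : R -> Omega -> R).

Let inI s : t0 <= s <= t -> t0 <= s <= T.
Proof. by move=> /andP[-> /le_trans]; apply. Qed.

Let restrE (q : R -> Omega -> R) s w : t0 <= s <= t -> q s w = path_on t0 T q w s.
Proof. by move=> /inI sI; rewrite /path_on /restr/= sI. Qed.

(** The solution at [t] sees the processes only at times in [[t0, t]], where they agree with their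
    extensions by 0, and these are jointly measurable. *)
Lemma measurable_sol : measurable_fun setT x0 ->
  measurable_fun setT (restr t0 T a) -> measurable_fun setT (restr t0 T b) ->
  measurable_fun setT (sol t0 x0 a b t).
Proof.
move=> mx0 ma mb.
have msw (q : R * Omega -> R) : measurable_fun setT q ->
    measurable_fun setT (fun z : Omega * R => q (z.2, z.1)).
  by move=> mq; apply: (measurableT_comp mq); exact: measurable_fun_pair.
rewrite (_ : sol t0 x0 a b t = fun w =>
  x0 w * expR (\int[leb]_(s in `[t0, t]%classic) restr t0 T a (s, w)) +
  \int[leb]_(s in `[t0, t]%classic) (restr t0 T b (s, w) *
    expR (\int[leb]_(r in `[s, t]%classic) restr t0 T a (r, w)))).
  apply: measurable_funD.
    apply: measurable_funM => //; apply: measurableT_comp => //.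
    apply: (@measurable_integral_itv _ _ _ (fun z : Omega * R => restr t0 T a (z.2, z.1))) => //.
    exact: msw.
  apply: (@measurable_integral_itv _ _ _ (fun z : Omega * R => restr t0 T b (z.2, z.1) *
    expR (\int[leb]_(r in `[z.2, t]%classic) restr t0 T a (r, z.1)))) => //.
  apply: measurable_funM; first exact: msw.
  apply: measurableT_comp => //.
  apply: (@measurable_integral_itv _ (Omega * R)%type _ (fun y : (Omega * R) * R =>
    restr t0 T a (y.2, y.1.1)) snd (cst t)) => //.
  apply: (measurableT_comp ma); apply: measurable_fun_pair => //.
  by apply: measurableT_comp.
apply/funext => w; rewrite /sol.
have E1 : \int[leb]_(s in `[t0, t]%classic) a s w =
    \int[leb]_(s in `[t0, t]%classic) restr t0 T a (s, w).
  by apply: eq_Rintegral => s; rewrite inE/= in_itv/= => /restrE ->.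
have E2 : \int[leb]_(s in `[t0, t]%classic)
      (b s w * expR (\int[leb]_(r in `[s, t]%classic) a r w)) =
    \int[leb]_(s in `[t0, t]%classic) (restr t0 T b (s, w) *
      expR (\int[leb]_(r in `[s, t]%classic) restr t0 T a (r, w))).
  apply: eq_Rintegral => s; rewrite inE/= in_itv/= => sI; rewrite restrE//.
  have -> // : \int[leb]_(r in `[s, t]%classic) a r w =
    \int[leb]_(r in `[s, t]%classic) restr t0 T a (r, w).
  apply: eq_Rintegral => r; rewrite inE/= in_itv/= => /andP[sr rt]; apply: restrE.
  by have /andP[s0 _] := sI; rewrite (le_trans s0).
by rewrite E1 E2.
Qed.

(** The integral of the drift over [[s, t]] is a difference of primitives, which brings out the
    common factor. The splitting of the source holds for every real [y], since [y * psi0] is added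
    in one integral and subtracted in the other. *)
Lemma solE w (psi0 : R -> R) (y : R) : measurable_fun setT (path_on t0 T a w) ->
  leb.-integrable I (EFin \o path_on t0 T a w) ->
  leb.-integrable I (EFin \o path_on t0 T b w) ->
  leb.-integrable I (EFin \o psi0) ->
  sol t0 x0 a b t w = expR (primitive t0 (path_on t0 T a w) t) *
    (x0 w + y * wint t0 t psi0 (path_on t0 T a w) +
     wint t0 t (fun s => path_on t0 T b w s - y * psi0 s) (path_on t0 T a w)).
Proof.
move=> mp ia ib ipsi; set al := path_on t0 T a w.
have iB : leb.-integrable I (EFin \o (fun s => path_on t0 T b w s - y * psi0 s)).
  by apply: integrableB_EFin => //; exact: integrableZl_EFin.
have kC s : t0 <= s <= T -> `|primitive t0 al s| <= \int[leb]_(r in I) `|al r|.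
  by move=> /andP[_ sT]; exact: primitive_le.
have wI := integrable_sub_itv tT (integrable_weight ib (@measurable_primitive _ t0 _ mp) kC).
rewrite -addrA -(wint_linear tT y ipsi iB mp ia).
rewrite (@eq_wint _ _ _ _ (path_on t0 T b w)); last by move=> s _; ring.
have E1 : \int[leb]_(s in `[t0, t]%classic) a s w = primitive t0 al t.
  by apply: eq_Rintegral => s; rewrite inE/= in_itv/= => /restrE ->.
rewrite mulrDr (mulrC _ (x0 w)) /sol E1.
suff -> : \int[leb]_(s in `[t0, t]%classic)
      (b s w * expR (\int[leb]_(r in `[s, t]%classic) a r w)) =
    expR (primitive t0 al t) * wint t0 t (path_on t0 T b w) al by [].
rewrite /wint -RintegralZl//; apply: eq_Rintegral => s; rewrite inE/= in_itv/= => sI.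
rewrite restrE// mulrCA -expRD.
suff -> : \int[leb]_(r in `[s, t]%classic) a r w =
  primitive t0 al t - primitive t0 al s by [].
have /andP[s0 st] := sI.
have iat := integrable_sub_itv tT ia.
have E : \int[leb]_(r in `[s, t]%classic) a r w = \int[leb]_(r in `[s, t]%classic) al r.
  apply: eq_Rintegral => r; rewrite inE/= in_itv/= => /andP[sr rt]; apply: restrE.
  by rewrite (le_trans s0 sr).
have ist : leb.-integrable `]s, t]%classic (EFin \o al).
  by apply: integrableS iat => // r; rewrite /= !in_itv/= => /andP[/ltW sr ->];
    rewrite (le_trans s0 sr).
rewrite E -Rintegral_itv_obnd_cbnd// /primitive -(@Rintegral_itvB _ al (BLeft t0))//.
Qed.

End solution_path.

(** * Isolating the leading coefficient in a truncated source *)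

Section truncation.
Context {R : realType} d (Omega : measurableType d) (P : probability Omega R).
Context (t0 T t : R) (a b : R -> Omega -> R) (La Lb : option nat).
Context (nu gam : nat -> R) (phi psi : nat -> R -> R) (xi eta : nat -> Omega -> R).
Local Notation leb := (@lebesgue_measure R).
Local Notation I := (`[t0, T]%classic).
Hypotheses (t0T : t0 < T) (t0t : t0 < t) (tT : t <= T).
Hypotheses (aL2 : L2_process P t0 T a) (bL2 : L2_process P t0 T b).
Hypotheses (KLa : KL_expansion P t0 T a La nu phi xi).
Hypotheses (KLb : KL_expansion P t0 T b Lb gam psi eta) (Lb0 : in_range Lb 0).
Hypothesis psi_gt0 : forall s : R, t0 < s < T -> 0 < psi 0%N s.

Definition lead_mode (s : R) : R := Num.sqrt (gam 0%N) * phi_on t0 T (psi 0%N) s.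

Definition trunc_rest (N : nat) : Type :=
  ((trunc_len La N).-tuple R * (trunc_len Lb N).-1.-tuple R)%type.

Definition trunc_drift N (u : (trunc_len La N).-tuple R) : R -> R :=
  KL_on P t0 T a nu phi u.

(** Shifting both families by [S] drops the first mode, while the mean of [b] remains included. *)
Definition trunc_source N (v : (trunc_len Lb N).-1.-tuple R) : R -> R :=
  KL_on P t0 T b (gam \o S) (psi \o S) v.

Definition trunc_K N (z : trunc_rest N) : R := primitive t0 (trunc_drift z.1) t.
Definition trunc_D N (z : trunc_rest N) : R := wint t0 t lead_mode (trunc_drift z.1).
Definition trunc_E N (z : trunc_rest N) : R :=
  wint t0 t (trunc_source z.2) (trunc_drift z.1).

Definition rest_vec N (w : Omega) : trunc_rest N := (vec La xi N w, vec_tail Lb eta N w).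

Lemma trunc_len_gt0 N : (1 <= N)%N -> (0 < trunc_len Lb N)%N.
Proof. by move: Lb0; case: Lb => //= m m0 N1; rewrite leq_min N1. Qed.

Lemma in_range_tail N j : (j < (trunc_len Lb N).-1)%N -> in_range Lb j.+1.
Proof.
by move=> jN; apply: (@in_range_trunc_len _ N); move: jN; case: (trunc_len Lb N).
Qed.

Lemma sqrt_gam0_gt0 : 0 < Num.sqrt (gam 0%N).
Proof. by have [g0 _ _] := KLb; rewrite sqrtr_gt0 g0. Qed.

Lemma measurable_lead_mode : measurable_fun setT lead_mode.
Proof.
apply: measurable_funM => //; apply: measurable_phi_on.
exact: (KL_measurable_phi KLb).
Qed.

Lemma integrable_lead_mode : leb.-integrable I (EFin \o lead_mode).
Proof.
have mI : measurable (I : set (measurableTypeR R)) by exact: measurable_itv.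
apply: integrableZl_EFin => //.
have E : {in I, EFin \o psi 0%N =1 EFin \o phi_on t0 T (psi 0%N)}.
  by move=> s; rewrite inE/= in_itv/= /phi_on => ->.
apply: (@eq_integrable _ (measurableTypeR R) R leb I mI _ _ E).
exact: (KL_integrable_phi t0T KLb).
Qed.

Lemma lead_mode_gt0 s : t0 < s < T -> 0 < lead_mode s.
Proof.
move=> sT; have /andP[s0 s1] := sT.
by rewrite /lead_mode /phi_on !ltW// mulr_gt0 ?sqrt_gam0_gt0// psi_gt0.
Qed.

Lemma measurable_trunc_drift N :
  measurable_fun setT (fun z : trunc_rest N * R => trunc_drift z.1.1 z.2).
Proof.
have mK := @measurable_KL_on R d Omega P t0 T a aL2 nu phi (trunc_len La N)
  (fun j jn => KL_measurable_phi KLa (in_range_trunc_len jn)).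
have mp : measurable_fun setT (fun z : trunc_rest N * R => (z.1.1, z.2)).
  by apply: measurable_fun_pair => //; exact: measurableT_comp.
exact: (measurableT_comp mK mp).
Qed.

Lemma measurable_trunc_source N :
  measurable_fun setT (fun z : trunc_rest N * R => trunc_source z.1.2 z.2).
Proof.
have mK := @measurable_KL_on R d Omega P t0 T b bL2 (gam \o S) (psi \o S) (trunc_len Lb N).-1
  (fun j jn => KL_measurable_phi KLb (in_range_tail jn)).
have mp : measurable_fun setT (fun z : trunc_rest N * R => (z.1.2, z.2)).
  by apply: measurable_fun_pair => //; exact: measurableT_comp.
exact: (measurableT_comp mK mp).
Qed.

Lemma measurable_trunc_drift1 N (u : (trunc_len La N).-tuple R) :
  measurable_fun setT (trunc_drift u).
Proof.
have mK := @measurable_KL_on R d Omega P t0 T a aL2 nu phi (trunc_len La N)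
  (fun j jn => KL_measurable_phi KLa (in_range_trunc_len jn)).
have mp : measurable_fun setT (fun s : R => (u, s)) by exact: measurable_fun_pair.
exact: (measurableT_comp mK mp).
Qed.

Lemma integrable_trunc_drift N (u : (trunc_len La N).-tuple R) :
  leb.-integrable I (EFin \o trunc_drift u).
Proof.
apply: integrable_KL_on => // j jN; apply: (KL_integrable_phi t0T KLa).
exact: in_range_trunc_len jN.
Qed.

Lemma integrable_trunc_source N (v : (trunc_len Lb N).-1.-tuple R) :
  leb.-integrable I (EFin \o trunc_source v).
Proof.
apply: integrable_KL_on => // j jN; apply: (KL_integrable_phi t0T KLb).
exact: in_range_tail jN.
Qed.

Lemma measurable_trunc_K N : measurable_fun setT (@trunc_K N).
Proof.
apply: (@measurable_integral_itv _ (trunc_rest N) _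
  (fun z : trunc_rest N * R => trunc_drift z.1.1 z.2)) => //.
exact: measurable_trunc_drift.
Qed.

Lemma measurable_trunc_D N : measurable_fun setT (@trunc_D N).
Proof.
apply: (@measurable_wint _ t0 t _ (trunc_rest N) (fun z => lead_mode z.2)
  (fun z => trunc_drift z.1.1 z.2)).
- by apply: measurableT_comp; [exact: measurable_lead_mode|].
- exact: measurable_trunc_drift.
Qed.

Lemma measurable_trunc_E N : measurable_fun setT (@trunc_E N).
Proof.
apply: (@measurable_wint _ t0 t _ (trunc_rest N) (fun z => trunc_source z.1.2 z.2)
  (fun z => trunc_drift z.1.1 z.2)).
- exact: measurable_trunc_source.
- exact: measurable_trunc_drift.
Qed.

Lemma trunc_D_gt0 N (z : trunc_rest N) : 0 < trunc_D z.
Proof.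
exact: (wint_gt0 t0t tT integrable_lead_mode lead_mode_gt0
  (measurable_trunc_drift1 _) (integrable_trunc_drift _)).
Qed.

Lemma measurable_rest_vec N : measurable_fun setT (@rest_vec N).
Proof.
apply: measurable_fun_pair; first exact: (measurable_vec KLa).
apply/measurable_fun_tnthP => i; rewrite (_ : _ \o _ = eta i.+1).
  by apply: (KL_measurable_xi KLb); exact: in_range_tail (ltn_ord i).
by apply/funext => w /=; rewrite tnth_mktuple.
Qed.

(** For [N >= 1] the truncation has positive length, so [nth 0 w 0] is a genuine coordinate and its
    default is never reached. [nth] is used because the length is not syntactically a successor. *)
Lemma KL_sum_lead N (w : (trunc_len Lb N).-tuple R) s : (1 <= N)%N -> t0 <= s <= T ->
  KL_sum P b gam psi w s =
  nth 0 w 0 * lead_mode s + trunc_source (behead_tuple w) s.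
Proof.
move=> N1 sI; have m0 := trunc_len_gt0 N1.
rewrite /trunc_source /KL_on /lead_mode /phi_on sI /KL_sum.
pose G j := Num.sqrt (gam j) * psi j s * nth 0 w j.
have -> : \sum_(j < trunc_len Lb N) Num.sqrt (gam j) * psi j s * tnth w j =
    \sum_(0 <= j < trunc_len Lb N) G j.
  by rewrite big_mkord; apply: eq_bigr => j _; rewrite (tnth_nth 0).
have -> : \sum_(j < (trunc_len Lb N).-1)
      Num.sqrt ((gam \o S) j) * (psi \o S) j s * tnth (behead_tuple w) j =
    \sum_(0 <= j < (trunc_len Lb N).-1) G j.+1.
  by rewrite big_mkord; apply: eq_bigr => j _; rewrite (tnth_nth 0)/= nth_behead.
rewrite -[in LHS](prednK m0) big_nat_recl//= /G.
by ring.
Qed.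

Lemma K_aE N (u : (trunc_len La N).-tuple R) s : s <= T ->
  K_a P t0 a nu phi u s = primitive t0 (trunc_drift u) s.
Proof.
move=> sT; apply: eq_Rintegral => r; rewrite inE/= in_itv/= => /andP[r0 rs].
by rewrite /trunc_drift /KL_on /phi_on r0 (le_trans rs).
Qed.

Lemma trunc_integral_lead N (u : (trunc_len La N).-tuple R)
    (w : (trunc_len Lb N).-tuple R) : (1 <= N)%N ->
  \int[leb]_(s in `[t0, t]%classic)
    (KL_sum P b gam psi w s * expR (- K_a P t0 a nu phi u s)) =
  nth 0 w 0 * @trunc_D N (u, behead_tuple w) + @trunc_E N (u, behead_tuple w).
Proof.
move=> N1; rewrite -(wint_linear tT _ integrable_lead_mode (integrable_trunc_source _)
  (measurable_trunc_drift1 u) (integrable_trunc_drift u)).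
apply: eq_Rintegral => s; rewrite inE/= in_itv/= => /andP[s0 st].
by rewrite K_aE ?KL_sum_lead ?s0 ?(le_trans st).
Qed.

Lemma measurable_nth_tuple n j : measurable_fun setT (fun w : n.-tuple R => nth 0 w j).
Proof.
have [jn|nj] := ltnP j n; last first.
  rewrite (_ : (fun w : n.-tuple R => nth 0 w j) = cst 0)//.
  by apply/funext => w; rewrite nth_default// size_tuple.
rewrite (_ : (fun w : n.-tuple R => nth 0 w j) = fun w => tnth w (Ordinal jn)).
  exact: measurable_tnth.
by apply/funext => w; rewrite (tnth_nth 0).
Qed.

Lemma measurable_behead_tuple n :
  measurable_fun setT (fun w : n.-tuple R => behead_tuple w).
Proof.
apply/measurable_fun_tnthP => i.
rewrite (_ : _ \o _ = fun w : n.-tuple R => nth 0 w i.+1).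
  exact: measurable_nth_tuple.
by apply/funext => w /=; rewrite (tnth_nth 0)/= nth_behead.
Qed.

Lemma nth_vec0 (z : nat -> Omega -> R) N w : (1 <= N)%N ->
  nth 0 (vec Lb z N w) 0 = z 0%N w.
Proof.
move=> /trunc_len_gt0 m0.
by rewrite -[0%N]/(val (Ordinal m0)) -tnth_nth tnth_mktuple.
Qed.

Lemma behead_vec (z : nat -> Omega -> R) N w :
  behead_tuple (vec Lb z N w) = vec_tail Lb z N w.
Proof.
apply: eq_from_tnth => j; rewrite tnth_mktuple (tnth_nth 0)/= nth_behead.
have jm : (j.+1 < trunc_len Lb N)%N by rewrite -ltn_predRL.
transitivity (tnth (vec Lb z N w) (Ordinal jm)); first by rewrite (tnth_nth 0).
by rewrite tnth_mktuple.
Qed.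

(** The integrand of [f1N] is a function of the coefficient vectors times their joint density, hence
    an expectation. The vector for [b] is then split into its head [eta 0] and a tail belonging to
    [rest_vec]. *)
Lemma f1N_expectation (f0 : R -> R)
    (fj : forall N, (trunc_len La N).-tuple R -> (trunc_len Lb N).-tuple R -> R) N x :
  (1 <= N)%N -> measurable_fun setT f0 -> (forall y, 0 <= f0 y) ->
  is_joint_density P (fun w => (vec La xi N w, vec Lb eta N w)) (fj N) ->
  (f1N P t0 a b La Lb nu gam phi psi f0 fj N x t =
   \int[P]_w (f0 (x * expR (- trunc_K (rest_vec N w)) -
       (eta 0%N w * trunc_D (rest_vec N w) + trunc_E (rest_vec N w))) *
     expR (- trunc_K (rest_vec N w)))%:E)%E.
Proof.
move=> N1 mf0 f00 fjN; have m0 := trunc_len_gt0 N1.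
pose h (u : (trunc_len La N).-tuple R) (w : (trunc_len Lb N).-tuple R) : R :=
  f0 (x * expR (- @trunc_K N (u, behead_tuple w)) -
    (nth 0 w 0 * @trunc_D N (u, behead_tuple w) + @trunc_E N (u, behead_tuple w))) *
  expR (- @trunc_K N (u, behead_tuple w)).
pose TT := ((trunc_len La N).-tuple R * (trunc_len Lb N).-tuple R)%type.
have mz : measurable_fun setT (fun z : TT => (z.1, behead_tuple z.2) : trunc_rest N).
  apply: measurable_fun_pair => //.
  by apply: measurableT_comp => //; exact: measurable_behead_tuple.
have mK := measurableT_comp (@measurable_trunc_K N) mz.
have mD := measurableT_comp (@measurable_trunc_D N) mz.
have mE := measurableT_comp (@measurable_trunc_E N) mz.
have mn : measurable_fun setT (fun z : TT => nth 0 z.2 0).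
  exact: (measurableT_comp (@measurable_nth_tuple (trunc_len Lb N) 0) measurable_snd).
have meK : measurable_fun setT (fun z : TT => expR (- @trunc_K N (z.1, behead_tuple z.2))).
  by apply: measurableT_comp => //; exact: measurable_funN mK.
have mh : measurable_fun setT (fun z : TT => h z.1 z.2).
  apply: measurable_funM => //; apply: measurableT_comp => //.
  apply: measurable_funB; first exact: measurable_funM.
  by apply: measurable_funD => //; exact: measurable_funM.
have h0 u w : 0 <= h u w by rewrite mulr_ge0// expR_ge0.
rewrite (_ : f1N _ _ _ _ _ _ _ _ _ _ _ _ _ _ _ =
    iint (fun u => iint (fun w => (h u w * fj N u w)%:E))); last first.
  rewrite /f1N; congr iint; apply/funext => u; congr iint; apply/funext => w.
  by rewrite trunc_integral_lead// K_aE// /h mulrAC.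
rewrite (ge0_integral_joint_density fjN mh h0).
by apply: eq_integral => w _; rewrite /h/= (nth_vec0 eta w N1) (behead_vec eta N w).
Qed.

End truncation.

(** * Error estimates and the limit *)

Section L2_rv.
Context {R : realType} d (Omega : measurableType d) (P : probability Omega R).

Lemma L2_rv_cst (r : R) : L2_rv P (fun=> r).
Proof. by split => //; rewrite integral_probability_cst ltry. Qed.

Lemma L2_rv_norm (X : Omega -> R) : L2_rv P X -> L2_rv P (fun w => `|X w|).
Proof.
move=> [mX X2]; split; first exact: measurableT_comp.
by under eq_integral do rewrite real_normK ?num_real//.
Qed.

Lemma L2_rvZl (c : R) (X : Omega -> R) : L2_rv P X -> L2_rv P (fun w => c * X w).
Proof.
move=> [mX X2]; split; first exact: measurable_funM.
under eq_integral do rewrite exprMn EFinM.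
rewrite ge0_integralZl_EFin ?sqr_ge0//.
- have X0 : (0 <= \int[P]_w (X w ^+ 2)%:E)%E.
    by apply: integral_ge0 => w _; rewrite lee_fin sqr_ge0.
  by rewrite lte_mul_pinfty// lee_fin sqr_ge0.
- by move=> w _; rewrite lee_fin sqr_ge0.
- by apply/measurable_EFinP; exact: measurable_funX.
Qed.

Lemma L2_rvD (X Y : Omega -> R) : L2_rv P X -> L2_rv P Y -> L2_rv P (fun w => X w + Y w).
Proof.
move=> /(L2_rvZl 2)[mX X2] /(L2_rvZl 2)[mY Y2].
have mX' : measurable_fun setT X.
  rewrite (_ : X = fun w => 2^-1 * (2 * X w)); first exact: measurable_funM.
  by apply/funext => w; rewrite mulKf.
have mY' : measurable_fun setT Y.
  rewrite (_ : Y = fun w => 2^-1 * (2 * Y w)); first exact: measurable_funM.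
  by apply/funext => w; rewrite mulKf.
split; first exact: measurable_funD.
have m2 (f : Omega -> R) : measurable_fun setT f -> measurable_fun setT (fun w => (f w ^+ 2)%:E).
  by move=> mf; apply/measurable_EFinP; exact: measurable_funX.
apply: (@le_lt_trans _ _ (\int[P]_w (((2 * X w) ^+ 2)%:E + ((2 * Y w) ^+ 2)%:E))%E).
  apply: ge0_le_integral => //.
  - by move=> w _; rewrite lee_fin sqr_ge0.
  - by apply: m2; exact: measurable_funD.
  - by apply: emeasurable_funD; exact: m2.
  move=> w _; rewrite -EFinD lee_fin.
  by have := sqr_ge0 (X w - Y w); have := sqr_ge0 (X w); have := sqr_ge0 (Y w); nra.
rewrite ge0_integralD//; first by rewrite lte_add_pinfty.
- by move=> w _; rewrite lee_fin sqr_ge0.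
- exact: m2.
- by move=> w _; rewrite lee_fin sqr_ge0.
- exact: m2.
Qed.

End L2_rv.

Section Rintegral_norm_sub_scale.
Context {R : realType} (t0 T : R).
Local Notation leb := (@lebesgue_measure R).
Local Notation I := (`[t0, T]%classic).

Lemma Rintegral_norm_sub_scale (c : R) (f h : R -> R) :
  leb.-integrable I (EFin \o f) -> leb.-integrable I (EFin \o h) ->
  \int[leb]_(s in I) `|f s - c * h s| <=
  \int[leb]_(s in I) `|f s| + `|c| * \int[leb]_(s in I) `|h s|.
Proof.
move=> fI hI.
have mI : measurable (`[t0, T]%classic : set (measurableTypeR R)) by exact: measurable_itv.
have fI' := integrable_norm fI; have hI' := integrable_norm hI.
rewrite -RintegralZl// -RintegralD//; last exact: integrableZl_EFin.
apply: le_Rintegral => //.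
- have B : leb.-integrable I (EFin \o (fun s => f s - c * h s)).
    by apply: integrableB_EFin => //; exact: integrableZl_EFin.
  exact: (integrable_norm B).
- by apply: integrableD_EFin => //; exact: integrableZl_EFin.
by move=> s _; rewrite (le_trans (ler_normB _ _))// normrM.
Qed.

End Rintegral_norm_sub_scale.

(** Here [x], [y], [z] stand for the errors in [K], [D], [E], with [q] the mass of the leading mode
    and [p] that of the source. The product [e * p] is absorbed by [W], and [W >= 1] gives the
    weight to the remaining terms. *)
Lemma combine_error (R : realFieldType) (W q al be e p x y z : R) : 1 <= W ->
  0 <= al -> 0 <= be -> 0 <= q -> 0 <= e -> e * p <= W ->
  x <= al -> y <= e * (q * al) -> z <= e * be + e * (p * al) ->
  W * (x + y) + z <= (2 + e * q + e) * W * (al + be).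
Proof.
move=> W1 al0 be0 q0 e0 pW x1 y1 z1.
have W0 : 0 <= W by lra.
have A1 : W * (x + y) <= W * (al + e * (q * al)) by rewrite ler_wpM2l// lerD.
have A2 : e * (p * al) <= W * al by rewrite mulrA ler_wpM2r.
have A3 : e * be <= W * (e * be) by rewrite ler_peMl// mulr_ge0.
have A4 : 0 <= W * ((2 + e * q) * be + e * al).
  by rewrite mulr_ge0// addr_ge0 ?mulr_ge0// addr_ge0// mulr_ge0.
have -> : (2 + e * q + e) * W * (al + be) =
  W * (al + e * (q * al)) + W * (e * be) + W * al + W * ((2 + e * q) * be + e * al) by ring.
by lra.
Qed.

Section pathwise_error.
Context {R : realType} (t0 T t C : R) (tT : t <= T).
Local Notation leb := (@lebesgue_measure R).
Local Notation I := (`[t0, T]%classic).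
Variables (al al' be be' l : R -> R) (W : R).
Hypotheses (ibe : leb.-integrable I (EFin \o be)) (ibe' : leb.-integrable I (EFin \o be')).
Hypotheses (mal : measurable_fun setT al) (mal' : measurable_fun setT al').
Hypotheses (ial : leb.-integrable I (EFin \o al)) (ial' : leb.-integrable I (EFin \o al')).
Hypotheses (alC : \int[leb]_(r in I) `|al r| <= C) (alC' : \int[leb]_(r in I) `|al' r| <= C).
Hypotheses (il : leb.-integrable I (EFin \o l)) (W_ge1 : 1 <= W).
Hypothesis beW : expR C * \int[leb]_(r in I) `|be' r| <= W.

Lemma wint_lead_dist : `|wint t0 t l al - wint t0 t l al'| <=
  expR C * (\int[leb]_(r in I) `|l r| * \int[leb]_(r in I) `|al r - al' r|).
Proof.
have := weighted_integral_dist tT il il mal mal' ial ial' alC alC'.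
suff -> : \int[leb]_(r in I) `|l r - l r| = 0 by rewrite mulr0 add0r.
under eq_Rintegral do rewrite subrr normr0.
by rewrite /Rintegral integral0.
Qed.

Lemma pathwise_error :
  W * (`|primitive t0 al t - primitive t0 al' t| + `|wint t0 t l al - wint t0 t l al'|) +
    `|wint t0 t be al - wint t0 t be' al'| <=
  (2 + expR C * \int[leb]_(r in I) `|l r| + expR C) * W *
    (\int[leb]_(r in I) `|al r - al' r| + \int[leb]_(r in I) `|be r - be' r|).
Proof.
have H1 := primitive_dist tT ial ial'.
have H2 := wint_lead_dist.
have H3 : `|wint t0 t be al - wint t0 t be' al'| <=
  expR C * \int[leb]_(r in I) `|be r - be' r| +
  expR C * (\int[leb]_(r in I) `|be' r| * \int[leb]_(r in I) `|al r - al' r|).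
  exact: weighted_integral_dist.
apply: combine_error H1 H2 H3; rewrite ?expR_ge0//; exact: Rintegral_ge0.
Qed.

End pathwise_error.

Section limit.
Context {R : realType} d (Omega : measurableType d) (P : probability Omega R).
Context (t0 T t : R) (x0 : Omega -> R) (a b : R -> Omega -> R) (La Lb : option nat).
Context (nu gam : nat -> R) (phi psi : nat -> R -> R) (xi eta : nat -> Omega -> R) (C : R).
Local Notation leb := (@lebesgue_measure R).
Local Notation I := (`[t0, T]%classic).
Local Notation l := (lead_mode t0 T gam psi).
Local Notation q := (\int[leb]_(s in I) `|l s|).
Hypotheses (t0T : t0 < T) (t0t : t0 < t) (tT : t <= T).
Hypotheses (aL2 : L2_process P t0 T a) (bL2 : L2_process P t0 T b) (x0L2 : L2_rv P x0).
Hypotheses (KLa : KL_expansion P t0 T a La nu phi xi).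
Hypotheses (KLb : KL_expansion P t0 T b Lb gam psi eta) (Lb0 : in_range Lb 0).
Hypothesis psi_gt0 : forall s : R, t0 < s < T -> 0 < psi 0%N s.
Hypothesis drift_n : forall N,
  {ae P, forall w, \int[leb]_(s in I) `|KL_on P t0 T a nu phi (vec La xi N w) s| <= C}.
Hypothesis drift : {ae P, forall w, \int[leb]_(s in I) `|path_on t0 T a w s| <= C}.

(** A difference rather than a series: subtracting the first mode avoids any pathwise summation of
    the other modes. *)
Definition lim_source w s := path_on t0 T b w s - eta 0%N w * l s.
Definition lim_K w := primitive t0 (path_on t0 T a w) t.
Definition lim_D w := wint t0 t l (path_on t0 T a w).
Definition lim_E w := wint t0 t (lim_source w) (path_on t0 T a w).
Definition D_min := expR (- C) * \int[leb]_(s in `[t0, t]%classic) l s.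
(** It must dominate both [|x0| + |eta 0| + |lim_E|] and [expR C] times the mass of [lim_source].
    The coefficient [expR C * q] of [|eta 0|] pays for the mode removed from [b]. *)
Definition weight w := 1 + `|x0 w| + (1 + expR C * q) * `|eta 0%N w| +
  expR C * \int[leb]_(s in I) `|path_on t0 T b w s|.

Local Notation il := (integrable_lead_mode t0T KLb Lb0).
Local Notation l_gt0 := (fun s => @lead_mode_gt0 _ _ _ _ _ _ _ _ _ _ _ KLb Lb0 psi_gt0 s).

Lemma D_min_gt0 : 0 < D_min.
Proof. by rewrite mulr_gt0 ?expR_gt0//; exact: (Rintegral_gt0 tT t0t il l_gt0). Qed.

Lemma lead_mass_ge0 : 0 <= q.
Proof. exact: Rintegral_ge0. Qed.

Lemma measurable_eta0 : measurable_fun setT (eta 0%N).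
Proof. exact: (KL_measurable_xi KLb). Qed.

Lemma measurable_swap_path (f : R -> Omega -> R) : L2_process P t0 T f ->
  measurable_fun setT (fun z : Omega * R => path_on t0 T f z.1 z.2).
Proof.
move=> [mf _]; apply: (measurableT_comp mf); exact: measurable_fun_pair.
Qed.

Lemma measurable_lim_K : measurable_fun setT lim_K.
Proof.
apply: (@measurable_integral_itv _ _ _ (fun z : Omega * R => path_on t0 T a z.1 z.2)) => //.
exact: measurable_swap_path.
Qed.

Lemma measurable_lim_D : measurable_fun setT lim_D.
Proof.
apply: (@measurable_wint _ t0 t _ _ (fun z => l z.2) (fun z => path_on t0 T a z.1 z.2)).
- exact: (measurableT_comp (measurable_lead_mode KLb Lb0) measurable_snd).
- exact: measurable_swap_path.
Qed.

Lemma measurable_lim_E : measurable_fun setT lim_E.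
Proof.
apply: (@measurable_wint _ t0 t _ _ (fun z => lim_source z.1 z.2)
  (fun z => path_on t0 T a z.1 z.2)); last exact: measurable_swap_path.
apply: measurable_funB; first exact: measurable_swap_path.
apply: measurable_funM; first exact: (measurableT_comp measurable_eta0 measurable_fst).
exact: (measurableT_comp (measurable_lead_mode KLb Lb0) measurable_snd).
Qed.

(** [eta 0] has second moment 1, and the time integral of [|b|] is square integrable by
    Cauchy-Schwarz in time. *)
Lemma L2_rv_weight : L2_rv P weight.
Proof.
have etaL2 : L2_rv P (eta 0%N).
  split; first exact: measurable_eta0.
  have [_ _ [_ _ [_ cov _]]] := KLb.
  by have := cov _ _ Lb0 Lb0; under eq_integral do rewrite -expr2; move=> ->; exact: ltry.
have bintL2 : L2_rv P (fun w => \int[leb]_(s in I) `|path_on t0 T b w s|).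
  have [mb b2] := bL2; split.
    apply: (@measurable_integral_itv _ _ _ (fun z : Omega * R => `|path_on t0 T b z.1 z.2|)) => //.
    by apply: measurableT_comp => //; exact: measurable_swap_path.
  apply: (le_lt_trans (integral_sqr_Rintegral_le P t0T mb)).
  have B0 : (0 <= \int[leb \x P]_z (restr t0 T b z ^+ 2)%:E)%E.
    by apply: integral_ge0 => z _; rewrite lee_fin sqr_ge0.
  by rewrite lte_mul_pinfty// lee_fin subr_ge0 ltW.
apply: L2_rvD; last exact: L2_rvZl.
apply: L2_rvD; last by apply: L2_rvZl; exact: L2_rv_norm.
by apply: L2_rvD; [exact: L2_rv_cst|exact: L2_rv_norm].
Qed.

Lemma weight_ge1 w : 1 <= weight w.
Proof.
rewrite /weight -!addrA lerDl !addr_ge0// mulr_ge0 ?expR_ge0//.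
  by rewrite addr_ge0// mulr_ge0 ?expR_ge0// lead_mass_ge0.
exact: Rintegral_ge0.
Qed.

Lemma integrable_lim_source w : leb.-integrable I (EFin \o path_on t0 T b w) ->
  leb.-integrable I (EFin \o lim_source w).
Proof.
move=> ib; have mI : measurable (I : set (measurableTypeR R)) by exact: measurable_itv.
by apply: integrableB_EFin => //; apply: integrableZl_EFin => //; exact: il.
Qed.

Lemma lim_source_weight w : leb.-integrable I (EFin \o path_on t0 T b w) ->
  1 + `|x0 w| + `|eta 0%N w| + expR C * \int[leb]_(s in I) `|lim_source w s| <= weight w.
Proof.
move=> ib; have := Rintegral_norm_sub_scale (eta 0%N w) ib il.
move=> /(ler_wpM2l (expR_ge0 C)) H.
have -> : weight w = 1 + `|x0 w| + `|eta 0%N w| +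
  expR C * (\int[leb]_(s in I) `|path_on t0 T b w s| + `|eta 0%N w| * q).
  by rewrite /weight; ring.
exact: lerD.
Qed.

(** The truncated source also loses exactly [eta 0 * l]. This term cancels against the one in
    [lim_source], so the error of the sources is the expansion error of [b]. *)
Lemma trunc_source_vec N w s : (1 <= N)%N -> t0 <= s <= T ->
  trunc_source P t0 T b gam psi (vec_tail Lb eta N w) s =
  KL_on P t0 T b gam psi (vec Lb eta N w) s - eta 0%N w * l s.
Proof.
move=> N1 sI; rewrite [in RHS]/KL_on [in RHS]/phi_on sI (@KL_sum_lead _ _ _ _ t0 T)//.
by rewrite (nth_vec0 Lb0)// behead_vec addrAC subrr add0r.
Qed.

Lemma lim_bounds_ae : {ae P, forall w, [/\ `|lim_K w| <= C, D_min <= lim_D w,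
  lim_D w <= expR C * q & `|x0 w| + `|eta 0%N w| + `|lim_E w| <= weight w]}.
Proof.
apply: filterS3 (ae_integrable_path_on t0T aL2) (ae_integrable_path_on t0T bL2) drift.
move=> w ia ib aC; have ma := measurable_path_on aL2 w.
have H := lim_source_weight ib.
have H' : `|lim_E w| <= expR C * \int[leb]_(s in I) `|lim_source w s|.
  by apply: weighted_integral_le => //; exact: integrable_lim_source.
split.
- exact: le_trans (primitive_le tT ia) aC.
- exact: (weighted_integral_ge tT il l_gt0 ma ia aC).
- by apply: le_trans (ler_norm _) _; exact: (weighted_integral_le tT il ma ia aC).
- apply: le_trans (lerD (lexx _) H') _; apply: le_trans H.
  by rewrite -!addrA lerDr.
Qed.

Lemma trunc_bounds_ae N : {ae P, forall w,
  `|trunc_K P t0 T t a nu phi (rest_vec La Lb xi eta N w)| <= C /\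
  D_min <= trunc_D P t0 T t a nu gam phi psi (rest_vec La Lb xi eta N w)}.
Proof.
apply: filterS (drift_n N) => w aC.
have ia := integrable_trunc_drift t0T aL2 KLa (vec La xi N w).
have ma := measurable_trunc_drift1 aL2 KLa (vec La xi N w).
split; first exact: le_trans (primitive_le tT ia) aC.
exact: (weighted_integral_ge tT il l_gt0 ma ia aC).
Qed.

Definition error_bound N w := (2 + expR C * q + expR C) * weight w *
  (KL_dist P t0 T a La nu phi xi N w + KL_dist P t0 T b Lb gam psi eta N w).

Lemma trunc_errors_ae N : (1 <= N)%N -> {ae P, forall w,
  let z := rest_vec La Lb xi eta N w in
  weight w * (`|trunc_K P t0 T t a nu phi z - lim_K w| +
    `|trunc_D P t0 T t a nu gam phi psi z - lim_D w|) +
  `|trunc_E P t0 T t a b nu gam phi psi z - lim_E w| <= error_bound N w}.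
Proof.
move=> N1.
apply: filterS3 (filterI (drift_n N) (ae_integrable_path_on t0T aL2))
  (ae_integrable_path_on t0T bL2) drift => w [aCn ia] ib aC /=.
have ian := integrable_trunc_drift t0T aL2 KLa (vec La xi N w).
have man := measurable_trunc_drift1 aL2 KLa (vec La xi N w).
have ma := measurable_path_on aL2 w.
have ibn := integrable_trunc_source t0T bL2 KLb (vec_tail Lb eta N w).
have iB := integrable_lim_source ib.
have bW : expR C * \int[leb]_(s in I) `|lim_source w s| <= weight w.
  by apply: le_trans (lim_source_weight ib); rewrite lerDr !addr_ge0.
apply: le_trans (pathwise_error tT ibn iB man ma ian ia aCn aC il (weight_ge1 w) bW) _.
rewrite /error_bound; suff -> : KL_dist P t0 T b Lb gam psi eta N w =
  \int[leb]_(r in I) `|trunc_source P t0 T b gam psi (vec_tail Lb eta N w) r -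
    lim_source w r| by [].
apply: eq_Rintegral => s; rewrite inE/= in_itv/= => sI.
by rewrite trunc_source_vec// /lim_source; congr `| _ |; ring.
Qed.

Lemma error_bound_ge0 N w : 0 <= error_bound N w.
Proof.
have W0 : 0 <= weight w by exact: le_trans (weight_ge1 w).
apply: mulr_ge0; last by rewrite addr_ge0// KL_dist_ge0.
apply: mulr_ge0 => //.
by rewrite !addr_ge0 ?expR_ge0// mulr_ge0 ?expR_ge0// lead_mass_ge0.
Qed.

Lemma measurable_error_bound N : measurable_fun setT (error_bound N).
Proof.
have [mW _] := L2_rv_weight.
apply: measurable_funM; first exact: measurable_funM.
by apply: measurable_funD; exact: measurable_KL_dist.
Qed.

Lemma error_bound_cvg0 (e : R) : 0 < e ->
  \forall n \near \oo, (\int[P]_w (error_bound n w)%:E <= e%:E)%E.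
Proof.
have [mW W2] := L2_rv_weight; move: e.
apply: product_sqr_cvg0 => //.
- by move=> n; exact: measurable_KL_dist.
- by move=> n; exact: measurable_KL_dist.
- by rewrite !addr_ge0 ?expR_ge0// mulr_ge0 ?expR_ge0// lead_mass_ge0.
- by move=> w; exact: le_trans (weight_ge1 w).
- by move=> n w; exact: KL_dist_ge0.
- by move=> n w; exact: KL_dist_ge0.
- by move=> e; exact: KL_dist_cvg0.
- by move=> e; exact: KL_dist_cvg0.
Qed.

Lemma sol_ae : {ae P, forall w,
  sol t0 x0 a b t w = expR (lim_K w) * (x0 w + eta 0%N w * lim_D w + lim_E w)}.
Proof.
apply: filterS2 (ae_integrable_path_on t0T aL2) (ae_integrable_path_on t0T bL2) => w ia ib.
exact: (solE tT x0 (eta 0%N w) (measurable_path_on aL2 w) ia ib il).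
Qed.

End limit.

Theorem theorem4 (R : realType) (d : measure_display) (Omega : measurableType d)
  (P : probability Omega R) (t0 T : R) (x0 : Omega -> R) (a b : R -> Omega -> R)
  (La Lb : option nat) (nu gam : nat -> R) (phi psi : nat -> R -> R)
  (xi eta : nat -> Omega -> R) :
  complete_prob P ->
  t0 < T ->
  (* Karhunen-Loeve expansions of a and b; b has at least one nonzero eigenvalue *)
  KL_expansion P t0 T a La nu phi xi ->
  KL_expansion P t0 T b Lb gam psi eta ->
  in_range Lb 0 ->
  (* (H1) *)
  L2_process P t0 T a -> L2_process P t0 T b -> L2_rv P x0 ->
  (* (H2) *)
  (forall N : nat, (1 <= N)%N ->
     [/\ abs_continuous P x0, abs_continuous P (eta 0%N),
         abs_continuous_vec P (fun w => (vec La xi N w, vec_tail Lb eta N w)) &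
         independent3 P x0 (eta 0%N)
           (fun w => (vec La xi N w, vec_tail Lb eta N w))]) ->
  (* (H3) *)
  (exists g : R -> R, is_density P (eta 0%N) g /\
     exists C : R, forall x y : R, `|g x - g y| <= C * `|x - y|) ->
  (* (H4) *)
  (exists A : R, 0 < A /\
     forall j, in_range La j -> P [set w | - A <= xi j w <= A] = 1%E) ->
  (forall s : R, t0 < s < T -> 0 < psi 0%N s) ->
  (* f0 : density of x0; fj N : joint density of (xi_N, eta_N) *)
  forall f0 : R -> R, is_density P x0 f0 ->
  forall fj : forall N : nat,
      (trunc_len La N).-tuple R -> (trunc_len Lb N).-tuple R -> R,
  (forall N : nat, (1 <= N)%N ->
     is_joint_density P (fun w => (vec La xi N w, vec Lb eta N w)) (fj N)) ->
  forall t : R, t0 < t <= T ->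
  exists f1 : R -> R,
    is_density P (sol t0 x0 a b t) f1 /\
    forall J : set R, (exists M : R, forall x, J x -> `|x| <= M) ->
      forall eps : R, 0 < eps ->
        \forall N \near \oo,
          {ae @lebesgue_measure R, forall x : R, J x ->
             (`| f1N P t0 a b La Lb nu gam phi psi f0 fj N x t - (f1 x)%:E |
                <= eps%:E)%E}.
Proof.
move=> _ t0T KLa KLb Lb0 aL2 bL2 x0L2 indep [g [eta_g [Cg0 gL0]]] [A [_ xiA]] psi0.
move=> f0 x0_f0 fj fjN t /andP[t0t tT].
have [C [drift_n drift]] := KL_drift_bound t0T aL2 KLa xiA.
have [meta g0 mg gP] := eta_g; have [_ f00 mf0 _] := x0_f0; have [mx0 _] := x0L2.
have [ma _] := aL2; have [mb _] := bL2.
pose Cg : R := `|Cg0|.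
have gL x y : `|g x - g y| <= Cg * `|x - y|.
  by rewrite (le_trans (gL0 x y))// ler_wpM2r// ler_norm.
have g1 : (\int[@lebesgue_measure R]_x (g x)%:E <= 1)%E.
  by rewrite -gP// preimage_setT probability_le1.
have gM y : 0 <= g y <= 1 + `|Cg0|.
  by rewrite g0 (lipschitz_density_bounded mg g0 g1 gL0).
(* All sequences are shifted by one: index [n] stands for the truncation [N = n.+1], since densities
   and independence are assumed for [N >= 1]. *)
pose z n := rest_vec La Lb xi eta n.+1.
pose kT n := @trunc_K R d Omega P t0 T t a La Lb nu phi n.+1.
pose DT n := @trunc_D R d Omega P t0 T t a La Lb nu gam phi psi n.+1.
pose ET n := @trunc_E R d Omega P t0 T t a b La Lb nu gam phi psi n.+1.
have mz n : measurable_fun setT (z n).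
  exact: (measurable_rest_vec KLa KLb).
have mkT n : measurable_fun setT (kT n).
  exact: (measurable_trunc_K t aL2 KLa).
have mDT n : measurable_fun setT (DT n).
  exact: (measurable_trunc_D t aL2 KLa KLb Lb0).
have mET n : measurable_fun setT (ET n).
  exact: (measurable_trunc_E t aL2 bL2 KLa KLb).
have DT_gt0 n v : 0 < DT n v.
  exact: (trunc_D_gt0 t0T t0t tT aL2 KLa KLb Lb0 psi0 v).
pose k := lim_K t0 T t a.
pose d0 := D_min t0 T t gam psi C.
have d0_gt0 : 0 < d0.
  exact: (D_min_gt0 C t0T t0t tT KLb Lb0 psi0).
(* the maximum is [lim_D] almost surely, but positive everywhere *)
pose D w := Num.max d0 (lim_D t0 T t a gam psi w).
pose E := lim_E t0 T t a b gam psi eta.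
pose W := weight t0 T x0 b gam psi eta C.
(* The almost sure upper bound of [lim_D], raised to 1 because the estimate for solutions asks for
   [1 <= d1]. *)
pose d1 : R := Num.max 1 (expR C * \int[@lebesgue_measure R]_(s in `[t0, T]%classic)
  `|lead_mode t0 T gam psi s|).
have mk : measurable_fun setT k.
  exact: (measurable_lim_K t aL2).
have mD : measurable_fun setT D.
  by apply: measurable_maxr => //; exact: (measurable_lim_D t aL2 KLb Lb0).
have mE : measurable_fun setT E.
  exact: (measurable_lim_E t aL2 bL2 KLb Lb0).
have D_gt0 w : 0 < D w by rewrite lt_max d0_gt0.
have limB := lim_bounds_ae x0 t0T tT aL2 bL2 KLb Lb0 psi0 drift.
have DE : {ae P, forall w, D w = lim_D t0 T t a gam psi w}.
  by apply: filterS limB => w [_ /max_r].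
pose Delta n := error_bound P t0 T x0 a b La Lb nu gam phi psi xi eta C n.+1.
have lim_bounds : {ae P, forall w, [/\ `|k w| <= C, d0 <= D w, D w <= d1, 1 <= W w &
    `|x0 w| + `|eta 0%N w| + `|E w| <= W w]}.
  apply: filterS2 DE limB => w Dw [kC dD Dd sW]; split => //.
  - by rewrite le_max lexx.
  - by rewrite Dw le_max Dd orbT.
  - exact: weight_ge1.
have n_bounds n : {ae P, forall w, `|kT n (z n w)| <= C /\ d0 <= DT n (z n w)}.
  exact: (trunc_bounds_ae t0T tT aL2 KLa KLb Lb0 psi0 drift_n).
have errors n : {ae P, forall w, W w * (`|kT n (z n w) - k w| + `|DT n (z n w) - D w|) +
    `|ET n (z n w) - E w| <= Delta n w}.
  have H := trunc_errors_ae x0 t0T tT aL2 bL2 KLa KLb Lb0 drift_n drift (ltn0Sn n).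
  by apply: filterS2 DE H => w ->.
have Delta_cvg0 (e : R) : 0 < e -> \forall n \near \oo, (\int[P]_w (Delta n w)%:E <= e%:E)%E.
  move=> e0; have [N _ HN] := error_bound_cvg0 C t0T aL2 bL2 x0L2 KLa KLb Lb0 e0.
  exists N; first exact: I.
  move=> n Nn.
  exact: (HN n.+1 (leqW Nn)).
have mDelta n : measurable_fun setT (Delta n).
  exact: (measurable_error_bound C t0T aL2 bL2 x0L2 KLa KLb Lb0).
have Delta_ge0 n w : 0 <= Delta n w.
  exact: (error_bound_ge0 _ _ _ _ _ _ _ _ _ _ _ _ _ _ _ _ _).
have ind n := let: And4 _ _ _ i := indep n.+1 isT in i.
have law_n n (h : R -> R) : measurable_fun setT h -> (forall x, 0 <= h x) ->
  (\int[P]_w (h (expR (kT n (z n w)) * (x0 w + eta 0%N w * DT n (z n w) + ET n (z n w))))%:E =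
   \int[@lebesgue_measure R]_x ((h x)%:E * \int[P]_w
     (affine_density g (kT n (z n w)) (DT n (z n w)) (ET n (z n w)) (x0 w) x)%:E))%E.
  move=> mh h0.
  apply: (ge0_integral_affine_law eta_g mx0 (mz n) (mkT n) (mDT n) (mET n) (DT_gt0 n)) => //.
  exact: (independent3_pair mx0 meta (mz n) (ind n)).
have mk_ n := measurableT_comp (mkT n) (mz n).
have mD_ n := measurableT_comp (mDT n) (mz n).
have mE_ n := measurableT_comp (mET n) (mz n).
have D_n_gt0 n w : 0 < DT n (z n w) by exact: DT_gt0.
have XE : {ae P, forall w, sol t0 x0 a b t w = expR (k w) * (x0 w + eta 0%N w * D w + E w)}.
  by apply: filterS2 DE (sol_ae x0 t0T tT aL2 bL2 KLb Lb0) => w ->.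
have mX := measurable_sol tT mx0 ma mb.
have d1_ge1 : 1 <= d1 by rewrite le_max lexx.
(* The mean kernel of the limit, with [D] in place of [lim_D] so that the division is by a positive
   number for every [w]. *)
exists (fun x => \int[P]_w affine_density g (k w) (D w) (E w) (x0 w) x).
split.
  exact: (density_limit_is_density mg gM (normr_ge0 Cg0) gL d0_gt0 d1_ge1 mx0 meta mk mD mE mX
    mk_ mD_ mE_ mDelta Delta_ge0 D_gt0 D_n_gt0 lim_bounds n_bounds errors Delta_cvg0 XE law_n).
move=> J [M JM] eps eps0.
have [N0 _ HN0] := density_limit_cvg mg gM (normr_ge0 Cg0) gL d0_gt0 mx0 mk mD mE
    mk_ mD_ mE_ mDelta Delta_ge0 D_gt0 D_n_gt0 lim_bounds n_bounds errors Delta_cvg0 M eps0.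
(* The successor undoes the shift and excludes [N = 0]. The bound then holds at every point of [J],
   hence almost everywhere. *)
exists N0.+1 => // -[//|n] /= N0n; apply: aeW => x Jx.
rewrite (f1N_expectation t0T tT aL2 bL2 KLa KLb Lb0 x _ mf0 f00 (fjN n.+1 isT))//.
(* Here [f0] disappears: the expectation becomes the mean kernel built from [g], to which the
   uniform convergence applies. *)
rewrite (integral_affine_density_x0 eta_g mx0 (mz n) (mkT n) (mDT n) (mET n) (DT_gt0 n) x x0_f0
  (independent3_23 (ind n)) (independent3_13 (ind n))).
have In := integrable_affine_density_n mg gM d0_gt0 mx0 mk_ mD_ mE_ D_n_gt0 n_bounds n x.
rewrite -(fineK (integrable_fin_num measurableT In)) -EFinB abse_EFin lee_fin.
exact: HN0 (JM _ Jx).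
Qed.
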